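(* Let $g\in H(\mathbb{D})$ satisfy $g',\frac1{g'}\in H^\infty$ and let $V_g\colon A(\mathbb{D})\to A(\mathbb{D})$ be continuous. (i) $H^1\subseteq[V_g,A(\mathbb{D})]=[T_g,A(\mathbb{D})]\subseteq A^{-1}_0$. (ii) $H^1\subseteq[V_g,H^\infty]=[T_g,H^\infty]\subseteq A^{-1}$.
   Context: $\mathbb{D}=\{z\in\mathbb{C}:|z|<1\}$; $H(\mathbb{D})$ is the Fréchet space of all analytic functions on $\mathbb{D}$ with the topology of uniform convergence on compact sets; $H^1$ and $H^\infty$ are the classical Hardy spaces on $\mathbb{D}$; $A(\mathbb{D})$ is the disc algebra (functions in $H(\mathbb{D})$ extending continuously to $\overline{\mathbb{D}}$, with the sup-norm). The condition $\frac1{g'}\in H^\infty$ means that $g'$ has no zeros in $\mathbb{D}$ and $1/g'$ is bounded. $A^{-1}:=\{f\in H(\mathbb{D}):\sup_{z\in\mathbb{D}}(1-|z|)|f(z)|<\infty\}$ and $A^{-1}_0:=\{f\in H(\mathbb{D}):\lim_{|z|\to1^-}(1-|z|)|f(z)|=0\}$. For $g,f\in H(\mathbb{D})$, $(V_gf)(z):=\int_0^z f(\xi)g'(\xi)\,d\xi$ for $z\in\mathbb{D}$, and $(T_gf)(z):=\frac1z\int_0^z f(\xi)g'(\xi)\,d\xi$ for $z\in\mathbb{D}\setminus\{0\}$, $(T_gf)(0):=f(0)g'(0)$. For $X$ a Banach space continuously included in $H(\mathbb{D})$ and $T\colon H(\mathbb{D})\to H(\mathbb{D})$ continuous linear with $T(X)\subseteq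 X$, the optimal domain is $[T,X]:=\{f\in H(\mathbb{D}):Tf\in X\}$ with (semi-)norm $\|f\|_{[T,X]}:=\|Tf\|_X$. Saying that $T\colon X\to X$ is continuous includes that $T(X)\subseteq X$. *)

(* Defs.v *)
From Stdlib Require Import Reals Lra.
From Coquelicot Require Export Coquelicot.

Open Scope R_scope.

(** Functions on the unit disc are total functions [C -> C].  Every notion below
    depends only on the values taken on the open disc, so that a predicate
    [X : (C -> C) -> Prop] stands for a set of functions on the disc. *)

Definition unit_disc (z : C) : Prop := Cmod z < 1.

Definition closed_unit_disc (z : C) : Prop := Cmod z <= 1.

Definition analytic_on_disc (f : C -> C) : Prop :=
  forall z : C, unit_disc z -> ex_derive (K := C_AbsRing) (V := C_NormedModule) f z.

Definition sup_on_disc (u : C -> R) : Rbar :=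
  Lub_Rbar (fun x : R => exists z : C, unit_disc z /\ x = u z).

Definition sup_norm (f : C -> C) : Rbar := sup_on_disc (fun z => Cmod (f z)).

Definition Hardy_infty (f : C -> C) : Prop :=
  analytic_on_disc f /\ Rbar_lt (sup_norm f) p_infty.

Definition expi (t : R) : C := (cos t, sin t).

Definition integral_mean (f : C -> C) (r : R) : R :=
  / (2 * PI) * RInt (fun t : R => Cmod (f (RtoC r * expi t)%C)) 0 (2 * PI).

Definition Hardy_1_norm (f : C -> C) : Rbar :=
  Lub_Rbar (fun x : R => exists r : R, 0 <= r < 1 /\ x = integral_mean f r).

Definition Hardy_1 (f : C -> C) : Prop :=
  analytic_on_disc f /\ Rbar_lt (Hardy_1_norm f) p_infty.

Definition disc_algebra (f : C -> C) : Prop :=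
  analytic_on_disc f /\
  exists h : C -> C,
    continuous_on (T := C_UniformSpace) (U := C_UniformSpace) closed_unit_disc h /\
    forall z : C, unit_disc z -> h z = f z.

(** The growth space $A^{-1}$. *)
Definition growth_space (f : C -> C) : Prop :=
  analytic_on_disc f /\
  Rbar_lt (sup_on_disc (fun z => (1 - Cmod z) * Cmod (f z))) p_infty.

(** The filter of [|z| -> 1-]. *)
Definition to_unit_circle (P : C -> Prop) : Prop :=
  at_left 1 (fun r : R => forall z : C, Cmod z = r -> P z).

(** The little growth space $A^{-1}_0$. *)
Definition little_growth_space (f : C -> C) : Prop :=
  analytic_on_disc f /\
  filterlim (fun z : C => (1 - Cmod z) * Cmod (f z)) to_unit_circle (locally 0).

(** $\int_0^z F(\xi)\,d\xi$ along the segment from $0$ to $z$, parametrised by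
    $\xi = tz$; for analytic [F] the path is immaterial. *)
Definition integral_from_0 (F : C -> C) (z : C) : C :=
  RInt (V := C_R_CompleteNormedModule)
    (fun t : R => (F (RtoC t * z) * z)%C) 0 1.

Definition volterra (g f : C -> C) (z : C) : C :=
  integral_from_0 (fun xi : C => (f xi * C_derive g xi)%C) z.

Definition cesaro (g f : C -> C) (z : C) : C :=
  if Ceq_dec z (RtoC 0) then (f (RtoC 0) * C_derive g (RtoC 0))%C
  else (/ z * volterra g f z)%C.

Definition opt_domain (T : (C -> C) -> (C -> C)) (X : (C -> C) -> Prop)
    (f : C -> C) : Prop :=
  analytic_on_disc f /\ X (T f).

(** [T] maps the space [X], normed by [N], continuously into itself. *)
Definition continuous_operator (X : (C -> C) -> Prop) (N : (C -> C) -> Rbar)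
    (T : (C -> C) -> (C -> C)) : Prop :=
  (forall f : C -> C, X f -> X (T f)) /\
  forall f : C -> C, X f -> forall eps : posreal, exists delta : posreal,
    forall h : C -> C, X h ->
      Rbar_lt (N (fun z => (h z - f z)%C)) delta ->
      Rbar_lt (N (fun z => (T h z - T f z)%C)) eps.

(* Main.v *)
(** Put [h = f g']; then [V_g f] is the primitive [F] of [h] vanishing at [0] (Goursat),
    [T_g f] is the analytic function [F(z)/z], and [|f|] is at most a constant times [|h|].
    The growth bounds are the Cauchy estimate [s |h(z)| <= sup |F(z + s e^it) - F(z)|], with
    uniform continuity of [F] on the closed disc giving the little-o version.

    The only deep point is that [F] extends continuously to the closed disc when [h] is in
    [H^1], i.e. that the functions [|h(s e^it)|], [s < 1], are uniformly integrable.  Here this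
    follows without boundary values or factorization.  The function [|k|^(1/2)] has the
    sub-mean-value property for analytic [k].  Apply it to [k(w) = h(s e^it phi(w))], where
    [phi(w) = (w + a)/(1 + a w)] and [a = s0/s], so that [phi(0) = a] while [phi] maps the unit
    circle to itself.  Expanding the square, the mean over [alpha] and [t] of
    [(|h(s e^it phi(e^i alpha))|^(1/2) - |h(s0 e^it)|^(1/2))^2] is at most the difference of the
    means of [|h|] on the circles of radius [s] and [s0].  Choosing [s0] with nearly maximal mean,
    some rotation of [|h(s .)|^(1/2)] is [L^2]-close to the fixed bounded function
    [|h(s0 .)|^(1/2)], for every [s > s0]. *)

Require Import Defs.
From Stdlib Require Import Reals Lra Lia ClassicalEpsilon.
From Coquelicot Require Import Coquelicot.

Open Scope R_scope.

(** All integrals are Riemann integrals of continuous functions over circles of radius s < 1, so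
    every estimate has to be uniform in s. The oscillation of F along an arc is controlled by the
    mass of |h| on it, and for general functions a bound on the means does not keep that mass from
    concentrating on short arcs as s tends to 1; analyticity has to enter at this point. The
    exponent 1/2 turns the L^1 question into an L^2 one: the cross term of the expanded square is
    exactly what a sub-mean-value inequality bounds from below. A logarithm would have to deal with
    the zeros of k; the square root is reached through products of rotated copies of k, to which the
    mean value property applies as it stands. Small oscillation along arcs of one fixed length is
    then enough: averaging over such an arc controls F radially as well, and the maximum principle
    carries the bound from the circle to the closed disc, so that the dilates F(s z) converge
    uniformly there. *)

(** * Complex derivatives and continuity in epsilon-delta form *)

Definition holo (R : R) (f : C -> C) : Prop :=
  forall z : C, Cmod z < R -> ex_derive (K := C_AbsRing) (V := C_NormedModule) f z.

Notation Ccontinuous := (continuous (T := C_UniformSpace) (U := C_UniformSpace)).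

Definition CInt (f : R -> C) (a b : R) : C := RInt (V := C_R_CompleteNormedModule) f a b.
Notation ex_CInt := (ex_RInt (V := C_R_NormedModule)).

(** The differential behind [is_derive] quantifies over all limits of the neighbourhood filter of
    [z]; uniqueness of limits leaves only [z] itself, and what remains is an estimate in [Cmod]. *)
Lemma Cderive_iff (f : C -> C) (z l : C) :
  is_derive (K := C_AbsRing) (V := C_NormedModule) f z l <->
  forall eps : posreal, exists d : posreal, forall w : C, Cmod (w - z) < d ->
    Cmod (f w - f z - (w - z) * l) <= eps * Cmod (w - z).
Proof.
  split.
  - intros [_ H] eps.
    destruct (H z (fun P HP => HP) eps) as [d Hd].
    exists d; intros w Hw; exact (Hd w Hw).
  - intros H; split.
    + apply (is_linear_scal_l (K := C_AbsRing) (V := C_NormedModule) l).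
    + intros x Hx eps.
      assert (x = z) as ->.
      { symmetry. now apply (is_filter_lim_locally_unique (K:=C_AbsRing) (V:=AbsRing_NormedModule C_AbsRing)). }
      destruct (H eps) as [d Hd].
      exists d; intros w Hw; exact (Hd w Hw).
Qed.

(** The balls of [C_UniformSpace] are squares, those of [Cmod] are discs; a square lies in the disc
    whose radius is larger by the factor sqrt 2. *)
Lemma Ccontinuous_iff (f : C -> C) (z : C) :
  Ccontinuous f z <->
  forall eps : posreal, exists d : posreal, forall w : C, Cmod (w - z) < d ->
    Cmod (f w - f z) < eps.
Proof.
  assert (Hs : 0 < sqrt 2) by (apply sqrt_lt_R0; lra).
  split.
  - intros H eps.
    assert (He : 0 < eps / sqrt 2) by (apply Rdiv_lt_0_compat; [apply eps | lra]).
    destruct (proj1 (filterlim_locally f (f z)) H (mkposreal _ He)) as [d Hd].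
    exists d; intros w Hw.
    assert (Hb : ball (M := C_UniformSpace) z d w)
      by (apply C_NormedModule_mixin_compat1; exact Hw).
    specialize (Hd w Hb).
    apply C_NormedModule_mixin_compat2 in Hd. simpl in Hd.
    replace (pos eps) with (sqrt 2 * (eps / sqrt 2)) by (field; lra).
    exact Hd.
  - intros H; apply filterlim_locally; intros eps.
    destruct (H eps) as [d Hd].
    assert (He : 0 < d / sqrt 2) by (apply Rdiv_lt_0_compat; [apply d | lra]).
    exists (mkposreal _ He). intros w Hw.
    apply C_NormedModule_mixin_compat1. apply Hd.
    apply C_NormedModule_mixin_compat2 in Hw. simpl in Hw.
    replace (pos d) with (sqrt 2 * (d / sqrt 2)) by (field; lra).
    exact Hw.
Qed.

Lemma ex_derive_Ccontinuous (f : C -> C) (z : C) :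
  ex_derive (K := C_AbsRing) (V := C_NormedModule) f z -> Ccontinuous f z.
Proof.
  intros [l Hl]. apply Ccontinuous_iff. intros eps.
  destruct (proj1 (Cderive_iff f z l) Hl (mkposreal 1 Rlt_0_1)) as [d Hd].
  simpl in Hd.
  assert (Hm := Cmod_ge_0 l).
  assert (Hp : 0 < Rmin d (eps / (2 + Cmod l))).
  { apply Rmin_pos; [apply d|]. apply Rdiv_lt_0_compat; [apply eps | lra]. }
  exists (mkposreal _ Hp); simpl. intros w Hw.
  assert (H1 := Rlt_le_trans _ _ _ Hw (Rmin_l _ _)).
  assert (H2 := Rlt_le_trans _ _ _ Hw (Rmin_r _ _)).
  replace (f w - f z)%C with ((f w - f z - (w - z) * l) + (w - z) * l)%C by ring.
  eapply Rle_lt_trans; [apply Cmod_triangle|]. rewrite (Cmod_mult (w - z)).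
  specialize (Hd w H1).
  apply (Rmult_lt_compat_r (2 + Cmod l)) in H2; [|lra].
  unfold Rdiv in H2. rewrite Rmult_assoc, Rinv_l, Rmult_1_r in H2 by lra.
  assert (H0 := Cmod_ge_0 (w - z)). nra.
Qed.

Lemma holo_continuous R f z : holo R f -> Cmod z < R -> Ccontinuous f z.
Proof. intros H Hz. now apply ex_derive_Ccontinuous, H. Qed.

(** * Rules of complex differentiation *)

Section Calculus.
Notation exd := (ex_derive (K := C_AbsRing) (V := C_NormedModule)).
Notation isd := (is_derive (K := C_AbsRing) (V := C_NormedModule)).

Lemma Cderive_const c z : isd (fun _ => c) z (RtoC 0).
Proof. apply (is_derive_const (K := C_AbsRing) (V := C_NormedModule)). Qed.

(** The product and chain rules speak of maps into [AbsRing_NormedModule C_AbsRing], the analytic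
    functions here of maps into [C_NormedModule]; the estimate inside both derivatives is the
    same. *)
Lemma Cderive_AbsRing f z l :
  isd f z l <-> is_derive (K := C_AbsRing) (V := AbsRing_NormedModule C_AbsRing) f z l.
Proof.
  split; intros [_ H].
  - split; [apply (is_linear_scal_l (K := C_AbsRing) (V := AbsRing_NormedModule C_AbsRing) l)|].
    exact H.
  - split; [apply (is_linear_scal_l (K := C_AbsRing) (V := C_NormedModule) l)|].
    exact H.
Qed.

Lemma Cderive_id z : isd (fun w => w) z (RtoC 1).
Proof. apply Cderive_AbsRing, (is_derive_id (K := C_AbsRing)). Qed.

Lemma Cderive_plus f g z a b :
  isd f z a -> isd g z b -> isd (fun w => (f w + g w)%C) z (a + b)%C.
Proof. apply (is_derive_plus (K := C_AbsRing) (V := C_NormedModule)). Qed.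

Lemma Cderive_mult f g z a b :
  isd f z a -> isd g z b -> isd (fun w => (f w * g w)%C) z (a * g z + f z * b)%C.
Proof.
  rewrite !Cderive_AbsRing. intros Hf Hg.
  exact (is_derive_mult (K := C_AbsRing) f g z a b Hf Hg Cmult_comm).
Qed.

Lemma Cderive_comp f g z a b :
  isd f (g z) a -> isd g z b -> isd (fun w => f (g w)) z (b * a)%C.
Proof.
  rewrite (Cderive_AbsRing g). intros Hf Hg.
  exact (is_derive_comp (K := C_AbsRing) (V := C_NormedModule) f g z a b Hf Hg).
Qed.

Lemma Cderive_inv z : z <> RtoC 0 -> isd Cinv z (- / (z * z))%C.
Proof.
  intros Hz. apply Cderive_iff. intros eps.
  assert (Hm : 0 < Cmod z) by now apply Cmod_gt_0.
  (* The remainder is (w - z)^2 / (w z^2). The first bound gives |w| > |z|/2; with it the second one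
     gives |w - z| <= eps |w| |z|^2. *)
  assert (Hp : 0 < Rmin (Cmod z / 2) (eps * (Cmod z * Cmod z * Cmod z) / 2)).
  { apply Rmin_pos; [lra|]. assert (He := cond_pos eps).
    apply Rdiv_lt_0_compat; [|lra]. repeat apply Rmult_lt_0_compat; lra. }
  exists (mkposreal _ Hp); simpl; intros w Hw.
  assert (H1 := Rlt_le_trans _ _ _ Hw (Rmin_l _ _)).
  assert (H2 := Rlt_le_trans _ _ _ Hw (Rmin_r _ _)).
  assert (Hwm : Cmod z / 2 < Cmod w).
  { assert (Ht := Cmod_triangle w (z - w)).
    replace (w + (z - w))%C with z in Ht by ring.
    replace (z - w)%C with (- (w - z))%C in Ht by ring. rewrite Cmod_opp in Ht. lra. }
  assert (Hw0 : w <> RtoC 0) by (apply Cmod_gt_0; lra).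
  replace (/ w - / z - (w - z) * - / (z * z))%C
    with ((w - z) * (w - z) * / (w * (z * z)))%C by (field; split; assumption).
  assert (Hn : (w * (z * z))%C <> RtoC 0)
    by (apply Cmult_neq_0; [|apply Cmult_neq_0]; assumption).
  rewrite !(Cmod_mult (_ * _)%C), (Cmod_mult (w - z)), Cmod_inv by assumption.
  rewrite (Cmod_mult w), (Cmod_mult z z).
  set (d := Cmod (w - z)) in *. set (m := Cmod z) in *. set (n := Cmod w) in *.
  assert (Hd : 0 <= d) by apply Cmod_ge_0.
  assert (Hq : 0 < n * (m * m)) by (repeat apply Rmult_lt_0_compat; lra).
  rewrite (Rmult_comm eps d), (Rmult_assoc d d).
  apply Rmult_le_compat_l; [exact Hd|].
  apply Rmult_le_reg_r with (n * (m * m)); [exact Hq|].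
  rewrite Rmult_assoc, Rinv_l, Rmult_1_r by lra.
  assert (He := cond_pos eps).
  assert (0 < eps * (m * m)) by (repeat apply Rmult_lt_0_compat; lra).
  replace (eps * (n * (m * m))) with (eps * (m * m) * n) by ring.
  replace (eps * (m * m * m) / 2) with (eps * (m * m) * (m / 2)) in H2 by field.
  nra.
Qed.

Lemma ex_Cderive_plus f g z : exd f z -> exd g z -> exd (fun w => (f w + g w)%C) z.
Proof. intros [a Ha] [b Hb]; eexists; apply Cderive_plus; eassumption. Qed.

Lemma ex_Cderive_mult f g z : exd f z -> exd g z -> exd (fun w => (f w * g w)%C) z.
Proof. intros [a Ha] [b Hb]; eexists; apply Cderive_mult; eassumption. Qed.

Lemma ex_Cderive_comp f g z : exd f (g z) -> exd g z -> exd (fun w => f (g w)) z.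
Proof. intros [a Ha] [b Hb]; eexists; apply Cderive_comp; eassumption. Qed.

Lemma ex_Cderive_const c z : exd (fun _ => c) z.
Proof. eexists; apply Cderive_const. Qed.

Lemma ex_Cderive_id z : exd (fun w => w) z.
Proof. eexists; apply Cderive_id. Qed.

Lemma ex_Cderive_inv f z : exd f z -> f z <> RtoC 0 -> exd (fun w => (/ f w)%C) z.
Proof.
  intros Hf H0. apply (ex_Cderive_comp Cinv f); [|exact Hf].
  eexists; now apply Cderive_inv.
Qed.

End Calculus.

(** * Derivatives of paths in the plane *)

Lemma norm_C_R (z : C) : norm (V := C_R_NormedModule) z = Cmod z.
Proof.
  change (sqrt (Rabs (fst z) ^ 2 + Rabs (snd z) ^ 2) = Cmod z).
  unfold Cmod. now rewrite !pow2_abs.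
Qed.

Lemma Rderive_C_iff (c : R -> C) (t : R) (l : C) :
  is_derive (K := R_AbsRing) (V := C_R_NormedModule) c t l <->
  forall eps : posreal, exists d : posreal, forall u : R, Rabs (u - t) < d ->
    Cmod (c u - c t - RtoC (u - t) * l) <= eps * Rabs (u - t).
Proof.
  assert (E : forall u, Cmod (c u - c t - RtoC (u - t) * l)%C =
    norm (V := C_R_NormedModule) (minus (minus (c u) (c t)) (scal (minus u t) l))).
  { intros u. rewrite norm_C_R. now rewrite <- scal_R_Cmult. }
  split.
  - intros [_ H] eps.
    destruct (H t (fun P HP => HP) eps) as [d Hd].
    exists d; intros u Hu. rewrite E. exact (Hd u Hu).
  - intros H; split.
    + apply (is_linear_scal_l (K := R_AbsRing) (V := C_R_NormedModule) l).
    + intros x Hx eps.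
      assert (x = t) as ->.
      { symmetry. now apply (is_filter_lim_locally_unique (K:=R_AbsRing) (V:=R_NormedModule)). }
      destruct (H eps) as [d Hd].
      exists d; intros u Hu. eapply Rle_trans; [|exact (Hd u Hu)].
      rewrite E. apply Rle_refl.
Qed.

Lemma Rderive_C_pair (c : R -> C) (t : R) (l : C) :
  is_derive (fun u => fst (c u)) t (fst l) ->
  is_derive (fun u => snd (c u)) t (snd l) ->
  is_derive (K := R_AbsRing) (V := C_R_NormedModule) c t l.
Proof.
  intros Hf Hs. apply Rderive_C_iff. intros eps.
  assert (Hp : 0 < eps / 2) by (assert (He := cond_pos eps); lra).
  destruct Hf as [_ Hf], Hs as [_ Hs].
  destruct (Hf t (fun P HP => HP) (mkposreal _ Hp)) as [d1 Hd1].
  destruct (Hs t (fun P HP => HP) (mkposreal _ Hp)) as [d2 Hd2].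
  assert (Hd : 0 < Rmin d1 d2) by (apply Rmin_pos; apply cond_pos).
  exists (mkposreal _ Hd); simpl; intros u Hu.
  specialize (Hd1 u (Rlt_le_trans _ _ _ Hu (Rmin_l _ _))).
  specialize (Hd2 u (Rlt_le_trans _ _ _ Hu (Rmin_r _ _))).
  set (w := (c u - c t - RtoC (u - t) * l)%C).
  assert (E1 : Rabs (fst w) <= eps / 2 * Rabs (u - t)).
  { replace (fst w) with (minus (minus (fst (c u)) (fst (c t))) (scal (minus u t) (fst l))).
    exact Hd1. unfold w, minus, plus, opp, scal; simpl. unfold mult; simpl. ring. }
  assert (E2 : Rabs (snd w) <= eps / 2 * Rabs (u - t)).
  { replace (snd w) with (minus (minus (snd (c u)) (snd (c t))) (scal (minus u t) (snd l))).
    exact Hd2. unfold w, minus, plus, opp, scal; simpl. unfold mult; simpl. ring. }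
  assert (Hw : Cmod w <= Rabs (fst w) + Rabs (snd w)).
  { replace w with (RtoC (fst w) + Ci * RtoC (snd w))%C.
    - eapply Rle_trans; [apply Cmod_triangle|].
      rewrite Cmod_mult, Cmod_Ci, !Cmod_R, Rmult_1_l. simpl.
      apply Req_le. f_equal; f_equal; simpl; ring.
    - unfold Ci, RtoC, Cplus, Cmult; destruct w; simpl; f_equal; ring. }
  lra.
Qed.

(** The inner derivative is over [R] and the outer one over [C], so a chain rule over a single field
    does not apply. The error splits into that of [F] at [c u] and [l] times that of [c]. *)
Lemma Rderive_along (F : C -> C) (c : R -> C) (t : R) (l d : C) :
  is_derive (K := C_AbsRing) (V := C_NormedModule) F (c t) l ->
  is_derive (K := R_AbsRing) (V := C_R_NormedModule) c t d ->
  is_derive (K := R_AbsRing) (V := C_R_NormedModule) (fun u => F (c u)) t (d * l)%C.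
Proof.
  intros HF Hc. apply Rderive_C_iff. intros eps.
  assert (He := cond_pos eps).
  assert (Hl := Cmod_ge_0 l). assert (Hd := Cmod_ge_0 d).
  (* Each of the two errors may cost eps/2 times |u - t|. The minimum with 1 below makes [c]
     Lipschitz at [t] with constant 1 + |d|. *)
  assert (Hp1 : 0 < eps / (2 * (1 + Cmod d))) by (apply Rdiv_lt_0_compat; lra).
  assert (Hp2 : 0 < Rmin 1 (eps / (2 * (1 + Cmod l)))).
  { apply Rmin_pos; [lra|]. apply Rdiv_lt_0_compat; lra. }
  destruct (proj1 (Cderive_iff _ _ _) HF (mkposreal _ Hp1)) as [d1 H1].
  destruct (proj1 (Rderive_C_iff _ _ _) Hc (mkposreal _ Hp2)) as [d2 H2].
  simpl in H1, H2.
  assert (Hp3 : 0 < Rmin d2 (d1 / (1 + Cmod d))).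
  { apply Rmin_pos; [apply cond_pos|]. apply Rdiv_lt_0_compat; [apply cond_pos|lra]. }
  exists (mkposreal _ Hp3); simpl; intros u Hu.
  assert (Hu2 := Rlt_le_trans _ _ _ Hu (Rmin_l _ _)).
  assert (Hu1 := Rlt_le_trans _ _ _ Hu (Rmin_r _ _)).
  specialize (H2 u Hu2).
  set (r := Rabs (u - t)) in *. assert (Hr : 0 <= r) by apply Rabs_pos.
  apply (Rmult_lt_compat_r (1 + Cmod d)) in Hu1; [|lra].
  unfold Rdiv in Hu1 at 1. rewrite Rmult_assoc, Rinv_l, Rmult_1_r in Hu1 by lra.
  assert (Hcu : Cmod (c u - c t) <= (1 + Cmod d) * r).
  { replace (c u - c t)%C with ((c u - c t - RtoC (u - t) * d) + RtoC (u - t) * d)%C by ring.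
    eapply Rle_trans; [apply Cmod_triangle|].
    rewrite Cmod_mult, Cmod_R. fold r.
    assert (Rmin 1 (eps / (2 * (1 + Cmod l))) * r <= 1 * r)
      by (apply Rmult_le_compat_r; [lra|apply Rmin_l]). lra. }
  assert (Hcu' : Cmod (c u - c t) < d1) by (eapply Rle_lt_trans; [exact Hcu|lra]).
  specialize (H1 _ Hcu').
  replace (F (c u) - F (c t) - RtoC (u - t) * (d * l))%C
    with ((F (c u) - F (c t) - (c u - c t) * l) + (c u - c t - RtoC (u - t) * d) * l)%C by ring.
  eapply Rle_trans; [apply Cmod_triangle|]. rewrite (Cmod_mult _ l).
  assert (A : eps / (2 * (1 + Cmod d)) * Cmod (c u - c t) <= eps / 2 * r).
  { replace (eps / 2 * r) with (eps / (2 * (1 + Cmod d)) * ((1 + Cmod d) * r)) by (field; lra).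
    apply Rmult_le_compat_l; lra. }
  assert (B : Cmod (c u - c t - RtoC (u - t) * d) * Cmod l <= eps / 2 * r).
  { apply Rle_trans with ((eps / (2 * (1 + Cmod l)) * r) * (1 + Cmod l)).
    - apply Rmult_le_compat; [apply Cmod_ge_0|lra| |lra].
      eapply Rle_trans; [exact H2|]. apply Rmult_le_compat_r; [lra|apply Rmin_r].
    - apply Req_le; field; lra. }
  lra.
Qed.

(** * Continuity of complex-valued maps on [R], on [C] and on products *)

Section Cont.
Context {T : UniformSpace}.
Notation cont := (continuous (T := T) (U := C_UniformSpace)).

Lemma continuous_C_pair (f : T -> C) (x : T) :
  continuous (fun u => fst (f u)) x -> continuous (fun u => snd (f u)) x -> cont f x.
Proof.
  intros H1 H2. apply filterlim_locally. intros eps.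
  generalize (filter_and _ _ (proj1 (filterlim_locally _ _) H1 eps) (proj1 (filterlim_locally _ _) H2 eps)).
  apply filter_imp. intros u [A B]. now split.
Qed.

Lemma continuous_C_fst (f : T -> C) (x : T) : cont f x -> continuous (fun u => fst (f u)) x.
Proof. intros H. apply (continuous_comp f fst); [exact H|apply continuous_fst]. Qed.

Lemma continuous_C_snd (f : T -> C) (x : T) : cont f x -> continuous (fun u => snd (f u)) x.
Proof. intros H. apply (continuous_comp f snd); [exact H|apply continuous_snd]. Qed.

Lemma continuous_Rplus (f g : T -> R) x :
  continuous f x -> continuous g x -> continuous (fun u => f u + g u) x.
Proof. apply (continuous_plus (V := R_NormedModule)). Qed.

Lemma continuous_Rminus (f g : T -> R) x :
  continuous f x -> continuous g x -> continuous (fun u => f u - g u) x.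
Proof. apply (continuous_minus (V := R_NormedModule)). Qed.

Lemma continuous_Rmult (f g : T -> R) x :
  continuous f x -> continuous g x -> continuous (fun u => f u * g u) x.
Proof. apply (continuous_mult (K := R_AbsRing)). Qed.

Lemma continuous_Cplus (f g : T -> C) x :
  cont f x -> cont g x -> cont (fun u => (f u + g u)%C) x.
Proof.
  intros Hf Hg; apply continuous_C_pair.
  - exact (continuous_Rplus _ _ x (continuous_C_fst f x Hf) (continuous_C_fst g x Hg)).
  - exact (continuous_Rplus _ _ x (continuous_C_snd f x Hf) (continuous_C_snd g x Hg)).
Qed.

Lemma continuous_Cminus (f g : T -> C) x :
  cont f x -> cont g x -> cont (fun u => (f u - g u)%C) x.
Proof.
  intros Hf Hg; apply continuous_C_pair.
  - exact (continuous_Rminus _ _ x (continuous_C_fst f x Hf) (continuous_C_fst g x Hg)).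
  - exact (continuous_Rminus _ _ x (continuous_C_snd f x Hf) (continuous_C_snd g x Hg)).
Qed.

Lemma continuous_Cmult (f g : T -> C) x :
  cont f x -> cont g x -> cont (fun u => (f u * g u)%C) x.
Proof.
  intros Hf Hg.
  assert (Hf1 := continuous_C_fst f x Hf). assert (Hf2 := continuous_C_snd f x Hf).
  assert (Hg1 := continuous_C_fst g x Hg). assert (Hg2 := continuous_C_snd g x Hg).
  apply continuous_C_pair.
  - exact (continuous_Rminus _ _ x (continuous_Rmult _ _ x Hf1 Hg1) (continuous_Rmult _ _ x Hf2 Hg2)).
  - exact (continuous_Rplus _ _ x (continuous_Rmult _ _ x Hf1 Hg2) (continuous_Rmult _ _ x Hf2 Hg1)).
Qed.

Lemma continuous_RtoC (f : T -> R) x : continuous f x -> cont (fun u => RtoC (f u)) x.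
Proof. intros Hf; apply continuous_C_pair; simpl; [exact Hf|apply continuous_const]. Qed.

Lemma continuous_Cmod (f : T -> C) x : cont f x -> continuous (fun u => Cmod (f u)) x.
Proof.
  intros Hf.
  assert (Hsq : forall v : T -> R, continuous v x -> continuous (fun u => v u ^ 2) x).
  { intros v Hv. exact (continuous_Rmult _ _ x Hv (continuous_Rmult _ _ x Hv (continuous_const 1 x))). }
  unfold Cmod. apply (continuous_comp (fun u => fst (f u) ^ 2 + snd (f u) ^ 2) sqrt).
  - exact (continuous_Rplus _ _ x (Hsq _ (continuous_C_fst f x Hf)) (Hsq _ (continuous_C_snd f x Hf))).
  - apply continuous_sqrt.
Qed.

Lemma continuous_Rsqrt (f : T -> R) x : continuous f x -> continuous (fun u => sqrt (f u)) x.
Proof. intros Hf. apply (continuous_comp f sqrt); [exact Hf|apply continuous_sqrt]. Qed.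

Lemma continuous_expi (f : T -> R) x : continuous f x -> cont (fun u => expi (f u)) x.
Proof.
  intros Hf; apply continuous_C_pair; simpl.
  - apply (continuous_comp f cos); [exact Hf|apply continuous_cos].
  - apply (continuous_comp f sin); [exact Hf|apply continuous_sin].
Qed.
End Cont.

(** * The unit circle and polar form *)

Lemma Cmod_expi t : Cmod (expi t) = 1.
Proof.
  unfold Cmod, expi; simpl fst; simpl snd.
  replace (cos t ^ 2 + sin t ^ 2) with 1; [apply sqrt_1|].
  generalize (sin2_cos2 t); unfold Rsqr; simpl; lra.
Qed.

Lemma expi_plus s t : expi (s + t) = (expi s * expi t)%C.
Proof. unfold expi, Cmult; simpl. rewrite cos_plus, sin_plus. f_equal; ring. Qed.

Lemma expi_0 : expi 0 = RtoC 1.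
Proof. unfold expi. now rewrite cos_0, sin_0. Qed.

Lemma expi_2PI : expi (2 * PI) = RtoC 1.
Proof. unfold expi. now rewrite cos_2PI, sin_2PI. Qed.

Lemma expi_period t : expi (t + 2 * PI) = expi t.
Proof. rewrite expi_plus, expi_2PI. ring. Qed.

Lemma expi_nz t : expi t <> RtoC 0.
Proof. apply Cmod_gt_0. rewrite Cmod_expi; lra. Qed.

Lemma Rderive_expi t :
  is_derive (K := R_AbsRing) (V := C_R_NormedModule) expi t (Ci * expi t)%C.
Proof.
  apply Rderive_C_pair; simpl; auto_derive; trivial; ring.
Qed.

(** The sign of the imaginary part decides between [acos x] and its opposite. The compact range of
    angles is what [circle_bounded] needs in order to bound a function on the whole circle by a
    maximum. *)
Lemma Cmod_eq_1_expi_PI z : Cmod z = 1 -> exists t, - PI <= t <= PI /\ z = expi t.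
Proof.
  destruct z as [x y]; intros Hz.
  assert (H : x * x + y * y = 1).
  { unfold Cmod in Hz; simpl in Hz.
    replace (x * x + y * y) with (sqrt (x * (x * 1) + y * (y * 1)) ^ 2); [rewrite Hz; ring|].
    rewrite pow2_sqrt; [ring|nra]. }
  assert (Hx : -1 <= x <= 1) by (split; nra).
  assert (Hy : sqrt (1 - x²) = Rabs y).
  { rewrite <- sqrt_Rsqr_abs. f_equal. unfold Rsqr; lra. }
  destruct (Rle_dec 0 y) as [H0|H0].
  - exists (acos x). assert (Hb := acos_bound x). split; [lra|]. unfold expi. rewrite cos_acos, sin_acos, Hy by assumption.
    now rewrite Rabs_pos_eq.
  - exists (- acos x). assert (Hb := acos_bound x). split; [lra|]. unfold expi. rewrite cos_neg, sin_neg, cos_acos, sin_acos, Hy by assumption.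
    rewrite Rabs_left by lra. f_equal; ring.
Qed.

Lemma Cmod_eq_1_expi z : Cmod z = 1 -> exists t, z = expi t.
Proof. intros H. destruct (Cmod_eq_1_expi_PI z H) as [t [_ Ht]]. now exists t. Qed.

Lemma C_polar z : exists t, z = (RtoC (Cmod z) * expi t)%C.
Proof.
  destruct (Ceq_dec z (RtoC 0)) as [->|Hz].
  - exists 0. rewrite Cmod_0. ring.
  - assert (Hm : 0 < Cmod z) by now apply Cmod_gt_0.
    assert (Hm0 : RtoC (Cmod z) <> RtoC 0) by (intros H; apply RtoC_inj in H; lra).
    destruct (Cmod_eq_1_expi (z / RtoC (Cmod z))%C) as [t Ht].
    + rewrite Cmod_div, Cmod_R, Rabs_pos_eq by (assumption || lra). field; lra.
    + exists t. rewrite <- Ht. now field.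
Qed.

(** * Integrals of complex-valued functions *)

(** [Rmin] and [Rmax] admit integrals with reversed bounds. *)
Definition cont_on (f : R -> C) (a b : R) : Prop :=
  forall t, Rmin a b <= t <= Rmax a b -> continuous (U := C_UniformSpace) f t.

Lemma ex_CInt_cont f a b : cont_on f a b -> ex_CInt f a b.
Proof. exact (ex_RInt_continuous (V := C_R_CompleteNormedModule) f a b). Qed.

Lemma CInt_pair f a b : ex_CInt f a b ->
  CInt f a b = (RInt (fun t => fst (f t)) a b, RInt (fun t => snd (f t)) a b).
Proof.
  intros [l Hl]. unfold CInt.
  rewrite (is_RInt_unique (V := C_R_CompleteNormedModule) _ _ _ _ Hl).
  apply (is_RInt_fct_extend_fst (U := R_NormedModule) (V := R_NormedModule)) in Hl as H1.
  apply (is_RInt_fct_extend_snd (U := R_NormedModule) (V := R_NormedModule)) in Hl as H2.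
  assert (E1 : RInt (fun t => fst (f t)) a b = fst l)
    by exact (is_RInt_unique (V := R_CompleteNormedModule) _ _ _ _ H1).
  assert (E2 : RInt (fun t => snd (f t)) a b = snd l)
    by exact (is_RInt_unique (V := R_CompleteNormedModule) _ _ _ _ H2).
  rewrite E1, E2. now destruct l.
Qed.

Lemma CInt_ext (f g : R -> C) a b :
  (forall t, Rmin a b < t < Rmax a b -> f t = g t) -> CInt f a b = CInt g a b.
Proof. apply (RInt_ext (V := C_R_CompleteNormedModule)). Qed.

Lemma CInt_minus f g a b : cont_on f a b -> cont_on g a b ->
  CInt (fun t => (f t - g t)%C) a b = (CInt f a b - CInt g a b)%C.
Proof.
  intros Hf Hg.
  apply (RInt_minus (V := C_R_CompleteNormedModule)); now apply ex_CInt_cont.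
Qed.

Lemma cont_on_mult f g a b : cont_on f a b -> cont_on g a b -> cont_on (fun t => (f t * g t)%C) a b.
Proof. intros Hf Hg t Ht. apply continuous_Cmult; auto. Qed.

Lemma cont_on_const c a b : cont_on (fun _ => c) a b.
Proof. intros t _. apply continuous_const. Qed.

(** The integral is linear over [R] only; a complex factor is pulled out by computing with real and
    imaginary parts. *)
Lemma CInt_mult_l c f a b : cont_on f a b ->
  CInt (fun t => (c * f t)%C) a b = (c * CInt f a b)%C.
Proof.
  intros Hf. pose proof (ex_CInt_cont _ _ _ Hf) as He.
  rewrite CInt_pair by (apply ex_CInt_cont, cont_on_mult; [apply cont_on_const|exact Hf]).
  rewrite CInt_pair by exact He.
  destruct He as [l Hl].
  apply (is_RInt_fct_extend_fst (U := R_NormedModule) (V := R_NormedModule)) in Hl as H1.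
  apply (is_RInt_fct_extend_snd (U := R_NormedModule) (V := R_NormedModule)) in Hl as H2.
  assert (E1 : RInt (fun t => fst (f t)) a b = fst l)
    by exact (is_RInt_unique (V := R_CompleteNormedModule) _ _ _ _ H1).
  assert (E2 : RInt (fun t => snd (f t)) a b = snd l)
    by exact (is_RInt_unique (V := R_CompleteNormedModule) _ _ _ _ H2).
  rewrite E1, E2.
  unfold Cmult; simpl. f_equal; apply (is_RInt_unique (V := R_CompleteNormedModule)).
  - apply (is_RInt_minus (V := R_NormedModule)); apply (is_RInt_scal (V := R_NormedModule)); assumption.
  - apply (is_RInt_plus (V := R_NormedModule)); apply (is_RInt_scal (V := R_NormedModule)); assumption.
Qed.

Lemma CInt_const c a b : CInt (fun _ => c) a b = (RtoC (b - a) * c)%C.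
Proof. unfold CInt; rewrite (RInt_const (V := C_R_CompleteNormedModule)). apply scal_R_Cmult. Qed.

Lemma Cmod_CInt_le f a b : a <= b -> cont_on f a b ->
  Cmod (CInt f a b) <= RInt (fun t => Cmod (f t)) a b.
Proof.
  intros Hab Hf. rewrite <- norm_C_R.
  apply (norm_RInt_le (V := C_R_NormedModule) f (fun t => Cmod (f t)) a b).
  - exact Hab.
  - intros x _. rewrite norm_C_R. apply Rle_refl.
  - apply (RInt_correct (V := C_R_CompleteNormedModule)), ex_CInt_cont, Hf.
  - apply (RInt_correct (V := R_CompleteNormedModule)).
    apply (ex_RInt_continuous (V := R_CompleteNormedModule)).
    intros t Ht. apply continuous_Cmod, Hf, Ht.
Qed.

Lemma Cmod_CInt_le_const f a b M : a <= b -> cont_on f a b ->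
  (forall t, a <= t <= b -> Cmod (f t) <= M) -> Cmod (CInt f a b) <= (b - a) * M.
Proof.
  intros Hab Hf HM. rewrite <- norm_C_R.
  apply (norm_RInt_le_const (V := C_R_NormedModule) f a b); [exact Hab| |].
  - intros x Hx. rewrite norm_C_R. now apply HM.
  - apply (RInt_correct (V := C_R_CompleteNormedModule)), ex_CInt_cont, Hf.
Qed.

Lemma CInt_derive (f df : R -> C) a b :
  (forall t, Rmin a b <= t <= Rmax a b ->
     is_derive (K := R_AbsRing) (V := C_R_NormedModule) f t (df t)) ->
  cont_on df a b -> CInt df a b = (f b - f a)%C.
Proof.
  intros Hd Hc. apply (is_RInt_unique (V := C_R_CompleteNormedModule)).
  now apply (is_RInt_derive (V := C_R_CompleteNormedModule) f df).
Qed.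

Lemma Rderive_C_scal (c d : C) t :
  is_derive (K := R_AbsRing) (V := C_R_NormedModule) (fun u => (c + RtoC u * d)%C) t d.
Proof.
  apply Rderive_C_iff. intros eps. exists (mkposreal 1 Rlt_0_1). intros u _.
  replace (_ - _)%C with (RtoC 0) by (rewrite RtoC_minus; ring).
  rewrite Cmod_0. apply Rmult_le_pos; [apply Rlt_le, cond_pos|apply Rabs_pos].
Qed.

(** * Contour integrals along segments and triangles *)

Section Segments.
Context (rad : R) (h : C -> C) (Hh : holo rad h).

Definition point (a b : C) (t : R) : C := (a + RtoC t * (b - a))%C.
Definition seg (f : C -> C) (a b : C) : C := CInt (fun t => (f (point a b t) * (b - a))%C) 0 1.

Lemma Cmod_point_le a b t r : Cmod a <= r -> Cmod b <= r -> 0 <= t <= 1 -> Cmod (point a b t) <= r.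
Proof.
  intros Ha Hb Ht.
  unfold point. replace (a + RtoC t * (b - a))%C with (RtoC (1 - t) * a + RtoC t * b)%C
    by (rewrite RtoC_minus; ring).
  eapply Rle_trans; [apply Cmod_triangle|]. rewrite !Cmod_mult, !Cmod_R, !Rabs_pos_eq by lra.
  nra.
Qed.

Lemma Cmod_point_lt a b t : Cmod a < rad -> Cmod b < rad -> 0 <= t <= 1 -> Cmod (point a b t) < rad.
Proof.
  intros Ha Hb Ht. apply Rle_lt_trans with (Rmax (Cmod a) (Cmod b)).
  - apply Cmod_point_le; [apply Rmax_l|apply Rmax_r|exact Ht].
  - now apply Rmax_lub_lt.
Qed.

Lemma continuous_point a b t : continuous (U := C_UniformSpace) (point a b) t.
Proof.
  apply continuous_Cplus; [apply continuous_const|].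
  apply continuous_Cmult; [apply continuous_RtoC, continuous_id|apply continuous_const].
Qed.

Lemma continuous_h_point a b t : Cmod a < rad -> Cmod b < rad -> 0 <= t <= 1 ->
  continuous (U := C_UniformSpace) (fun t => (h (point a b t) * (b - a))%C) t.
Proof.
  intros Ha Hb Ht. apply continuous_Cmult; [|apply continuous_const].
  apply (continuous_comp (point a b) h); [apply continuous_point|].
  apply holo_continuous with (1 := Hh). now apply Cmod_point_lt.
Qed.

(** An affine change of the parameter. Splitting a segment and reversing it are the special cases
    with one or both of [u], [v] equal to 0 or 1. *)
Lemma seg_sub a b u v : Cmod a < rad -> Cmod b < rad -> 0 <= u <= 1 -> 0 <= v <= 1 ->
  seg h (point a b u) (point a b v) = CInt (fun t => (h (point a b t) * (b - a))%C) u v.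
Proof.
  intros Ha Hb Hu Hv. set (g := fun t => (h (point a b t) * (b - a))%C).
  assert (E := RInt_comp_lin (V := C_R_CompleteNormedModule) g (v - u) u 0 1).
  replace ((v - u) * 0 + u) with u in E by ring.
  replace ((v - u) * 1 + u) with v in E by ring.
  unfold CInt at 1. rewrite <- E.
  - unfold seg. apply CInt_ext. intros t _. symmetry.
    etransitivity; [apply scal_R_Cmult|]. unfold g.
    replace (point (point a b u) (point a b v) t) with (point a b ((v - u) * t + u)).
    + unfold point. rewrite RtoC_minus. ring.
    + unfold point. rewrite RtoC_plus, RtoC_mult, RtoC_minus. ring.
  - apply ex_CInt_cont. intros t Ht. apply continuous_h_point; try assumption.
    revert Ht. unfold Rmin, Rmax; destruct (Rle_dec u v); intros; lra.
Qed.

Lemma point_0 a b : point a b 0 = a. Proof. unfold point; ring. Qed.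
Lemma point_1 a b : point a b 1 = b. Proof. unfold point; ring. Qed.

Lemma seg_split a b t : Cmod a < rad -> Cmod b < rad -> 0 <= t <= 1 ->
  seg h a b = (seg h a (point a b t) + seg h (point a b t) b)%C.
Proof.
  intros Ha Hb Ht.
  assert (H1 := seg_sub a b 0 t Ha Hb (conj (Rle_refl 0) Rle_0_1) Ht).
  assert (H2 := seg_sub a b t 1 Ha Hb Ht (conj Rle_0_1 (Rle_refl 1))).
  rewrite point_0 in H1. rewrite point_1 in H2. rewrite H1, H2. symmetry.
  apply (RInt_Chasles (V := C_R_CompleteNormedModule)); apply ex_CInt_cont; intros u;
    rewrite Rmin_left, Rmax_right by lra; intros Hu; apply continuous_h_point; try assumption; lra.
Qed.

Lemma seg_rev a b : Cmod a < rad -> Cmod b < rad -> seg h b a = (- seg h a b)%C.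
Proof.
  intros Ha Hb.
  assert (H1 := seg_sub a b 1 0 Ha Hb (conj Rle_0_1 (Rle_refl 1)) (conj (Rle_refl 0) Rle_0_1)).
  rewrite point_0, point_1 in H1. rewrite H1.
  unfold CInt; rewrite <- (opp_RInt_swap (V := C_R_CompleteNormedModule)); [reflexivity|].
  apply ex_CInt_cont; intros u;
    rewrite Rmin_left, Rmax_right by lra; intros Hu; apply continuous_h_point; try assumption; lra.
Qed.

(** An affine function has a primitive, so its segment integral is explicit and the rest is at most
    eta times the length. Both uses of the derivative of [h] rest on this (Goursat, the quotient at
    0); [q = 0] covers mere continuity. *)
Lemma seg_affine_close a b p q z0 eta : Cmod a < rad -> Cmod b < rad ->
  (forall t, 0 <= t <= 1 -> Cmod (h (point a b t) - (p + q * (point a b t - z0))) <= eta) ->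
  Cmod (seg h a b - (p * (b - a) + q * ((b - z0) * (b - z0) - (a - z0) * (a - z0)) / 2)) <= eta * Cmod (b - a).
Proof.
  intros Ha Hb Hc.
  set (l := fun t => ((p + q * (point a b t - z0)) * (b - a))%C).
  assert (Hl : cont_on l 0 1).
  { intros t _. apply continuous_Cmult; [|apply continuous_const].
    apply continuous_Cplus; [apply continuous_const|].
    apply continuous_Cmult; [apply continuous_const|].
    apply continuous_Cminus; [apply continuous_point|apply continuous_const]. }
  assert (Hg : cont_on (fun t => (h (point a b t) * (b - a))%C) 0 1).
  { intros t; rewrite Rmin_left, Rmax_right by lra; intros Ht. now apply continuous_h_point. }
  assert (H2 : RtoC 2 <> RtoC 0) by (intros E; apply RtoC_inj in E; lra).
  assert (El : CInt l 0 1 = (p * (b - a) + q * ((b - z0) * (b - z0) - (a - z0) * (a - z0)) / 2)%C).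
  { set (P := fun w => (p * w + q * / RtoC 2 * ((w - z0) * (w - z0)))%C).
    rewrite (CInt_derive (fun t => P (point a b t)) l).
    - rewrite point_0, point_1. unfold P. field.
    - intros t _.
      assert (HP : is_derive (K := C_AbsRing) (V := C_NormedModule) P (point a b t)
                    (p + q * (point a b t - z0))%C).
      { unfold P. set (w := point a b t).
        assert (E : (p + q * (w - z0))%C = ((RtoC 0 * w + p * RtoC 1) +
           (RtoC 0 * ((w - z0) * (w - z0)) + q * / RtoC 2 * ((RtoC 1 + RtoC 0) * (w - z0) + (w - z0) * (RtoC 1 + RtoC 0))))%C)
          by (field; exact H2).
        rewrite E.
        assert (Hm : is_derive (K := C_AbsRing) (V := C_NormedModule) (fun w => (w - z0)%C) w (RtoC 1 + RtoC 0)%C)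
          by (apply (Cderive_plus (fun w => w) (fun _ => (- z0)%C)); [apply Cderive_id|apply Cderive_const]).
        apply Cderive_plus.
        - apply (Cderive_mult (fun _ => p) (fun w => w)); [apply Cderive_const|apply Cderive_id].
        - apply (Cderive_mult (fun _ => (q * / RtoC 2)%C) (fun w => ((w - z0) * (w - z0))%C));
            [apply Cderive_const|].
          now apply (Cderive_mult (fun w => (w - z0)%C) (fun w => (w - z0)%C)). }
      assert (Hd := Rderive_along P (point a b) t _ _ HP (Rderive_C_scal a (b - a)%C t)).
      unfold l. rewrite Cmult_comm. exact Hd.
    - exact Hl. }
  rewrite <- El. unfold seg. rewrite <- CInt_minus by assumption.
  replace (eta * Cmod (b - a)) with ((1 - 0) * (eta * Cmod (b - a))) by ring.
  apply Cmod_CInt_le_const; [lra| |].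
  - intros t Ht. apply continuous_Cminus; auto.
  - intros t Ht. unfold l.
    replace (_ - _)%C with ((h (point a b t) - (p + q * (point a b t - z0))) * (b - a))%C by ring.
    rewrite Cmod_mult. apply Rmult_le_compat_r; [apply Cmod_ge_0|]. now apply Hc.
Qed.

Definition tri (a b c : C) : C := (seg h a b + seg h b c + seg h c a)%C.
Definition mid (a b : C) : C := point a b (1 / 2).

(** Each side of the medial triangle is run through once in each direction and cancels. *)
Lemma tri_split a b c : Cmod a < rad -> Cmod b < rad -> Cmod c < rad ->
  tri a b c = (tri a (mid a b) (mid c a) + tri (mid a b) b (mid b c)
    + tri (mid c a) (mid b c) c + tri (mid a b) (mid b c) (mid c a))%C.
Proof.
  intros Ha Hb Hc. assert (H12 : 0 <= 1 / 2 <= 1) by lra.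
  assert (Hab := Cmod_point_lt a b _ Ha Hb H12).
  assert (Hbc := Cmod_point_lt b c _ Hb Hc H12).
  assert (Hca := Cmod_point_lt c a _ Hc Ha H12).
  unfold tri at 1.
  rewrite (seg_split a b _ Ha Hb H12), (seg_split b c _ Hb Hc H12), (seg_split c a _ Hc Ha H12).
  unfold tri, mid.
  rewrite (seg_rev (point c a (1/2)) (point a b (1/2))), (seg_rev (point a b (1/2)) (point b c (1/2))),
    (seg_rev (point b c (1/2)) (point c a (1/2))) by assumption. ring.
Qed.
End Segments.

(** * Goursat's theorem *)

Lemma Cmod_le_Rabs_sum (z : C) : Cmod z <= Rabs (fst z) + Rabs (snd z).
Proof.
  assert (H := Rabs_pos (fst z)); assert (H' := Rabs_pos (snd z)).
  unfold Cmod. rewrite <- (sqrt_Rsqr (Rabs (fst z) + Rabs (snd z))) by lra.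
  apply sqrt_le_1_alt. rewrite <- (pow2_abs (fst z)), <- (pow2_abs (snd z)). unfold Rsqr. nra.
Qed.

Lemma C_cauchy_converges (a : nat -> C) :
  (forall eps, 0 < eps -> exists N, forall n, (N <= n)%nat -> Cmod (a n - a N) <= eps) ->
  exists p, forall eps, 0 < eps -> exists N, forall n, (N <= n)%nat -> Cmod (a n - p) <= eps.
Proof.
  intros Ha.
  assert (Hpr : forall (pr : C -> R), (forall z w, Rabs (pr z - pr w) <= Cmod (z - w)) ->
     exists x : R, is_lim_seq (fun n => pr (a n)) x).
  { intros pr Hpr. apply ex_lim_seq_cauchy_corr. intros eps.
    destruct (Ha (eps / 4)) as [N HN]; [assert (H := cond_pos eps); lra|].
    exists N. intros n m Hn Hm.
    assert (Kn := Rle_trans _ _ _ (Hpr _ _) (HN n Hn)). assert (Km := Rle_trans _ _ _ (Hpr _ _) (HN m Hm)).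
    replace (pr (a n) - pr (a m)) with ((pr (a n) - pr (a N)) - (pr (a m) - pr (a N))) by ring.
    eapply Rle_lt_trans; [apply Rabs_triang|]. rewrite Rabs_Ropp. assert (H := cond_pos eps). lra. }
  assert (Hfst : forall z w : C, Rabs (fst z - fst w) <= Cmod (z - w)).
  { intros z w. eapply Rle_trans; [|apply Rmax_Cmod]. apply (Rmax_l (Rabs (fst (z - w)%C))). }
  assert (Hsnd : forall z w : C, Rabs (snd z - snd w) <= Cmod (z - w)).
  { intros z w. eapply Rle_trans; [|apply Rmax_Cmod]. apply (Rmax_r _ (Rabs (snd (z - w)%C))). }
  destruct (Hpr fst Hfst) as [x Hx]. destruct (Hpr snd Hsnd) as [y Hy].
  exists (x, y). intros eps He.
  assert (He2 : 0 < eps / 2) by lra.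
  destruct (proj2 (is_lim_seq_spec _ _) Hx (mkposreal _ He2)) as [N1 H1]. simpl in H1.
  destruct (proj2 (is_lim_seq_spec _ _) Hy (mkposreal _ He2)) as [N2 H2]. simpl in H2.
  exists (N1 + N2)%nat. intros n Hn. specialize (H1 n ltac:(lia)). specialize (H2 n ltac:(lia)).
  eapply Rle_trans; [apply Cmod_le_Rabs_sum|]. simpl. unfold Rminus in *. lra.
Qed.

(** The bound on all later terms passes to the limit, which gives a rate: in [goursat] the limit
    point lies within one perimeter of each triangle's first vertex. *)
Lemma C_cauchy_limit (a : nat -> C) (D : nat -> R) :
  (forall n k, Cmod (a (n + k)%nat - a n) <= D n) -> is_lim_seq D 0 ->
  exists p, forall n, Cmod (a n - p) <= D n.
Proof.
  intros Ha HD.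
  destruct (C_cauchy_converges a) as [p Hp].
  - intros eps He. destruct (proj2 (is_lim_seq_spec _ _) HD (mkposreal _ He)) as [N HN].
    exists N. intros n Hn. specialize (HN N (le_n N)). simpl in HN. rewrite Rminus_0_r in HN.
    replace n with (N + (n - N))%nat by lia. eapply Rle_trans; [apply Ha|].
    assert (H := Rle_abs (D N)). lra.
  - exists p. intros n. apply Rle_plus_epsilon. intros eps He. destruct (Hp eps He) as [N HN].
    specialize (HN (n + N)%nat ltac:(lia)).
    replace (a n - p)%C with (- (a (n + N)%nat - a n) + (a (n + N)%nat - p))%C by ring.
    eapply Rle_trans; [apply Cmod_triangle|]. rewrite Cmod_opp. apply Rplus_le_compat; [apply Ha|exact HN].
Qed.

Section Goursat.
Context (rad : R) (h : C -> C) (Hh : holo rad h).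

Definition perimeter (T : C * C * C) : R :=
  let '(a, b, c) := T in Cmod (b - a) + Cmod (c - b) + Cmod (a - c).
Definition tri_int (T : C * C * C) : C := let '(a, b, c) := T in tri h a b c.
Definition inside (r : R) (T : C * C * C) : Prop :=
  let '(a, b, c) := T in Cmod a <= r /\ Cmod b <= r /\ Cmod c <= r.
Definition vertex (T : C * C * C) : C := fst (fst T).

Lemma Cmod_half z : Cmod (RtoC (1 / 2) * z)%C = Cmod z / 2.
Proof. rewrite Cmod_mult, Cmod_R, Rabs_pos_eq; lra. Qed.

Lemma le_sum4_cases x p q r s : x <= p + q + r + s ->
  x <= 4 * p \/ x <= 4 * q \/ x <= 4 * r \/ x <= 4 * s.
Proof.
  intros H. destruct (Rle_dec x (4 * p)), (Rle_dec x (4 * q)), (Rle_dec x (4 * r)); try tauto.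
  right; right; right. lra.
Qed.

(** One of the four midpoint triangles carries at least a quarter of the integral. In place of
    nestedness only the displacement of the first vertex is recorded; it is at most the perimeter
    lost, so displacements telescope. *)
Lemma goursat_step r T : r < rad -> inside r T ->
  exists T', inside r T' /\ perimeter T' = perimeter T / 2 /\
    Cmod (vertex T' - vertex T) <= perimeter T / 2 /\
    Cmod (tri_int T) <= 4 * Cmod (tri_int T').
Proof.
  intros Hr. destruct T as [[a b] c]. intros (Ha & Hb & Hc).
  assert (H12 : 0 <= 1 / 2 <= 1) by lra.
  assert (Ia : Cmod (mid a b) <= r) by (apply Cmod_point_le; assumption).
  assert (Ib : Cmod (mid b c) <= r) by (apply Cmod_point_le; assumption).
  assert (Ic : Cmod (mid c a) <= r) by (apply Cmod_point_le; assumption).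
  assert (E := tri_split rad h Hh a b c ltac:(lra) ltac:(lra) ltac:(lra)).
  set (T1 := tri h a (mid a b) (mid c a)) in *. set (T2 := tri h (mid a b) b (mid b c)) in *.
  set (T3 := tri h (mid c a) (mid b c) c) in *. set (T4 := tri h (mid a b) (mid b c) (mid c a)) in *.
  assert (Hsum : Cmod (tri h a b c) <= Cmod T1 + Cmod T2 + Cmod T3 + Cmod T4).
  { rewrite E. do 2 (eapply Rle_trans; [apply Cmod_triangle|]; apply Rplus_le_compat_r).
    apply Cmod_triangle. }
  assert (Hh2 : RtoC (1 / 2) = (RtoC 1 / RtoC 2)%C) by (apply RtoC_div; lra).
  assert (M : forall x y : C, (mid x y = (x + y) / RtoC 2)%C).
  { intros x y. unfold mid, point. rewrite Hh2. field. }
  assert (D : forall x y z, (x - y)%C = (RtoC (1/2) * z)%C -> Cmod (x - y) = Cmod z / 2).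
  { intros x y z ->. apply Cmod_half. }
  assert (Dab := Cmod_ge_0 (b - a)). assert (Dbc := Cmod_ge_0 (c - b)). assert (Dca := Cmod_ge_0 (a - c)).
  assert (Cases : Cmod (tri h a b c) <= 4 * Cmod T1 \/ Cmod (tri h a b c) <= 4 * Cmod T2 \/
    Cmod (tri h a b c) <= 4 * Cmod T3 \/ Cmod (tri h a b c) <= 4 * Cmod T4).
  { exact (le_sum4_cases _ _ _ _ _ Hsum). }
  destruct Cases as [H|[H|[H|H]]].
  - exists (a, mid a b, mid c a). unfold inside, perimeter, vertex, tri_int; simpl fst.
    repeat split; try assumption.
    + rewrite (D (mid a b) a (b - a)%C), (D (mid c a) (mid a b) (c - b)%C), (D a (mid c a) (a - c)%C);
        rewrite ?M, ?Hh2; [lra|field|field|field].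
    + replace (a - a)%C with (RtoC 0) by ring. rewrite Cmod_0. lra.
  - exists (mid a b, b, mid b c). unfold inside, perimeter, vertex, tri_int; simpl fst.
    repeat split; try assumption.
    + rewrite (D b (mid a b) (b - a)%C), (D (mid b c) b (c - b)%C), (D (mid a b) (mid b c) (a - c)%C);
        rewrite ?M, ?Hh2; [lra|field|field|field].
    + rewrite (D (mid a b) a (b - a)%C); rewrite ?M, ?Hh2; [lra|field].
  - exists (mid c a, mid b c, c). unfold inside, perimeter, vertex, tri_int; simpl fst.
    repeat split; try assumption.
    + rewrite (D (mid b c) (mid c a) (b - a)%C), (D c (mid b c) (c - b)%C), (D (mid c a) c (a - c)%C);
        rewrite ?M, ?Hh2; [lra|field|field|field].
    + rewrite (D (mid c a) a (c - a)%C); rewrite ?M, ?Hh2; [|field].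
      replace (c - a)%C with (- (a - c))%C by ring. rewrite Cmod_opp. lra.
  - exists (mid a b, mid b c, mid c a). unfold inside, perimeter, vertex, tri_int; simpl fst.
    repeat split; try assumption.
    + rewrite (D (mid b c) (mid a b) (c - a)%C), (D (mid c a) (mid b c) (a - b)%C), (D (mid a b) (mid c a) (b - c)%C);
        rewrite ?M, ?Hh2; [|field|field|field].
      replace (c - a)%C with (- (a - c))%C by ring. replace (a - b)%C with (- (b - a))%C by ring.
      replace (b - c)%C with (- (c - b))%C by ring. rewrite !Cmod_opp. lra.
    + rewrite (D (mid a b) a (b - a)%C); rewrite ?M, ?Hh2; [lra|field].
Qed.

Lemma goursat a b c : Cmod a < rad -> Cmod b < rad -> Cmod c < rad -> tri h a b c = RtoC 0.
Proof.
  intros Ha Hb Hc.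
  (* A closed disc of radius r < rad keeps the limit point [p] inside the domain, where [h] has a
     derivative. *)
  set (r := Rmax (Cmod a) (Rmax (Cmod b) (Cmod c))).
  assert (Hr : r < rad) by (repeat apply Rmax_lub_lt; assumption).
  assert (HT0 : inside r (a, b, c)).
  { repeat split; unfold r; [apply Rmax_l| |];
      (eapply Rle_trans; [|apply Rmax_r]); [apply Rmax_l|apply Rmax_r]. }
  (* The hypothesis is moved under the existential so that choice gives a map on all triangles,
     which can be iterated. *)
  assert (Hstep : forall T, exists T', inside r T -> inside r T' /\ perimeter T' = perimeter T / 2 /\
    Cmod (vertex T' - vertex T) <= perimeter T / 2 /\ Cmod (tri_int T) <= 4 * Cmod (tri_int T')).
  { intros T. destruct (classic (inside r T)) as [H|H].
    - destruct (goursat_step r T Hr H) as [T' HT']. now exists T'.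
    - exists T. tauto. }
  set (nxt := fun T => proj1_sig (constructive_indefinite_description _ (Hstep T))).
  assert (Hnxt := fun T => proj2_sig (constructive_indefinite_description _ (Hstep T))).
  change (forall T, inside r T -> inside r (nxt T) /\ perimeter (nxt T) = perimeter T / 2 /\
    Cmod (vertex (nxt T) - vertex T) <= perimeter T / 2 /\ Cmod (tri_int T) <= 4 * Cmod (tri_int (nxt T))) in Hnxt.
  clearbody nxt.
  set (T := fun n => Nat.iter n nxt (a, b, c)).
  set (D := perimeter (a, b, c)).
  assert (HD : 0 <= D).
  { unfold D, perimeter. assert (H1 := Cmod_ge_0 (b - a)). assert (H2 := Cmod_ge_0 (c - b)).
    assert (H3 := Cmod_ge_0 (a - c)). lra. }
  assert (HT : forall n, inside r (T n)).
  { induction n; [exact HT0|]. apply (Hnxt (T n)), IHn. }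
  assert (Hper : forall n, perimeter (T n) = D / 2 ^ n).
  { induction n; [change (D = D / 1); field|].
    destruct (Hnxt (T n) (HT n)) as (_ & E & _). change (T (S n)) with (nxt (T n)). rewrite E, IHn. simpl. field.
    apply pow_nonzero; lra. }
  assert (Htri : forall n, Cmod (tri h a b c) <= 4 ^ n * Cmod (tri_int (T n))).
  { induction n; [simpl; lra|].
    destruct (Hnxt (T n) (HT n)) as (_ & _ & _ & E). eapply Rle_trans; [exact IHn|].
    change (T (S n)) with (nxt (T n)).
    simpl pow. rewrite (Rmult_comm 4), Rmult_assoc. apply Rmult_le_compat_l; [|exact E].
    apply pow_le; lra. }
  assert (Hdist : forall n k, Cmod (vertex (T (n + k)%nat) - vertex (T n)) <= perimeter (T n) - perimeter (T (n + k)%nat)).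
  { intros n; induction k.
    - rewrite Nat.add_0_r. replace (_ - _)%C with (RtoC 0) by ring. rewrite Cmod_0. lra.
    - destruct (Hnxt (T (n + k)%nat) (HT (n + k)%nat)) as (_ & E & V & _).
      rewrite Nat.add_succ_r. change (T (S (n + k))) with (nxt (T (n + k)%nat)).
      replace (vertex (nxt (T (n + k)%nat)) - vertex (T n))%C with
        ((vertex (nxt (T (n + k)%nat)) - vertex (T (n + k)%nat)) + (vertex (T (n + k)%nat) - vertex (T n)))%C by ring.
      eapply Rle_trans; [apply Cmod_triangle|]. lra. }
  assert (Hpow : forall n, 0 < 2 ^ n) by (intros; apply pow_lt; lra).
  assert (HperP : forall n, 0 <= perimeter (T n)).
  { intros n. rewrite Hper. apply Rmult_le_pos; [exact HD|]. apply Rlt_le, Rinv_0_lt_compat, Hpow. }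
  assert (Hlim : is_lim_seq (fun n => perimeter (T n)) 0).
  { apply is_lim_seq_ext with (fun n => D * (/ 2) ^ n).
    - intros n. rewrite Hper, pow_inv. reflexivity.
    - replace (Finite 0) with (Rbar_mult D 0) by (simpl; f_equal; ring).
      apply is_lim_seq_scal_l, is_lim_seq_geom. rewrite Rabs_pos_eq; lra. }
  destruct (C_cauchy_limit (fun n => vertex (T n)) (fun n => perimeter (T n))) as [p Hp]; [|exact Hlim|].
  { intros n k. eapply Rle_trans; [apply Hdist|]. assert (H := HperP (n + k)%nat). lra. }
  assert (Hpr : Cmod p <= r).
  { apply Rle_plus_epsilon. intros eps He.
    destruct (proj2 (is_lim_seq_spec _ _) Hlim (mkposreal _ He)) as [N HN].
    specialize (HN N (le_n N)). simpl in HN. rewrite Rminus_0_r in HN.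
    assert (H1 := Rle_abs (perimeter (T N))).
    replace p with (vertex (T N) + - (vertex (T N) - p))%C by ring.
    eapply Rle_trans; [apply Cmod_triangle|]. rewrite Cmod_opp.
    assert (H2 := Hp N). assert (H3 := HT N).
    destruct (T N) as [[x y] z]. destruct H3 as (H3 & _). unfold vertex at 1; simpl fst. lra. }
  destruct (Hh p ltac:(lra)) as [l Hl].
  (* At stage N the function is within eps * 2P of its linearisation at [p], along a path of length
     P = D / 2^N; the factor 4^N from [Htri] cancels against P^2. *)
  assert (Hmain : forall eps, 0 < eps -> Cmod (tri h a b c) <= eps * (2 * D * D)).
  { intros eps He.
    destruct (proj1 (Cderive_iff _ _ _) Hl (mkposreal _ He)) as [d Hd]. simpl in Hd.
    assert (Hd2 : 0 < d / 2) by (assert (H := cond_pos d); lra).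
    destruct (proj2 (is_lim_seq_spec _ _) Hlim (mkposreal _ Hd2)) as [N HN].
    specialize (HN N (le_n N)). simpl in HN. rewrite Rminus_0_r in HN.
    assert (HPd := Rle_abs (perimeter (T N))). assert (H2 := Hp N). assert (H3 := HT N).
    assert (H4 := Htri N). assert (H5 := Hper N). assert (H6 := HperP N).
    set (P := perimeter (T N)) in *.
    assert (Hgoal : Cmod (tri_int (T N)) <= eps * (2 * P) * P).
    { destruct (T N) as [[x y] z]. unfold vertex in H2; simpl fst in H2.
      destruct H3 as (Hx & Hy & Hz). unfold tri_int.
      assert (Dx := Cmod_ge_0 (y - x)). assert (Dy := Cmod_ge_0 (z - y)). assert (Dz := Cmod_ge_0 (x - z)).
      assert (DP : P = Cmod (y - x) + Cmod (z - y) + Cmod (x - z)) by reflexivity.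
      assert (Dzx : Cmod (z - x) = Cmod (x - z)).
      { replace (z - x)%C with (- (x - z))%C by ring. apply Cmod_opp. }
      assert (Near : forall u v t, Cmod (u - x) <= P -> Cmod (v - x) <= P -> 0 <= t <= 1 ->
         Cmod (h (point u v t) - (h p + l * (point u v t - p))) <= eps * (2 * P)).
      { intros u v t Hu Hv Ht. set (w := point u v t).
        assert (Hwx : Cmod (w - x) <= P).
        { unfold w. replace (point u v t - x)%C with (point (u - x) (v - x) t)
            by (unfold point; ring). now apply Cmod_point_le. }
        assert (Hw : Cmod (w - p) <= 2 * P).
        { replace (w - p)%C with ((w - x) + (x - p))%C by ring.
          eapply Rle_trans; [apply Cmod_triangle|]. lra. }
        replace (h w - (h p + l * (w - p)))%C with (h w - h p - (w - p) * l)%C by ring.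
        eapply Rle_trans; [apply Hd; lra|]. apply Rmult_le_compat_l; lra. }
      assert (Hxx : Cmod (x - x) <= P).
      { replace (x - x)%C with (RtoC 0) by ring. rewrite Cmod_0. lra. }
      assert (S1 := seg_affine_close rad h Hh x y (h p) l p (eps * (2 * P)) ltac:(lra) ltac:(lra)
                      (fun t Ht => Near x y t Hxx ltac:(lra) Ht)).
      assert (S2 := seg_affine_close rad h Hh y z (h p) l p (eps * (2 * P)) ltac:(lra) ltac:(lra)
                      (fun t Ht => Near y z t ltac:(lra) ltac:(lra) Ht)).
      assert (S3 := seg_affine_close rad h Hh z x (h p) l p (eps * (2 * P)) ltac:(lra) ltac:(lra)
                      (fun t Ht => Near z x t ltac:(lra) Hxx Ht)).
      set (A1 := (seg h x y - _)%C) in S1. set (A2 := (seg h y z - _)%C) in S2. set (A3 := (seg h z x - _)%C) in S3.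
      (* The integrals of the affine part add up to zero around the closed triangle. *)
      replace (tri h x y z) with (A1 + A2 + A3)%C by (unfold A1, A2, A3, tri; field).
      eapply Rle_trans; [apply Cmod_triangle|].
      apply Rle_trans with (Cmod A1 + Cmod A2 + Cmod A3); [apply Rplus_le_compat_r, Cmod_triangle|].
      rewrite DP at 2. rewrite !Rmult_plus_distr_l. lra. }
    eapply Rle_trans; [exact H4|].
    apply Rle_trans with (4 ^ N * (eps * (2 * P) * P)).
    - apply Rmult_le_compat_l; [apply pow_le; lra|exact Hgoal].
    - apply Req_le. rewrite H5. replace 4 with (2 * 2) by ring. rewrite Rpow_mult_distr.
      field. apply Rgt_not_eq, Hpow. }
  apply Cmod_eq_0. apply Rle_antisym; [|apply Cmod_ge_0].
  apply Rle_plus_epsilon. intros eps He.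
  assert (Hq : 0 < 1 + 2 * D * D) by nra.
  eapply Rle_trans; [apply (Hmain (eps / (1 + 2 * D * D)))|].
  - apply Rdiv_lt_0_compat; lra.
  - rewrite Rplus_0_l. apply Rmult_le_reg_r with (1 + 2 * D * D); [lra|].
    replace (eps / (1 + 2 * D * D) * (2 * D * D) * (1 + 2 * D * D)) with (eps * (2 * D * D)) by (field; lra).
    nra.
Qed.

Lemma integral_from_0_seg z : integral_from_0 h z = seg h (RtoC 0) z.
Proof.
  unfold integral_from_0, seg. apply CInt_ext. intros t _.
  replace (point 0 z t) with (RtoC t * z)%C by (unfold point; ring). ring.
Qed.

(** Goursat for the triangle 0, z, w turns the increment of the primitive into the integral over the
    segment from z to w, on which [h] is nearly constant. *)
Lemma integral_from_0_derive z : Cmod z < rad ->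
  is_derive (K := C_AbsRing) (V := C_NormedModule) (integral_from_0 h) z (h z).
Proof.
  intros Hz. apply Cderive_iff. intros eps.
  destruct (proj1 (Ccontinuous_iff _ _) (holo_continuous _ _ _ Hh Hz) eps) as [d Hd].
  assert (Hp : 0 < Rmin d (rad - Cmod z)) by (apply Rmin_pos; [apply cond_pos|lra]).
  exists (mkposreal _ Hp); simpl; intros w Hw.
  assert (H1 := Rlt_le_trans _ _ _ Hw (Rmin_l _ _)).
  assert (H2 := Rlt_le_trans _ _ _ Hw (Rmin_r _ _)).
  assert (Hwr : Cmod w < rad).
  { replace w with (z + (w - z))%C by ring. eapply Rle_lt_trans; [apply Cmod_triangle|]. lra. }
  assert (H0 : Cmod 0 < rad) by (rewrite Cmod_0; assert (H := Cmod_ge_0 z); lra).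
  rewrite !integral_from_0_seg.
  assert (G := goursat 0 z w H0 Hz Hwr). unfold tri in G.
  rewrite (seg_rev rad h Hh 0 w) in G by assumption.
  assert (S := seg_affine_close rad h Hh z w (h z) 0 0 eps Hz Hwr).
  replace (seg h 0 w - seg h 0 z - (w - z) * h z)%C with
    (seg h z w - (h z * (w - z) + 0 * ((w - 0) * (w - 0) - (z - 0) * (z - 0)) / 2))%C.
  - apply S. intros t Ht.
    replace (_ - _)%C with (h (point z w t) - h z)%C by ring.
    apply Rlt_le, Hd. unfold point.
    replace (z + RtoC t * (w - z) - z)%C with (RtoC t * (w - z))%C by ring.
    rewrite Cmod_mult, Cmod_R, Rabs_pos_eq by lra. assert (H := Cmod_ge_0 (w - z)). nra.
  - replace (seg h z w) with (seg h 0 w - seg h 0 z + (seg h 0 z + seg h z w + - seg h 0 w))%C by ring.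
    rewrite G. field.
Qed.
End Goursat.

(** * Parameter integrals and Fubini's theorem *)

Lemma ex_RInt_cont_R (f : R -> R) a b :
  (forall t, Rmin a b <= t <= Rmax a b -> continuous f t) -> ex_RInt f a b.
Proof. exact (ex_RInt_continuous (V := R_CompleteNormedModule) f a b). Qed.

Lemma continuity_2d_pt_l (f : R -> R -> R) x y :
  continuity_2d_pt f x y -> continuous (fun u => f u y) x.
Proof.
  intros H. apply continuity_2d_pt_filterlim in H.
  apply (filterlim_comp _ _ _ (fun u => (u, y)) (fun z => f (fst z) (snd z))) with (2 := H).
  apply (filterlim_locally (U := prod_UniformSpace R_UniformSpace R_UniformSpace)). intros eps. exists eps. intros u Hu.
  split; [exact Hu|apply ball_center].
Qed.

Lemma continuity_2d_pt_r (f : R -> R -> R) x y :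
  continuity_2d_pt f x y -> continuous (f x) y.
Proof.
  intros H. apply continuity_2d_pt_filterlim in H.
  apply (filterlim_comp _ _ _ (fun u => (x, u)) (fun z => f (fst z) (snd z))) with (2 := H).
  apply (filterlim_locally (U := prod_UniformSpace R_UniformSpace R_UniformSpace)). intros eps. exists eps. intros u Hu.
  split; [apply ball_center|exact Hu].
Qed.

Lemma continuity_2d_pt_swap (f : R -> R -> R) x y :
  continuity_2d_pt f x y -> continuity_2d_pt (fun u v => f v u) y x.
Proof. intros H eps. destruct (H eps) as [d Hd]. exists d. intros u v Hu Hv. now apply Hd. Qed.

Lemma continuity_2d_pt_pair (f : R * R -> R) x y :
  continuous (T := prod_UniformSpace R_UniformSpace R_UniformSpace) f (x, y) ->
  continuity_2d_pt (fun u v => f (u, v)) x y.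
Proof.
  intros H eps. destruct (proj1 (filterlim_locally f (f (x, y))) H eps) as [d Hd].
  exists d. intros u v Hu Hv. apply (Hd (u, v)). split; assumption.
Qed.

(** Uniform continuity over the compact range of [u]. Continuity is asked only for parameters near
    [t], since the integrands met here are continuous only for radii inside the disc. *)
Lemma continuous_RInt_param (f : R -> R -> R) a b t : a <= b ->
  locally t (fun v => forall u, a <= u <= b -> continuity_2d_pt f u v) ->
  continuous (fun v => RInt (fun u => f u v) a b) t.
Proof.
  intros Hab [d0 Hf]. apply filterlim_locally. intros eps.
  (* The summand 1 keeps the divisor positive when [a = b]. *)
  assert (He : 0 < eps / (b - a + 1)) by (apply Rdiv_lt_0_compat; [apply cond_pos|lra]).
  destruct (uniform_continuity_2d_1d f a b t (fun x Hx => Hf t (ball_center _ _) x Hx) (mkposreal _ He)) as [d Hd].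
  assert (Hp : 0 < Rmin d d0) by (apply Rmin_pos; apply cond_pos).
  simpl in Hd. exists (mkposreal _ Hp). intros v Hv.
  assert (Hv' : Rabs (v - t) < Rmin d d0) by exact Hv.
  assert (Hv1 := Rlt_le_trans _ _ _ Hv' (Rmin_l _ _)). assert (Hv2 := Rlt_le_trans _ _ _ Hv' (Rmin_r _ _)).
  assert (Hex : forall w, Rabs (w - t) < d0 -> ex_RInt (fun u => f u w) a b).
  { intros w Hw. apply ex_RInt_cont_R. rewrite Rmin_left, Rmax_right by lra.
    intros u Hu. apply continuity_2d_pt_l, Hf; [exact Hw|exact Hu]. }
  assert (Ht : Rabs (t - t) < d0) by (replace (t - t) with 0 by ring; rewrite Rabs_R0; apply cond_pos).
  change (Rabs (RInt (fun u => f u v) a b - RInt (fun u => f u t) a b) < eps).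
  apply Rabs_def2 in Hv1.
  assert (E : RInt (fun u => f u v) a b - RInt (fun u => f u t) a b = RInt (fun u => f u v - f u t) a b).
  { symmetry. apply (RInt_minus (V := R_CompleteNormedModule)); now apply Hex. }
  rewrite E. eapply Rle_lt_trans.
  - apply abs_RInt_le_const with (M := eps / (b - a + 1)); [exact Hab| |].
    + apply (ex_RInt_minus (V := R_NormedModule)); now apply Hex.
    + intros u Hu. apply Rlt_le, Hd; try lra. replace (u - u) with 0 by ring. rewrite Rabs_R0. apply cond_pos.
  - apply Rmult_lt_reg_r with (b - a + 1); [lra|].
    replace ((b - a) * (eps / (b - a + 1)) * (b - a + 1)) with ((b - a) * eps) by (field; lra).
    assert (H := cond_pos eps). nra.
Qed.

Lemma locally_between (P : R -> Prop) A B x : A < x < B -> (forall y, A < y < B -> P y) -> locally x P.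
Proof.
  intros Hx HP. assert (Hp : 0 < Rmin (x - A) (B - x)) by (apply Rmin_pos; lra).
  exists (mkposreal _ Hp). intros y Hy.
  assert (Hy' : Rabs (y - x) < Rmin (x - A) (B - x)) by exact Hy.
  assert (H1 := Rlt_le_trans _ _ _ Hy' (Rmin_l _ _)). assert (H2 := Rlt_le_trans _ _ _ Hy' (Rmin_r _ _)).
  apply Rabs_def2 in H1. apply Rabs_def2 in H2. apply HP. lra.
Qed.

(* Both sides, as functions of the upper bound [b], have the same derivative. *)
Lemma RInt_swap (f : R -> R -> R) A B a b c d : A < a -> a <= b -> b < B -> c <= d ->
  (forall u v, A < u < B -> continuity_2d_pt f u v) ->
  RInt (fun u => RInt (f u) c d) a b = RInt (fun v => RInt (fun u => f u v) a b) c d.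
Proof.
  intros HAa Hab HbB Hcd Hf.
  (* A base point strictly to the left of [a], so that the integral from it is differentiable on
     both sides of [a]. *)
  set (a' := (A + a) / 2).
  assert (Hex : forall x y v, A < x < B -> A < y < B -> ex_RInt (fun u => f u v) x y).
  { intros x y v Hx Hy. apply ex_RInt_cont_R. intros u Hu. apply continuity_2d_pt_l, Hf.
    revert Hu. unfold Rmin, Rmax; destruct (Rle_dec x y); lra. }
  set (phi := fun x v => RInt (fun u => f u v) a' x).
  set (H := fun x => RInt (fun v => phi x v) c d).
  assert (Dphi : forall x v, A < x < B -> is_derive (fun y => phi y v) x (f x v)).
  { intros x v Hx. apply (is_derive_RInt (V := R_NormedModule) (fun u => f u v) _ a').
    - apply (locally_between _ A B); [exact Hx|]. intros y Hy.
      apply (RInt_correct (V := R_CompleteNormedModule)), Hex; unfold a'; lra.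
    - now apply continuity_2d_pt_l, Hf. }
  assert (DH : forall x, a <= x <= b -> is_derive H x (RInt (f x) c d)).
  { intros x Hx.
    assert (Hp : 0 < Rmin (x - a') (B - x)) by (apply Rmin_pos; unfold a'; lra).
    assert (Hloc : forall y, Rabs (y - x) < Rmin (x - a') (B - x) -> a' < y < B).
    { intros y Hy. assert (H1 := Rlt_le_trans _ _ _ Hy (Rmin_l _ _)).
      assert (H2 := Rlt_le_trans _ _ _ Hy (Rmin_r _ _)).
      apply Rabs_def2 in H1. apply Rabs_def2 in H2. lra. }
    replace (RInt (f x) c d) with (RInt (fun v => Derive (fun y => phi y v) x) c d).
    2: { apply RInt_ext. intros v _. apply is_derive_unique, Dphi. lra. }
    apply is_derive_RInt_param.
    - exists (mkposreal _ Hp). intros y Hy v _. eexists. apply Dphi.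
      specialize (Hloc y Hy). unfold a' in Hloc. lra.
    - intros v _. apply continuity_2d_pt_ext_loc with f; [|apply Hf; lra].
      exists (mkposreal _ Hp). intros y w Hy _. symmetry. apply is_derive_unique, Dphi.
      specialize (Hloc y Hy). unfold a' in Hloc. lra.
    - exists (mkposreal _ Hp). intros y Hy. specialize (Hloc y Hy).
      apply ex_RInt_cont_R. intros v _. apply continuous_RInt_param; [lra|].
      apply filter_forall. intros w u Hu. apply Hf. unfold a' in *. lra. }
  assert (E : RInt (fun u => RInt (f u) c d) a b = H b - H a).
  { apply (is_RInt_unique (V := R_CompleteNormedModule)).
    apply (is_RInt_derive (V := R_CompleteNormedModule) H).
    - rewrite Rmin_left, Rmax_right by lra. exact DH.
    - rewrite Rmin_left, Rmax_right by lra. intros x Hx.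
      apply (continuous_RInt_param (fun u v => f v u)); [exact Hcd|].
      apply (locally_between _ A B); [lra|]. intros y Hy u _. now apply continuity_2d_pt_swap, Hf. }
  rewrite E. unfold H.
  assert (Hc : forall x, a <= x <= b -> ex_RInt (fun v => phi x v) c d).
  { intros x Hx. apply ex_RInt_cont_R. intros v _. apply continuous_RInt_param; [unfold a'; lra|].
    apply filter_forall. intros w u Hu. apply Hf. unfold a' in *; lra. }
  etransitivity; [symmetry; apply (RInt_minus (V := R_CompleteNormedModule)); apply Hc; lra|].
  apply RInt_ext. intros v _. unfold phi.
  assert (C := RInt_Chasles (V := R_CompleteNormedModule) (fun u => f u v) a' a b
    (Hex a' a v ltac:(unfold a'; lra) ltac:(lra)) (Hex a b v ltac:(lra) ltac:(lra))).
  rewrite <- C. unfold minus, plus, opp; simpl. ring.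
Qed.

Notation cont2 f u v :=
  (continuous (T := prod_UniformSpace R_UniformSpace R_UniformSpace) (U := C_UniformSpace)
     (fun p => f (fst p) (snd p)) (u, v)).

Lemma cont2_fst (f : R -> R -> C) u v : cont2 f u v -> continuity_2d_pt (fun x y => fst (f x y)) u v.
Proof. intros H. apply continuity_2d_pt_filterlim. apply (continuous_C_fst _ _ H). Qed.

Lemma cont2_snd (f : R -> R -> C) u v : cont2 f u v -> continuity_2d_pt (fun x y => snd (f x y)) u v.
Proof. intros H. apply continuity_2d_pt_filterlim. apply (continuous_C_snd _ _ H). Qed.

Lemma cont2_swap (f : R -> R -> C) u v : cont2 f u v -> cont2 (fun x y => f y x) v u.
Proof.
  intros H. apply continuous_C_pair.
  - apply (proj1 (continuity_2d_pt_filterlim (fun x y => fst (f y x)) v u)).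
    apply (continuity_2d_pt_swap (fun x y => fst (f x y))), cont2_fst, H.
  - apply (proj1 (continuity_2d_pt_filterlim (fun x y => snd (f y x)) v u)).
    apply (continuity_2d_pt_swap (fun x y => snd (f x y))), cont2_snd, H.
Qed.

Lemma cont2_l (f : R -> R -> C) u v : cont2 f u v -> continuous (U := C_UniformSpace) (fun x => f x v) u.
Proof.
  intros H. apply continuous_C_pair; [apply (continuity_2d_pt_l (fun x y => fst (f x y))), cont2_fst, H|
    apply (continuity_2d_pt_l (fun x y => snd (f x y))), cont2_snd, H].
Qed.

Lemma cont2_r (f : R -> R -> C) u v : cont2 f u v -> continuous (U := C_UniformSpace) (f u) v.
Proof.
  intros H. apply continuous_C_pair; [apply (continuity_2d_pt_r (fun x y => fst (f x y))), cont2_fst, H|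
    apply (continuity_2d_pt_r (fun x y => snd (f x y))), cont2_snd, H].
Qed.

Lemma continuous_CInt_param (f : R -> R -> C) a b t : a <= b ->
  locally t (fun u => forall v, a <= v <= b -> cont2 f u v) ->
  continuous (U := C_UniformSpace) (fun u => CInt (f u) a b) t.
Proof.
  intros Hab Hf.
  apply continuous_ext_loc with (fun u => (RInt (fun v => fst (f u v)) a b, RInt (fun v => snd (f u v)) a b)).
  - revert Hf. apply filter_imp. intros u Hu. symmetry. apply CInt_pair, ex_CInt_cont.
    intros v. rewrite Rmin_left, Rmax_right by lra. intros Hv. now apply cont2_r, Hu.
  - apply continuous_C_pair; simpl.
    + apply (continuous_RInt_param (fun v u => fst (f u v))); [exact Hab|].
      revert Hf. apply filter_imp. intros u Hu v Hv.
      apply (continuity_2d_pt_swap (fun u v => fst (f u v))). now apply cont2_fst, Hu.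
    + apply (continuous_RInt_param (fun v u => snd (f u v))); [exact Hab|].
      revert Hf. apply filter_imp. intros u Hu v Hv.
      apply (continuity_2d_pt_swap (fun u v => snd (f u v))). now apply cont2_snd, Hu.
Qed.

Lemma CInt_swap (f : R -> R -> C) A B a b c d : A < a -> a <= b -> b < B -> c <= d ->
  (forall u v, A < u < B -> cont2 f u v) ->
  CInt (fun u => CInt (f u) c d) a b = CInt (fun v => CInt (fun u => f u v) a b) c d.
Proof.
  intros HA Hab HB Hcd Hf.
  assert (H1 : forall u, A < u < B -> CInt (f u) c d = (RInt (fun v => fst (f u v)) c d, RInt (fun v => snd (f u v)) c d)).
  { intros u Hu. apply CInt_pair, ex_CInt_cont. intros v _. now apply cont2_r, Hf. }
  assert (H2 : forall v, CInt (fun u => f u v) a b = (RInt (fun u => fst (f u v)) a b, RInt (fun u => snd (f u v)) a b)).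
  { intros v. apply CInt_pair, ex_CInt_cont. intros u. rewrite Rmin_left, Rmax_right by lra. intros Hu.
    apply (cont2_l f), Hf. lra. }
  rewrite (CInt_pair _ a b), (CInt_pair _ c d).
  - f_equal.
    + rewrite (RInt_ext (V := R_CompleteNormedModule) _ (fun u => RInt (fun v => fst (f u v)) c d) a b).
      2: { rewrite Rmin_left, Rmax_right by lra. intros u Hu. rewrite H1; [reflexivity|lra]. }
      rewrite (RInt_ext (V := R_CompleteNormedModule) _ (fun v => RInt (fun u => fst (f u v)) a b) c d).
      2: { intros v _. now rewrite H2. }
      apply (RInt_swap (fun u v => fst (f u v)) A B); try assumption. intros u v Hu. now apply cont2_fst, Hf.
    + rewrite (RInt_ext (V := R_CompleteNormedModule) _ (fun u => RInt (fun v => snd (f u v)) c d) a b).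
      2: { rewrite Rmin_left, Rmax_right by lra. intros u Hu. rewrite H1; [reflexivity|lra]. }
      rewrite (RInt_ext (V := R_CompleteNormedModule) _ (fun v => RInt (fun u => snd (f u v)) a b) c d).
      2: { intros v _. now rewrite H2. }
      apply (RInt_swap (fun u v => snd (f u v)) A B); try assumption. intros u v Hu. now apply cont2_snd, Hf.
  - apply ex_CInt_cont. intros v _. apply (continuous_CInt_param (fun v u => f u v)); [exact Hab|].
    apply filter_forall. intros w u Hu.
    apply cont2_swap, Hf. lra.
  - apply ex_CInt_cont. intros u. rewrite Rmin_left, Rmax_right by lra. intros Hu.
    apply continuous_CInt_param; [exact Hcd|].
    apply (locally_between _ A B); [lra|]. intros y Hy v _. now apply Hf.
Qed.

(** * The mean value property *)

Lemma Cmod_circle s t : Cmod (RtoC s * expi t) = Rabs s.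
Proof. rewrite Cmod_mult, Cmod_R, Cmod_expi. ring. Qed.

Lemma Rderive_circle (c : C) t :
  is_derive (K := R_AbsRing) (V := C_R_NormedModule) (fun t => (c * expi t)%C) t (Ci * (c * expi t))%C.
Proof.
  assert (D : is_derive (K := C_AbsRing) (V := C_NormedModule) (fun z => (c * z)%C) (expi t)
     (RtoC 0 * expi t + c * RtoC 1)%C)
    by (apply (Cderive_mult (fun _ => c) (fun z => z)); [apply Cderive_const|apply Cderive_id]).
  assert (E : (Ci * (c * expi t))%C = (Ci * expi t * (RtoC 0 * expi t + c * RtoC 1))%C) by ring.
  rewrite E. exact (Rderive_along _ expi t _ _ D (Rderive_expi t)).
Qed.

Lemma expi_opp t : expi (- t) = (/ expi t)%C.
Proof.
  assert (H := expi_nz t).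
  assert (E : (expi t * expi (- t))%C = RtoC 1).
  { rewrite <- expi_plus. replace (t + - t) with 0 by ring. apply expi_0. }
  rewrite <- (Cmult_1_l (/ expi t)), <- E. now field.
Qed.

Section Mean.
Context (rad : R) (k : C -> C) (Hk : holo rad k).

Lemma cont2_circle s t : Rabs s < rad -> cont2 (fun s t => k (RtoC s * expi t)%C) s t.
Proof.
  intros Hs.
  apply (continuous_comp (fun p : R * R => (RtoC (fst p) * expi (snd p))%C) k).
  - apply continuous_Cmult; [apply continuous_RtoC, continuous_fst|apply continuous_expi, continuous_snd].
  - apply holo_continuous with (1 := Hk). simpl fst; simpl snd. now rewrite Cmod_circle.
Qed.

Lemma continuous_circle s t : Rabs s < rad ->
  continuous (U := C_UniformSpace) (fun t => k (RtoC s * expi t)%C) t.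
Proof. intros Hs. apply (cont2_r (fun s t => k (RtoC s * expi t)%C)), cont2_circle, Hs. Qed.

Definition circle_int (s : R) : C := CInt (fun t => k (RtoC s * expi t)%C) 0 (2 * PI).

Lemma PI2_pos : 0 < 2 * PI. Proof. generalize PI_RGT_0; lra. Qed.

Lemma continuous_circle_int s : Rabs s < rad -> continuous (U := C_UniformSpace) circle_int s.
Proof.
  intros Hs. apply Rabs_def2 in Hs.
  apply (continuous_CInt_param (fun s t => k (RtoC s * expi t)%C)); [apply Rlt_le, PI2_pos|].
  apply (locally_between _ (- rad) rad); [lra|]. intros y Hy v _. apply cont2_circle, Rabs_def1; lra.
Qed.

(* [K] is a primitive of [k]; integrating [d/dt (K(s e^it) e^-it)] over a period
   gives [s M(s)], and integrating [d/dr (K(r e^it) e^-it)] over [0, s] gives the other side. *)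
Lemma circle_int_average s : 0 < s < rad -> (RtoC s * circle_int s = CInt circle_int 0 s)%C.
Proof.
  intros Hs. set (K := integral_from_0 k).
  assert (HK : forall z, Cmod z < rad -> is_derive (K := C_AbsRing) (V := C_NormedModule) K z (k z))
    by (intros z Hz; now apply (integral_from_0_derive rad)).
  assert (HKc : forall z, Cmod z < rad -> Ccontinuous K z).
  { intros z Hz. apply ex_derive_Ccontinuous. eexists. now apply HK. }
  assert (HK0 : K (RtoC 0) = RtoC 0).
  { unfold K. rewrite integral_from_0_seg. unfold seg.
    rewrite (CInt_ext _ (fun _ => RtoC 0)); [rewrite CInt_const; ring|]. intros t _. ring. }
  assert (Hee : forall t, (expi t * expi (- t))%C = RtoC 1).
  { intros t. rewrite <- expi_plus. replace (t + - t) with 0 by ring. apply expi_0. }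
  set (A := CInt (fun t => (K (RtoC s * expi t) * expi (- t))%C) 0 (2 * PI)).
  assert (EA : A = CInt circle_int 0 s).
  { unfold A, circle_int.
    rewrite (CInt_swap (fun s t => k (RtoC s * expi t)%C) (- rad) rad 0 s 0 (2 * PI)); try lra.
    - apply CInt_ext. intros t _.
      rewrite (CInt_derive (fun r => (K (RtoC r * expi t) * expi (- t))%C)).
      + replace (RtoC 0 * expi t)%C with (RtoC 0) by ring. rewrite HK0. ring.
      + rewrite Rmin_left, Rmax_right by lra. intros r Hr.
        assert (Hr' : Cmod (RtoC r * expi t) < rad) by (rewrite Cmod_circle, Rabs_pos_eq; lra).
        assert (D : is_derive (K := C_AbsRing) (V := C_NormedModule) (fun z => (K z * expi (- t))%C)
                (RtoC r * expi t)%C (k (RtoC r * expi t) * expi (- t) + K (RtoC r * expi t) * RtoC 0)%C)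
          by (apply (Cderive_mult K (fun _ => expi (- t))); [now apply HK|apply Cderive_const]).
        assert (D' := Rderive_along _ (fun r => (RtoC r * expi t)%C) r _ (expi t) D).
        assert (E : (expi t * (k (RtoC r * expi t) * expi (- t) + K (RtoC r * expi t) * RtoC 0))%C = k (RtoC r * expi t)%C).
        { transitivity ((expi t * expi (- t)) * k (RtoC r * expi t))%C; [ring|]. rewrite Hee. ring. }
        rewrite E in D'. apply D'.
        apply (is_derive_ext (fun r => (RtoC 0 + RtoC r * expi t)%C)); [intros; apply Cplus_0_l|].
        apply Rderive_C_scal.
      + unfold cont_on. rewrite Rmin_left, Rmax_right by lra. intros r Hr.
        apply (cont2_l (fun s t => k (RtoC s * expi t)%C)), cont2_circle. rewrite Rabs_pos_eq; lra.
    - apply Rlt_le, PI2_pos.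
    - intros u v Hu. apply cont2_circle, Rabs_def1; lra. }
  rewrite <- EA.
  assert (Hc1 : cont_on (fun t => k (RtoC s * expi t)%C) 0 (2 * PI)).
  { intros t _. apply continuous_circle. rewrite Rabs_pos_eq; lra. }
  assert (Hc2 : cont_on (fun t => (K (RtoC s * expi t) * expi (- t))%C) 0 (2 * PI)).
  { intros t _. apply continuous_Cmult; [|apply continuous_expi, (continuous_opp (V := R_NormedModule)), continuous_id].
    apply (continuous_comp (fun t : R => (RtoC s * expi t)%C) K).
    - apply continuous_Cmult; [apply continuous_const|apply continuous_expi, continuous_id].
    - apply HKc. rewrite Cmod_circle, Rabs_pos_eq; lra. }
  assert (B : (Ci * (RtoC s * circle_int s - A))%C = RtoC 0).
  { unfold circle_int, A. rewrite <- CInt_mult_l, <- CInt_minus by (assumption || (apply cont_on_mult; [apply cont_on_const|assumption])).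
    rewrite <- CInt_mult_l.
    2: { intros t Ht. apply continuous_Cminus; [apply (cont_on_mult _ _ _ _ (cont_on_const (RtoC s) _ _) Hc1 t Ht)|now apply Hc2]. }
    rewrite (CInt_derive (fun t => (K (RtoC s * expi t) * expi (- t))%C)).
    - rewrite expi_2PI, expi_0.
      replace (expi (- (2 * PI))) with (RtoC 1); [replace (- 0) with 0 by ring; rewrite expi_0; ring|].
      rewrite <- (Cmult_1_l (expi _)), <- expi_2PI, Hee, expi_2PI. reflexivity.
    - intros t _.
      assert (Ht : Cmod (RtoC s * expi t) < rad) by (rewrite Cmod_circle, Rabs_pos_eq; lra).
      assert (Hs0 : RtoC s <> RtoC 0) by (intros E; apply RtoC_inj in E; lra).
      assert (Het := expi_nz t).
      set (z := (RtoC s * expi t)%C) in *.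
      assert (Hz : z <> RtoC 0) by now apply Cmult_neq_0.
      (* On the circle the factor e^-it equals s/z; in this form the integrand is a function of z
         with a complex derivative, to which [Rderive_along] applies. *)
      assert (D : is_derive (K := C_AbsRing) (V := C_NormedModule) (fun z => (K z * (RtoC s * / z))%C) z
         (k z * (RtoC s * / z) + K z * (RtoC 0 * / z + RtoC s * - / (z * z)))%C).
      { apply (Cderive_mult K (fun z => (RtoC s * / z)%C)); [now apply HK|].
        apply (Cderive_mult (fun _ => RtoC s) Cinv); [apply Cderive_const|now apply Cderive_inv]. }
      assert (D' := Rderive_along _ (fun t => (RtoC s * expi t)%C) t _ _ D (Rderive_circle (RtoC s) t)). fold z in D'.
      assert (E : (Ci * z * (k z * (RtoC s * / z) + K z * (RtoC 0 * / z + RtoC s * - / (z * z))))%C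
        = (Ci * (RtoC s * k z - K z * expi (- t)))%C).
      { rewrite expi_opp. unfold z. field. split; assumption. }
      rewrite E in D'. revert D'. apply is_derive_ext. intros u. rewrite expi_opp.
      assert (Heu := expi_nz u).
      assert (E' : (RtoC s * / (RtoC s * expi u))%C = (/ expi u)%C) by (field; split; assumption).
      now rewrite E'.
    - apply cont_on_mult; [apply cont_on_const|]. intros t Ht.
      apply continuous_Cminus; [|now apply Hc2].
      apply (cont_on_mult _ _ _ _ (cont_on_const (RtoC s) _ _) Hc1 t Ht). }
  assert (HCi := Ci_nz).
  replace (RtoC s * circle_int s)%C with (A + / Ci * (Ci * (RtoC s * circle_int s - A)))%C by now field.
  rewrite B. ring.
Qed.

(** With G the integral of [m] from 0, the quotient G(s)/s equals m(s) and has derivative (s m(s) -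
    G(s)) / s^2 = 0; continuity at 0 identifies the constant. *)
Lemma average_fixed_const (m : R -> R) r : 0 < r ->
  (forall s, - r < s < r -> continuous m s) ->
  (forall s, 0 < s < r -> s * m s = RInt m 0 s) ->
  forall s, 0 < s < r -> m s = m 0.
Proof.
  intros Hr Hc Hm s Hs.
  set (G := fun s => RInt m 0 s).
  assert (HG : forall s, 0 < s < r -> is_derive G s (m s)).
  { intros x Hx. apply (is_derive_RInt (V := R_NormedModule) m G 0).
    - apply (locally_between _ (- r) r); [lra|]. intros y Hy.
      apply (RInt_correct (V := R_CompleteNormedModule)), ex_RInt_cont_R. intros t Ht. apply Hc.
      revert Ht. unfold Rmin, Rmax. destruct (Rle_dec 0 y); lra.
    - apply Hc; lra. }
  assert (Hq : forall s, 0 < s < r -> is_derive (fun s => G s / s) s 0).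
  { intros x Hx. replace 0 with ((m x * x - G x * 1) / x ^ 2).
    - apply (is_derive_div G (fun s => s)); [now apply HG| |lra]. apply (is_derive_id (K := R_AbsRing)).
    - unfold G. rewrite <- Hm by exact Hx. field. lra. }
  assert (Hmq : forall s, 0 < s < r -> m s = G s / s).
  { intros x Hx. unfold G. rewrite <- Hm by exact Hx. field; lra. }
  apply cond_eq. intros eps He.
  destruct (proj1 (filterlim_locally (F := locally 0) m (m 0)) (Hc 0 ltac:(lra)) (mkposreal _ He)) as [d Hd].
  set (x := Rmin s (d / 2)).
  assert (Hdp := cond_pos d).
  assert (Hx : 0 < x) by (apply Rmin_pos; lra).
  assert (Hxs : x <= s) by apply Rmin_l.
  assert (Hxd : x <= d / 2) by apply Rmin_r.
  assert (Ex : m s = m x).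
  { destruct (Req_dec x s) as [->|Hne]; [reflexivity|].
    rewrite !Hmq by lra. symmetry.
    apply (eq_is_derive (V := R_NormedModule) (fun s => G s / s)); [|lra].
    intros t Ht. apply Hq. lra. }
  rewrite Ex. apply (Hd x). change (Rabs (x - 0) < d). rewrite Rminus_0_r, Rabs_pos_eq; lra.
Qed.

Lemma mean_value s : 0 < s < rad -> circle_int s = (RtoC (2 * PI) * k (RtoC 0))%C.
Proof.
  intros Hs.
  assert (E0 : circle_int 0 = (RtoC (2 * PI) * k (RtoC 0))%C).
  { unfold circle_int. rewrite (CInt_ext _ (fun _ => k (RtoC 0))).
    - rewrite CInt_const. now rewrite Rminus_0_r.
    - intros t _. f_equal. ring. }
  rewrite <- E0.
  assert (Hc : forall s, - rad < s < rad -> continuous (U := C_UniformSpace) circle_int s).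
  { intros x Hx. apply continuous_circle_int, Rabs_def1; lra. }
  assert (Havg : forall s, 0 < s < rad -> (RtoC s * circle_int s)%C =
     (RInt (fun t => fst (circle_int t)) 0 s, RInt (fun t => snd (circle_int t)) 0 s)).
  { intros x Hx. rewrite circle_int_average by exact Hx. apply CInt_pair, ex_CInt_cont.
    intros t. rewrite Rmin_left, Rmax_right by lra. intros Ht. apply Hc. lra. }
  assert (H1 : fst (circle_int s) = fst (circle_int 0)).
  { apply (average_fixed_const (fun s => fst (circle_int s)) rad); [lra| | |exact Hs].
    - intros x Hx. apply continuous_C_fst, Hc, Hx.
    - intros x Hx. generalize (f_equal fst (Havg x Hx)); simpl. intros <-. ring. }
  assert (H2 : snd (circle_int s) = snd (circle_int 0)).
  { apply (average_fixed_const (fun s => snd (circle_int s)) rad); [lra| | |exact Hs].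
    - intros x Hx. apply continuous_C_snd, Hc, Hx.
    - intros x Hx. generalize (f_equal snd (Havg x Hx)); simpl. intros <-. ring. }
  destruct (circle_int s), (circle_int 0). simpl in *. congruence.
Qed.
End Mean.

(** * The sub-mean-value property of the square root *)

Lemma ex_RInt_all (v : R -> R) a b : (forall t, continuous v t) -> ex_RInt v a b.
Proof. intros H. apply ex_RInt_cont_R. intros t _. apply H. Qed.

Lemma RInt_shift (v : R -> R) T a b : (forall t, continuous v t) ->
  RInt (fun t => v (t + T)) a b = RInt v (a + T) (b + T).
Proof.
  intros Hv. assert (E := RInt_comp_lin (V := R_CompleteNormedModule) v 1 T a b).
  rewrite !Rmult_1_l in E. rewrite <- E by now apply ex_RInt_all.
  apply RInt_ext. intros t _. change (v (t + T) = 1 * v (1 * t + T)). now rewrite !Rmult_1_l.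
Qed.

Lemma RInt_Chasles_all (v : R -> R) a b c : (forall t, continuous v t) ->
  RInt v a b + RInt v b c = RInt v a c.
Proof. intros Hv. apply (RInt_Chasles (V := R_CompleteNormedModule)); now apply ex_RInt_all. Qed.

Lemma RInt_periodic (v : R -> R) T x : (forall t, continuous v t) ->
  (forall t, v (t + T) = v t) -> RInt v x (x + T) = RInt v 0 T.
Proof.
  intros Hv Hp. rewrite <- (RInt_Chasles_all v x 0), <- (RInt_Chasles_all v 0 T (x + T)) by exact Hv.
  assert (E : RInt v T (x + T) = RInt v 0 x).
  { rewrite <- (Rplus_0_l T) at 1. rewrite <- RInt_shift by exact Hv. apply RInt_ext. intros t _. apply Hp. }
  rewrite E. assert (E2 := RInt_Chasles_all v x 0 x Hv). rewrite RInt_point in E2.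
  change (@zero _) with 0 in E2. lra.
Qed.

(** * Averages over equally spaced points of the circle *)

Section DyadicAverages.
Context (v : R -> R) (Hv : forall t, continuous v t) (Hp : forall t, v (t + 2 * PI) = v t).

(** The mean of [v] over the 2^m points t + 2 PI j / 2^m, a Riemann sum of its mean over the period;
    the recursion by halves runs parallel to that of [rotation_product]. *)
Fixpoint dyadic_average (m : nat) (t : R) : R :=
  match m with
  | O => v t
  | S m => (dyadic_average m t + dyadic_average m (t + 2 * PI / 2 ^ S m)) / 2
  end.

Lemma pow2_pos n : 0 < 2 ^ n. Proof. apply pow_lt; lra. Qed.

Lemma continuous_shift (f : R -> R) T t : (forall t, continuous f t) -> continuous (fun t => f (t + T)) t.
Proof.
  intros Hf. apply (continuous_comp (fun t => t + T) f); [|apply Hf].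
  apply continuous_Rplus; [apply continuous_id|apply continuous_const].
Qed.

Lemma continuous_dyadic_average m t : continuous (dyadic_average m) t.
Proof.
  revert t; induction m; intros t; [apply Hv|].
  apply (continuous_Rmult (fun t => dyadic_average m t + dyadic_average m (t + 2 * PI / 2 ^ S m)) (fun _ => / 2));
    [|apply continuous_const].
  apply continuous_Rplus; [apply IHm|]. now apply continuous_shift.
Qed.

(** The 2^m translates of an interval of length 2 PI / 2^m tile a period, so over that interval the
    averages have the same mean as [v] over the period. *)
Lemma RInt_dyadic_average m x :
  RInt (dyadic_average m) x (x + 2 * PI / 2 ^ m) = RInt v 0 (2 * PI) / 2 ^ m :> R.
Proof.
  revert x; induction m; intros x.
  - simpl. replace (2 * PI / 1) with (2 * PI) by field. now rewrite RInt_periodic, Rdiv_1_r.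
  - set (L := 2 * PI / 2 ^ S m).
    assert (HL : 2 * PI / 2 ^ m = L + L) by (unfold L; simpl; field; apply Rgt_not_eq, pow2_pos).
    assert (E : RInt (dyadic_average (S m)) x (x + L) =
      / 2 * RInt (fun t => dyadic_average m t + dyadic_average m (t + L)) x (x + L) :> R).
    { rewrite <- (RInt_scal (V := R_CompleteNormedModule)).
      - apply RInt_ext. intros t _. change ((dyadic_average m t + dyadic_average m (t + L)) / 2 =
          / 2 * (dyadic_average m t + dyadic_average m (t + L))). field.
      - apply ex_RInt_all. intros t. apply continuous_Rplus; [apply continuous_dyadic_average|].
        apply continuous_shift, continuous_dyadic_average. }
    rewrite E.
    assert (E2 : RInt (fun t => dyadic_average m t + dyadic_average m (t + L)) x (x + L) =
      RInt (dyadic_average m) x (x + L) + RInt (fun t => dyadic_average m (t + L)) x (x + L) :> R).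
    { apply (RInt_plus (V := R_CompleteNormedModule)); apply ex_RInt_all; [apply continuous_dyadic_average|].
      intros t. apply continuous_shift, continuous_dyadic_average. }
    rewrite E2, (RInt_shift (dyadic_average m)) by apply continuous_dyadic_average.
    rewrite RInt_Chasles_all by apply continuous_dyadic_average.
    replace (x + L + L) with (x + 2 * PI / 2 ^ m) by lra. rewrite IHm. simpl. field.
    apply Rgt_not_eq, pow2_pos.
Qed.

(** The shifts add up to at most 2 PI - 2 PI / 2^m, so points up to 4 PI + 2 PI / 2^m are moved no
    further than 6 PI, the end of the interval of uniform continuity. *)
Lemma dyadic_average_oscillation m eps d :
  (forall x y, 0 <= x <= 6 * PI -> 0 <= y <= 6 * PI -> Rabs (x - y) < d -> Rabs (v x - v y) <= eps) ->
  forall x y, 0 <= x <= 4 * PI + 2 * PI / 2 ^ m -> 0 <= y <= 4 * PI + 2 * PI / 2 ^ m ->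
    Rabs (x - y) < d -> Rabs (dyadic_average m x - dyadic_average m y) <= eps.
Proof.
  intros H. assert (HPI := PI_RGT_0). induction m; intros x y Hx Hy Hxy.
  - simpl in *. apply H; lra.
  - set (L := 2 * PI / 2 ^ S m) in *.
    assert (HL : 2 * PI / 2 ^ m = L + L) by (unfold L; simpl; field; apply Rgt_not_eq, pow2_pos).
    assert (HL0 : 0 < L) by (apply Rdiv_lt_0_compat; [lra|apply pow2_pos]).
    change (Rabs ((dyadic_average m x + dyadic_average m (x + L)) / 2 - (dyadic_average m y + dyadic_average m (y + L)) / 2) <= eps).
    assert (H1 := IHm x y ltac:(lra) ltac:(lra) Hxy).
    assert (H2 := IHm (x + L) (y + L) ltac:(lra) ltac:(lra) ltac:(replace (x + L - (y + L)) with (x - y) by ring; exact Hxy)).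
    apply Rabs_le_between in H1. apply Rabs_le_between in H2. apply Rabs_le_between. lra.
Qed.

(** Once 2 PI / 2^m is below the modulus of continuity, the average varies by at most eps over an
    interval of that length starting at [t], and its mean over this interval is the period mean. *)
Lemma dyadic_average_le eps : 0 < eps -> exists m, forall t, 0 <= t <= 2 * PI ->
  dyadic_average m t <= RInt v 0 (2 * PI) / (2 * PI) + eps.
Proof.
  intros He. assert (HPI := PI_RGT_0).
  destruct (unifcont_normed_1d (K := R_AbsRing) (V := R_NormedModule) v 0 (6 * PI) (fun x _ => Hv x) (mkposreal _ He)) as [d Hd].
  assert (Hd' : forall x y, 0 <= x <= 6 * PI -> 0 <= y <= 6 * PI -> Rabs (x - y) < d -> Rabs (v x - v y) <= eps).
  { intros x y Hx Hy Hxy. apply Rlt_le. rewrite Rabs_minus_sym. apply (Hd x y Hx Hy).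
    change (Rabs (y - x) < d). now rewrite Rabs_minus_sym. }
  destruct (pow_lt_1_zero (/ 2) ltac:(rewrite Rabs_pos_eq; lra) (d / (2 * PI)) ltac:(apply Rdiv_lt_0_compat; [apply cond_pos|lra])) as [m Hm].
  exists m. intros t Ht. specialize (Hm m (le_n m)).
  set (L := 2 * PI / 2 ^ m).
  assert (HL0 : 0 < L) by (apply Rdiv_lt_0_compat; [lra|apply pow2_pos]).
  assert (HLd : L < d).
  { rewrite Rabs_pos_eq in Hm by (apply pow_le; lra). rewrite pow_inv in Hm.
    unfold L. unfold Rdiv. apply (Rmult_lt_compat_l (2 * PI)) in Hm; [|lra].
    replace (2 * PI * (d / (2 * PI))) with (pos d) in Hm by (field; lra). exact Hm. }
  assert (Hint : RInt (fun _ => dyadic_average m t) t (t + L) <= RInt (fun s => dyadic_average m s + eps) t (t + L)).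
  { apply RInt_le; [lra|apply ex_RInt_all; intros; apply continuous_const| |].
    - apply ex_RInt_all. intros s. apply continuous_Rplus; [apply continuous_dyadic_average|apply continuous_const].
    - intros s Hs. assert (H := dyadic_average_oscillation m eps d Hd' t s ltac:(fold L; lra) ltac:(fold L; lra)).
      assert (H' : Rabs (t - s) < d) by (apply Rabs_def1; lra).
      specialize (H H'). apply Rabs_le_between in H. lra. }
  rewrite RInt_const in Hint.
  assert (E : RInt (fun s => dyadic_average m s + eps) t (t + L) = RInt v 0 (2 * PI) / 2 ^ m + L * eps :> R).
  { etransitivity; [apply (RInt_plus (V := R_CompleteNormedModule)); apply ex_RInt_all;
      [apply continuous_dyadic_average|intros; apply continuous_const]|].
    rewrite RInt_const. unfold L at 1. rewrite RInt_dyadic_average.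
    unfold plus, scal; simpl; unfold mult; simpl. ring. }
  rewrite E in Hint. unfold scal in Hint; simpl in Hint; unfold mult in Hint; simpl in Hint.
  apply Rmult_le_reg_l with L; [exact HL0|].
  replace (L * (RInt v 0 (2 * PI) / (2 * PI) + eps)) with (RInt v 0 (2 * PI) / 2 ^ m + L * eps).
  - lra.
  - unfold L. field. split; [lra|apply Rgt_not_eq, pow2_pos].
Qed.
End DyadicAverages.

Section SubMean.
Context (rad : R) (k : C -> C) (Hrad : 1 < rad) (Hk : holo rad k).

Lemma continuous_unit_circle t : continuous (U := C_UniformSpace) (fun t => k (expi t)) t.
Proof.
  apply (continuous_comp expi k); [apply continuous_expi, continuous_id|].
  apply holo_continuous with (1 := Hk). rewrite Cmod_expi. exact Hrad.
Qed.

Lemma mean_value_1 : CInt (fun t => k (expi t)) 0 (2 * PI) = (RtoC (2 * PI) * k (RtoC 0))%C.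
Proof.
  rewrite <- (mean_value rad k Hk 1) by lra. unfold circle_int. apply CInt_ext. intros t _. f_equal. ring.
Qed.

Lemma mean_value_le L : (forall t, 0 <= t <= 2 * PI -> Cmod (k (expi t)) <= L) -> Cmod (k (RtoC 0)) <= L.
Proof.
  intros HL. assert (HPI := PI_RGT_0).
  assert (H := Cmod_CInt_le_const (fun t => k (expi t)) 0 (2 * PI) L ltac:(lra) (fun t _ => continuous_unit_circle t) HL).
  rewrite mean_value_1, Cmod_mult, Cmod_R, Rabs_pos_eq in H by lra. rewrite Rminus_0_r in H.
  apply Rmult_le_reg_l with (2 * PI); lra.
Qed.
End SubMean.

(* [rotation_product k m w] is the product of [k(u w)] over the [2^m]-th roots of unity [u].  Its
   modulus at [0] is [|k(0)|^(2^m)], so the mean value property bounds that number by a value on the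
   unit circle, and the arithmetic-geometric mean inequality turns the latter into an average of
   [|k|^(1/2)] over equally spaced points. *)
Fixpoint rotation_product (k : C -> C) (m : nat) (w : C) : C :=
  match m with
  | O => k w
  | S m => (rotation_product k m w * rotation_product k m (expi (2 * PI / 2 ^ S m) * w))%C
  end.

Section SubMeanSqrt.
Context (rad : R) (k : C -> C) (Hrad : 1 < rad) (Hk : holo rad k).
Let v (t : R) := sqrt (Cmod (k (expi t))).

Lemma continuous_sqrt_circle t : continuous v t.
Proof. apply continuous_Rsqrt, continuous_Cmod, (continuous_unit_circle rad k Hrad Hk). Qed.

Lemma holo_rotation_product m : holo rad (rotation_product k m).
Proof.
  induction m; [exact Hk|]. intros z Hz.
  apply (ex_Cderive_mult (rotation_product k m) (fun w => rotation_product k m (expi (2 * PI / 2 ^ S m) * w)%C)); [now apply IHm|].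
  apply (ex_Cderive_comp (rotation_product k m) (fun w => (expi (2 * PI / 2 ^ S m) * w)%C)).
  - apply IHm. rewrite Cmod_mult, Cmod_expi. lra.
  - apply (ex_Cderive_mult (fun _ => expi (2 * PI / 2 ^ S m)) (fun w => w)); [apply ex_Cderive_const|apply ex_Cderive_id].
Qed.

Lemma Cmod_rotation_product_0 m : Cmod (rotation_product k m (RtoC 0)) = Cmod (k (RtoC 0)) ^ (2 ^ m).
Proof.
  induction m; [simpl; ring|]. cbn [rotation_product]. rewrite Cmult_0_r, Cmod_mult, IHm.
  rewrite <- pow_add. f_equal. simpl. lia.
Qed.

Lemma dyadic_average_pos m t : 0 <= dyadic_average v m t.
Proof.
  revert t; induction m; intros t; [apply sqrt_pos|].
  cbn [dyadic_average]. assert (H1 := IHm t). assert (H2 := IHm (t + 2 * PI / 2 ^ S m)). lra.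
Qed.

(** There are 2^m factors |k| = v^2, hence the exponent 2 * 2^m. Each doubling uses x y <= ((x + y)
    / 2)^2. *)
Lemma Cmod_rotation_product_le m t :
  Cmod (rotation_product k m (expi t)) <= dyadic_average v m t ^ (2 * 2 ^ m).
Proof.
  revert t; induction m; intros t.
  - simpl. unfold v. rewrite Rmult_1_r, sqrt_sqrt by apply Cmod_ge_0. apply Rle_refl.
  - cbn [rotation_product dyadic_average]. set (L := 2 * PI / 2 ^ S m).
    rewrite Cmod_mult, <- expi_plus, (Rplus_comm L t).
    set (x := dyadic_average v m t). set (y := dyadic_average v m (t + L)).
    assert (Hx : 0 <= x) by apply dyadic_average_pos. assert (Hy : 0 <= y) by apply dyadic_average_pos.
    apply Rle_trans with (x ^ (2 * 2 ^ m) * y ^ (2 * 2 ^ m)).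
    + apply Rmult_le_compat; try apply Cmod_ge_0; apply IHm.
    + rewrite <- Rpow_mult_distr. replace (2 * 2 ^ S m)%nat with (2 * (2 * 2 ^ m))%nat by (simpl; lia).
      rewrite (pow_mult ((x + y) / 2) 2). apply pow_incr. split; [nra|].
      assert (0 <= (x - y) ^ 2) by apply pow2_ge_0. nra.
Qed.

Lemma submean_sqrt : 2 * PI * sqrt (Cmod (k (RtoC 0))) <= RInt v 0 (2 * PI).
Proof.
  assert (HPI := PI_RGT_0).
  apply Rle_trans with (2 * PI * (RInt v 0 (2 * PI) / (2 * PI))); [|apply Req_le; field; lra].
  apply Rmult_le_compat_l; [lra|]. apply Rle_plus_epsilon. intros eps He.
  assert (Hvp : forall t, v (t + 2 * PI) = v t) by (intros t; unfold v; now rewrite expi_period).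
  destruct (dyadic_average_le v continuous_sqrt_circle Hvp eps He) as [m Hm].
  set (L := RInt v 0 (2 * PI) / (2 * PI) + eps) in *.
  assert (HL : 0 <= L) by (apply Rle_trans with (2 := Hm 0 ltac:(lra)), dyadic_average_pos).
  assert (H : Cmod (rotation_product k m (RtoC 0)) <= L ^ (2 * 2 ^ m)).
  { apply (mean_value_le rad _ Hrad (holo_rotation_product m)). intros t Ht.
    eapply Rle_trans; [apply Cmod_rotation_product_le|]. apply pow_incr. split; [apply dyadic_average_pos|now apply Hm]. }
  rewrite Cmod_rotation_product_0 in H.
  (* The root of order 2 * 2^m is taken by contradiction: a base above [L] would have a strictly
     larger power. *)
  apply Rnot_lt_le. intros Hlt. apply (Rlt_irrefl (L ^ (2 * 2 ^ m))).
  eapply Rlt_le_trans; [|exact H].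
  rewrite <- (sqrt_sqrt (Cmod (k (RtoC 0)))) by apply Cmod_ge_0.
  set (s := sqrt (Cmod (k (RtoC 0)))) in *. replace (s * s) with (s ^ 2) by ring. rewrite <- pow_mult.
  assert (Hn : (0 < 2 * 2 ^ m)%nat) by (assert (H2 := Nat.pow_nonzero 2 m); lia).
  destruct (2 * 2 ^ m)%nat as [|n]; [lia|].
  assert (G : forall j, L ^ j <= s ^ j) by (intros; apply pow_incr; lra).
  simpl. assert (Gn := G n). assert (Ln : 0 < s ^ n) by (apply pow_lt; lra).
  assert (0 <= L ^ n) by now apply pow_le. nra.
Qed.
End SubMeanSqrt.

(** * Moebius maps and integrals over arcs *)

Definition mobius (a : R) (w : C) : C := ((w + RtoC a) / (RtoC 1 + RtoC a * w))%C.

Lemma Cmod_sqr z : Cmod z ^ 2 = fst z ^ 2 + snd z ^ 2.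
Proof. unfold Cmod. rewrite pow2_sqrt; [reflexivity|]. simpl. nra. Qed.

(** The right-hand side vanishes on the unit circle; just outside it measures by how much the image
    can leave the unit disc. *)
Lemma mobius_identity a w :
  Cmod (RtoC 1 + RtoC a * w) ^ 2 - Cmod (w + RtoC a) ^ 2 = (1 - a ^ 2) * (1 - Cmod w ^ 2).
Proof. rewrite !Cmod_sqr. destruct w as [x y]; simpl. ring. Qed.

Lemma mobius_denominator a m w : 0 <= a -> Cmod w <= m -> 1 - a * m <= Cmod (RtoC 1 + RtoC a * w).
Proof.
  intros Ha Hw. assert (H := Cmod_triangle (RtoC 1 + RtoC a * w) (- (RtoC a * w))).
  replace (RtoC 1 + RtoC a * w + - (RtoC a * w))%C with (RtoC 1) in H by ring.
  rewrite Cmod_1, Cmod_opp, Cmod_mult, Cmod_R, Rabs_pos_eq in H by exact Ha. nra.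
Qed.

Lemma mobius_0 a : mobius a (RtoC 0) = RtoC a.
Proof.
  unfold mobius. replace (RtoC 1 + RtoC a * RtoC 0)%C with (RtoC 1) by ring.
  field.
Qed.

Lemma mobius_denominator_nz a w : 0 <= a < 1 -> Cmod w <= 1 -> (RtoC 1 + RtoC a * w)%C <> RtoC 0.
Proof.
  intros Ha Hw. apply Cmod_gt_0. assert (H := mobius_denominator a 1 w ltac:(lra) Hw). lra.
Qed.

Lemma Cmod_mobius_circle a t : 0 <= a < 1 -> Cmod (mobius a (expi t)) = 1.
Proof.
  intros Ha. unfold mobius.
  assert (Hn := mobius_denominator_nz a (expi t) Ha ltac:(rewrite Cmod_expi; lra)).
  rewrite Cmod_div by exact Hn.
  assert (Hi := mobius_identity a (expi t)). rewrite Cmod_expi in Hi.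
  apply Cmod_gt_0 in Hn. assert (H0 := Cmod_ge_0 (expi t + RtoC a)).
  replace (Cmod (expi t + RtoC a)) with (Cmod (RtoC 1 + RtoC a * expi t)); [field; lra|nra].
Qed.

(** The mean value inequalities ask for analyticity on a disc of radius above 1, so the composition
    with [mobius a] must be analytic slightly beyond the closed disc. *)
Lemma mobius_near a rad : 0 <= a < 1 -> 1 < rad -> exists rho, 1 < rho /\
  forall w, Cmod w < rho -> (RtoC 1 + RtoC a * w)%C <> RtoC 0 /\ Cmod (mobius a w) < rad.
Proof.
  intros Ha Hr. set (c := (rad ^ 2 - 1) * (1 - a) ^ 2 / 4).
  assert (Hc : 0 < c).
  { unfold c. apply Rdiv_lt_0_compat; [|lra]. apply Rmult_lt_0_compat; [nra|apply pow_lt; lra]. }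
  (* The bound 1 gives m^2 - 1 <= 3 eta, the bound (1 - a)/2 keeps the denominator at least (1 -
     a)/2, and c/4 makes 3 eta < c <= (rad^2 - 1) d^2. *)
  set (eta := Rmin (Rmin 1 ((1 - a) / 2)) (c / 4)).
  assert (He : 0 < eta) by (repeat apply Rmin_pos; lra).
  assert (He1 : eta <= 1) by (eapply Rle_trans; [apply Rmin_l|apply Rmin_l]).
  assert (He2 : eta <= (1 - a) / 2) by (eapply Rle_trans; [apply Rmin_l|apply Rmin_r]).
  assert (He3 : eta <= c / 4) by apply Rmin_r.
  exists (1 + eta). split; [lra|]. intros w Hw.
  assert (Hd := mobius_denominator a (1 + eta) w ltac:(lra) ltac:(lra)).
  set (d := Cmod (RtoC 1 + RtoC a * w)) in *.
  assert (Hd2 : (1 - a) / 2 <= d) by nra.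
  assert (Hn : (RtoC 1 + RtoC a * w)%C <> RtoC 0) by (apply Cmod_gt_0; fold d; lra).
  split; [exact Hn|]. unfold mobius. rewrite Cmod_div by exact Hn. fold d.
  apply Rmult_lt_reg_r with d; [lra|]. unfold Rdiv. rewrite Rmult_assoc, Rinv_l, Rmult_1_r by lra.
  assert (Hi := mobius_identity a w). fold d in Hi.
  assert (H0 := Cmod_ge_0 (w + RtoC a)). assert (Hw0 := Cmod_ge_0 w).
  set (n := Cmod (w + RtoC a)) in *. set (m := Cmod w) in *.
  assert (Hm : m ^ 2 - 1 <= 3 * eta) by nra.
  assert (Hcd : c <= (rad ^ 2 - 1) * d ^ 2).
  { unfold c. replace ((rad ^ 2 - 1) * (1 - a) ^ 2 / 4) with ((rad ^ 2 - 1) * (((1 - a) / 2) ^ 2)) by field.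
    apply Rmult_le_compat_l; [nra|]. apply pow_incr. lra. }
  assert (Ha2 : (1 - a ^ 2) * (m ^ 2 - 1) <= 3 * eta).
  { apply Rle_trans with ((1 - a ^ 2) * (3 * eta)); [apply Rmult_le_compat_l; nra|nra]. }
  assert (Hsq : n ^ 2 < (rad * d) ^ 2) by nra.
  apply Rnot_le_lt. intros Hle. assert ((rad * d) ^ 2 <= n ^ 2) by (apply pow_incr; nra). lra.
Qed.

Lemma holo_comp_mobius rad G a c : holo rad G -> 1 < rad -> 0 <= a < 1 -> Cmod c = 1 ->
  exists rho, 1 < rho /\ holo rho (fun w => G (c * mobius a w)%C).
Proof.
  intros HG Hr Ha Hc. destruct (mobius_near a rad Ha Hr) as [rho [H1 H2]].
  exists rho. split; [exact H1|]. intros w Hw. destruct (H2 w Hw) as [Hn Hm].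
  apply (ex_Cderive_comp G (fun w => (c * mobius a w)%C)).
  - apply HG. rewrite Cmod_mult, Hc. lra.
  - apply (ex_Cderive_mult (fun _ => c) (mobius a)); [apply ex_Cderive_const|].
    apply (ex_Cderive_mult (fun w => (w + RtoC a)%C) (fun w => (/ (RtoC 1 + RtoC a * w))%C)).
    + apply (ex_Cderive_plus (fun w => w) (fun _ => RtoC a)); [apply ex_Cderive_id|apply ex_Cderive_const].
    + apply (ex_Cderive_inv (fun w => (RtoC 1 + RtoC a * w)%C)); [|exact Hn].
      apply (ex_Cderive_plus (fun _ => RtoC 1) (fun w => (RtoC a * w)%C)); [apply ex_Cderive_const|].
      apply (ex_Cderive_mult (fun _ => RtoC a) (fun w => w)); [apply ex_Cderive_const|apply ex_Cderive_id].
Qed.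

Section Mobius.
Context (rad : R) (G : C -> C) (Hrad : 1 < rad) (HG : holo rad G).

(** A rotated Moebius map sends 0 to the given interior point and the unit circle to itself, so the
    mean value inequality at the centre is enough. *)
Lemma maximum_principle L : (forall t, Cmod (G (expi t)) <= L) -> forall z, Cmod z <= 1 -> Cmod (G z) <= L.
Proof.
  intros HL z Hz. destruct (C_polar z) as [t Ht].
  destruct (Rle_lt_or_eq_dec _ _ Hz) as [Hlt|Heq].
  - assert (Ha : 0 <= Cmod z < 1) by (split; [apply Cmod_ge_0|exact Hlt]).
    destruct (holo_comp_mobius rad G (Cmod z) (expi t) HG Hrad Ha (Cmod_expi t)) as [rho [Hrho Hk]].
    assert (H := mean_value_le rho _ Hrho Hk L). cbv beta in H. rewrite mobius_0 in H.
    rewrite Ht at 1. rewrite Cmult_comm. apply H. intros x _.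
    destruct (Cmod_eq_1_expi (mobius (Cmod z) (expi x)) (Cmod_mobius_circle _ x Ha)) as [y ->].
    rewrite <- expi_plus. apply HL.
  - rewrite Ht, Heq, Cmult_1_l. apply HL.
Qed.

Context (a : R) (Ha : 0 <= a < 1).
Let v (t : R) := sqrt (Cmod (G (expi t))).
Let u (t : R) := sqrt (Cmod (G (RtoC a * expi t))).
Let q (alpha t : R) := sqrt (Cmod (G (expi t * mobius a (expi alpha)))).

Lemma sqrt_Cmod_sqr z : sqrt (Cmod z) * sqrt (Cmod z) = Cmod z.
Proof. apply sqrt_sqrt, Cmod_ge_0. Qed.

Lemma continuous_v t : continuous v t.
Proof. apply continuous_Rsqrt, continuous_Cmod, (continuous_unit_circle rad G Hrad HG). Qed.

Lemma continuous_u t : continuous u t.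
Proof.
  apply continuous_Rsqrt, continuous_Cmod, (continuous_circle rad G HG). rewrite Rabs_pos_eq; lra.
Qed.

Lemma continuity_q alpha t : continuity_2d_pt q alpha t.
Proof.
  apply (continuity_2d_pt_pair (fun p => sqrt (Cmod (G (expi (snd p) * mobius a (expi (fst p))))))).
  apply continuous_Rsqrt, continuous_Cmod.
  apply (continuous_comp (fun p : R * R => (expi (snd p) * mobius a (expi (fst p)))%C) G).
  - apply continuous_Cmult; [apply continuous_expi, continuous_snd|].
    apply (continuous_comp (fun p : R * R => expi (fst p)) (mobius a)); [apply continuous_expi, continuous_fst|].
    (* Composing with the identity gives analyticity of [mobius a] itself. *)
    destruct (holo_comp_mobius 2 (fun z => z) a (RtoC 1) (fun z _ => ex_Cderive_id z) ltac:(lra) Ha Cmod_1) as [rho [Hrho Hm]].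
    apply (continuous_ext (fun w => (RtoC 1 * mobius a w)%C)); [intros; apply Cmult_1_l|].
    apply holo_continuous with (1 := Hm). simpl fst. rewrite Cmod_expi. exact Hrho.
  - apply holo_continuous with (1 := HG). simpl. rewrite Cmod_mult, Cmod_expi, Cmod_mobius_circle by exact Ha. lra.
Qed.

Lemma submean_q t : 2 * PI * u t <= RInt (fun alpha => q alpha t) 0 (2 * PI).
Proof.
  destruct (holo_comp_mobius rad G a (expi t) HG Hrad Ha (Cmod_expi t)) as [rho [Hrho Hk]].
  assert (H := submean_sqrt rho _ Hrho Hk). cbv beta in H. rewrite mobius_0 in H.
  unfold u. rewrite (Cmult_comm (RtoC a)). exact H.
Qed.

(* [mobius a] rotates each [expi alpha] to some [expi tau]; averaging over [alpha] and exchanging the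
   integrals, [submean_q] shows that some [tau] is at least as good as the mean. *)
Lemma exists_rotation_correlation : exists tau,
  RInt (fun t => u t * u t) 0 (2 * PI) <= RInt (fun t => v (t + tau) * u t) 0 (2 * PI).
Proof.
  assert (HPI := PI_RGT_0).
  apply NNPP. intros Hno.
  set (I0 := RInt (fun t => u t * u t) 0 (2 * PI)) in *.
  assert (Hlt : forall alpha, RInt (fun t => q alpha t * u t) 0 (2 * PI) < I0).
  { intros alpha. apply Rnot_le_lt. intros Hle. apply Hno.
    destruct (Cmod_eq_1_expi _ (Cmod_mobius_circle a alpha Ha)) as [tau Htau].
    exists tau. erewrite RInt_ext; [exact Hle|]. intros t _. simpl. unfold v, q.
    now rewrite Htau, expi_plus. }
  assert (Hqu : forall alpha t, continuity_2d_pt (fun alpha t => q alpha t * u t) alpha t).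
  { intros alpha t. apply continuity_2d_pt_mult; [apply continuity_q|].
    apply (continuity_2d_pt_pair (fun p => u (snd p))). apply (continuous_comp (fun p : R * R => snd p) u); [apply continuous_snd|apply continuous_u]. }
  assert (H1 : RInt (fun alpha => RInt (fun t => q alpha t * u t) 0 (2 * PI)) 0 (2 * PI) < RInt (fun _ => I0) 0 (2 * PI)).
  { apply RInt_lt; [lra| | |].
    - intros; apply continuous_const.
    - intros x _. apply (continuous_RInt_param (fun t alpha => q alpha t * u t)); [lra|].
      apply filter_forall. intros y t _. apply (continuity_2d_pt_swap (fun alpha t => q alpha t * u t)), Hqu.
    - intros; apply Hlt. }
  rewrite (RInt_swap _ (-1) (2 * PI + 1)) in H1 by (lra || (intros; apply Hqu)).
  rewrite RInt_const in H1.
  assert (H2 : RInt (fun t => 2 * PI * (u t * u t)) 0 (2 * PI) <=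
    RInt (fun t => RInt (fun alpha => q alpha t * u t) 0 (2 * PI)) 0 (2 * PI)).
  { apply RInt_le; [lra| | |].
    - apply ex_RInt_all. intros t. apply continuous_Rmult; [apply continuous_const|].
      apply continuous_Rmult; apply continuous_u.
    - apply ex_RInt_all. intros t. apply continuous_RInt_param; [lra|].
      apply filter_forall. intros y x _. apply Hqu.
    - intros t _.
      assert (E : RInt (fun alpha => q alpha t * u t) 0 (2 * PI) = u t * RInt (fun alpha => q alpha t) 0 (2 * PI) :> R).
      { rewrite <- (RInt_scal (V := R_CompleteNormedModule)).
        - apply RInt_ext. intros x _. apply Rmult_comm.
        - apply ex_RInt_all. intros x. apply continuity_2d_pt_l, continuity_q. }
      rewrite E. assert (H := submean_q t). assert (Hu : 0 <= u t) by apply sqrt_pos. nra. }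
  assert (E : RInt (fun t => 2 * PI * (u t * u t)) 0 (2 * PI) = 2 * PI * I0 :> R).
  { apply (RInt_scal (V := R_CompleteNormedModule) (fun t => u t * u t)).
    apply ex_RInt_all. intros t. apply continuous_Rmult; apply continuous_u. }
  rewrite E in H2. unfold scal in H1; simpl in H1; unfold mult in H1; simpl in H1. lra.
Qed.

(** With [u] shifted by the rotation found above, v^2 <= 2 (v - u)^2 + 2 u^2. The first term,
    integrated over the whole period, is small by the L^2 estimate; the second is at most 2 B
    pointwise, hence proportional to the length of the arc. *)
Lemma arc_integral_le B th1 th2 : (forall t, Cmod (G (RtoC a * expi t)) <= B) -> th1 <= th2 <= th1 + 2 * PI ->
  RInt (fun t => Cmod (G (expi t))) th1 th2 <=
  2 * (RInt (fun t => Cmod (G (expi t))) 0 (2 * PI) - RInt (fun t => Cmod (G (RtoC a * expi t))) 0 (2 * PI))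
  + 2 * (th2 - th1) * B.
Proof.
  intros HB Hth. assert (HPI := PI_RGT_0).
  destruct exists_rotation_correlation as [tau Htau].
  set (I1 := RInt (fun t => Cmod (G (expi t))) 0 (2 * PI)).
  set (I0 := RInt (fun t => Cmod (G (RtoC a * expi t))) 0 (2 * PI)).
  assert (E0 : RInt (fun t => u t * u t) 0 (2 * PI) = I0) by (apply RInt_ext; intros; apply sqrt_Cmod_sqr).
  set (D := fun t => (v t - u (t - tau)) * (v t - u (t - tau))).
  assert (Hus : forall t, continuous (fun t => u (t - tau)) t).
  { intros t. apply continuous_shift, continuous_u. }
  assert (HD : forall t, continuous D t).
  { assert (Hvu : forall t, continuous (fun t => v t - u (t - tau)) t).
    { intros t. apply continuous_Rminus; [apply continuous_v|apply Hus]. }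
    intros t. exact (continuous_Rmult _ _ t (Hvu t) (Hvu t)). }
  assert (Hvp : forall t, v (t + 2 * PI) = v t) by (intros; unfold v; now rewrite expi_period).
  assert (Hup : forall t, u (t + 2 * PI) = u t) by (intros; unfold u; now rewrite expi_period).
  assert (HDp : forall t, D (t + 2 * PI) = D t).
  { intros t. unfold D. replace (t + 2 * PI - tau) with (t - tau + 2 * PI) by ring. now rewrite Hvp, Hup. }
  (* Expanded, the square integrates to I1 + I0 minus twice the correlation, and the correlation is
     at least I0. *)
  assert (HDi : RInt D 0 (2 * PI) <= I1 - I0).
  { rewrite <- (RInt_periodic D (2 * PI) tau HD HDp).
    rewrite (Rplus_comm tau). rewrite <- (Rplus_0_l tau) at 1. rewrite <- RInt_shift by exact HD.
    assert (Hvs : forall t, continuous (fun t => v (t + tau)) t).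
    { intros t. apply continuous_shift, continuous_v. }
    set (f1 := fun t => v (t + tau) * v (t + tau)). set (f2 := fun t => u t * u t). set (f3 := fun t => v (t + tau) * u t).
    assert (C1 : ex_RInt f1 0 (2 * PI)) by (apply ex_RInt_all; intros; apply continuous_Rmult; apply Hvs).
    assert (C2 : ex_RInt f2 0 (2 * PI)) by (apply ex_RInt_all; intros; apply continuous_Rmult; apply continuous_u).
    assert (C3 : ex_RInt f3 0 (2 * PI)) by (apply ex_RInt_all; intros; apply continuous_Rmult; [apply Hvs|apply continuous_u]).
    assert (E : RInt (fun t => D (t + tau)) 0 (2 * PI) = RInt f1 0 (2 * PI) + RInt f2 0 (2 * PI) + (- 2) * RInt f3 0 (2 * PI)).
    { apply (is_RInt_unique (V := R_CompleteNormedModule)).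
      apply (is_RInt_ext (V := R_NormedModule) (fun t => (f1 t + f2 t) + (- 2) * f3 t)).
      - intros t _. unfold D, f1, f2, f3. replace (t + tau - tau) with t by ring.
        match goal with |- ?x = ?y => change (@eq R x y) end. ring.
      - apply (is_RInt_plus (V := R_NormedModule)); [apply (is_RInt_plus (V := R_NormedModule))|apply (is_RInt_scal (V := R_NormedModule))];
          now apply (RInt_correct (V := R_CompleteNormedModule)). }
    assert (E1 : RInt f1 0 (2 * PI) = I1).
    { unfold f1. rewrite (RInt_shift (fun t => v t * v t)) by (intros; apply continuous_Rmult; apply continuous_v).
      rewrite (Rplus_comm (2 * PI)), Rplus_0_l.
      rewrite (RInt_periodic (fun t => v t * v t)).
      - apply RInt_ext; intros; apply sqrt_Cmod_sqr.
      - intros; apply continuous_Rmult; apply continuous_v.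
      - intros; now rewrite Hvp. }
    rewrite E, E1. change (RInt (fun t => u t * u t) 0 (2 * PI)) with (RInt f2 0 (2 * PI)) in *.
    change (RInt (fun t => v (t + tau) * u t) 0 (2 * PI)) with (RInt f3 0 (2 * PI)) in *. lra. }
  assert (HDa : RInt D th1 th2 <= RInt D 0 (2 * PI)).
  { rewrite <- (RInt_periodic D (2 * PI) th1 HD HDp), <- (RInt_Chasles_all D th1 th2 (th1 + 2 * PI)) by exact HD.
    assert (0 <= RInt D th2 (th1 + 2 * PI)).
    { apply RInt_ge_0; [lra|now apply ex_RInt_all|]. intros t _. apply Rle_0_sqr. }
    lra. }
  apply Rle_trans with (RInt (fun t => 2 * D t + 2 * B) th1 th2).
  - apply RInt_le; [lra| | |].
    + apply ex_RInt_all. intros t. apply continuous_Cmod, (continuous_unit_circle rad G Hrad HG).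
    + apply ex_RInt_all. intros t. apply continuous_Rplus; [|apply continuous_const].
      apply continuous_Rmult; [apply continuous_const|apply HD].
    + intros t _. rewrite <- sqrt_Cmod_sqr. fold (v t). unfold D.
      assert (Hu : u (t - tau) * u (t - tau) <= B) by (unfold u; rewrite sqrt_Cmod_sqr; apply HB).
      (* 2 (v - u)^2 + 2 u^2 - v^2 is the square of v - 2u. *)
      assert (H := Rle_0_sqr (v t - 2 * u (t - tau))). unfold Rsqr in H. nra.
  - assert (E : RInt (fun t => 2 * D t + 2 * B) th1 th2 = 2 * RInt D th1 th2 + (th2 - th1) * (2 * B)).
    { apply (is_RInt_unique (V := R_CompleteNormedModule)).
      apply (is_RInt_plus (V := R_NormedModule)); [apply (is_RInt_scal (V := R_NormedModule))|apply (is_RInt_const (V := R_NormedModule))].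
      apply (RInt_correct (V := R_CompleteNormedModule)). now apply ex_RInt_all. }
    rewrite E. lra.
Qed.
End Mobius.

(** * Primitives of functions in the Hardy space *)

Lemma continuous_on_C_iff (D : C -> Prop) (f : C -> C) :
  continuous_on (T := C_UniformSpace) (U := C_UniformSpace) D f <->
  forall z, D z -> forall eps, 0 < eps -> exists d, 0 < d /\
    forall w, D w -> Cmod (w - z) < d -> Cmod (f w - f z) < eps.
Proof.
  assert (Hs : 0 < sqrt 2) by (apply sqrt_lt_R0; lra).
  split.
  - intros H z Hz eps He.
    assert (He' : 0 < eps / sqrt 2) by (apply Rdiv_lt_0_compat; lra).
    destruct (proj1 (filterlim_locally (F := within D (locally (T := C_UniformSpace) z)) f (f z)) (H z Hz) (mkposreal _ He')) as [d Hd].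
    exists d. split; [apply cond_pos|]. intros w HDw Hw.
    assert (Hb : ball (M := C_UniformSpace) z d w) by (apply C_NormedModule_mixin_compat1; exact Hw).
    specialize (Hd w Hb HDw). apply C_NormedModule_mixin_compat2 in Hd. simpl in Hd.
    replace eps with (sqrt 2 * (eps / sqrt 2)) by (field; lra). exact Hd.
  - intros H z Hz. apply (filterlim_locally (F := within D (locally (T := C_UniformSpace) z))). intros eps.
    destruct (H z Hz eps (cond_pos eps)) as [d [Hd0 Hd]].
    assert (He : 0 < d / sqrt 2) by (apply Rdiv_lt_0_compat; lra).
    exists (mkposreal _ He). intros w Hw HDw.
    apply C_NormedModule_mixin_compat1. apply Hd; [exact HDw|].
    apply C_NormedModule_mixin_compat2 in Hw. simpl in Hw.
    replace d with (sqrt 2 * (d / sqrt 2)) by (field; lra). exact Hw.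
Qed.

(** For [rad = 1] and s < 1 the dilate is analytic beyond the closed unit disc, as the lemmas on the
    unit circle require. *)
Lemma holo_scale rad f s : 0 < s -> holo rad f -> holo (rad / s) (fun w => f (RtoC s * w)%C).
Proof.
  intros Hs Hf w Hw. apply (ex_Cderive_comp f (fun w => (RtoC s * w)%C)).
  - apply Hf. rewrite Cmod_mult, Cmod_R, Rabs_pos_eq by lra.
    apply (Rmult_lt_compat_l s) in Hw; [|exact Hs]. replace (s * (rad / s)) with rad in Hw by (field; lra). exact Hw.
  - apply (ex_Cderive_mult (fun _ => RtoC s) (fun w => w)); [apply ex_Cderive_const|apply ex_Cderive_id].
Qed.

Lemma Rinv_gt_1 s : 0 < s < 1 -> 1 < 1 / s.
Proof. intros Hs. unfold Rdiv. rewrite Rmult_1_l, <- Rinv_1. apply Rinv_lt_contravar; lra. Qed.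

Section Boundary.
Context (h : C -> C) (Hh : holo 1 h).

Let F := integral_from_0 h.

Lemma primitive_derive z : Cmod z < 1 -> is_derive (K := C_AbsRing) (V := C_NormedModule) F z (h z).
Proof. apply (integral_from_0_derive 1 h Hh). Qed.

Lemma holo_primitive : holo 1 F.
Proof. intros z Hz. eexists. now apply primitive_derive. Qed.

Definition circle_mean (s : R) : R := RInt (fun t => Cmod (h (RtoC s * expi t))) 0 (2 * PI).

Lemma continuous_Cmod_circle s t : 0 <= s < 1 -> continuous (fun t => Cmod (h (RtoC s * expi t))) t.
Proof. intros Hs. apply continuous_Cmod, (continuous_circle 1 h Hh). rewrite Rabs_pos_eq; lra. Qed.

Lemma circle_bounded s : 0 <= s < 1 -> exists B, 0 <= B /\ forall t, Cmod (h (RtoC s * expi t)) <= B.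
Proof.
  intros Hs. assert (HPI := PI_RGT_0).
  destruct (continuity_ab_maj (fun t => Cmod (h (RtoC s * expi t))) (- PI) PI) as [x [Hx _]]; [lra| |].
  - intros c _. apply continuity_pt_filterlim, continuous_Cmod_circle, Hs.
  - exists (Cmod (h (RtoC s * expi x))). split; [apply Cmod_ge_0|]. intros t.
    destruct (Cmod_eq_1_expi_PI (expi t) (Cmod_expi t)) as [t' [Ht' ->]]. now apply Hx.
Qed.

Context (M : R) (HM : forall s, 0 <= s < 1 -> circle_mean s <= M).

Lemma circle_mean_near_sup eps : 0 < eps -> exists s0, 0 <= s0 < 1 /\
  forall s, 0 <= s < 1 -> circle_mean s - circle_mean s0 <= eps.
Proof.
  intros He.
  destruct (completeness (fun x => exists s, 0 <= s < 1 /\ x = circle_mean s)) as [S [HS1 HS2]].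
  - exists M. intros x (s & Hs & ->). now apply HM.
  - exists (circle_mean 0), 0. split; [lra|reflexivity].
  - apply NNPP. intros Hno.
    assert (Hub : S <= S - eps).
    { apply HS2. intros x (s & Hs & ->). apply Rnot_lt_le. intros Hlt. apply Hno.
      exists s. split; [exact Hs|]. intros s' Hs'. assert (H := HS1 _ (ex_intro _ s' (conj Hs' eq_refl))). lra. }
    lra.
Qed.

Lemma uniformly_integrable eps : 0 < eps -> exists d s0, 0 < d /\ 0 <= s0 < 1 /\
  forall s th1 th2, s0 < s < 1 -> th1 <= th2 <= th1 + d ->
    RInt (fun t => Cmod (h (RtoC s * expi t))) th1 th2 <= eps.
Proof.
  intros He. assert (HPI := PI_RGT_0).
  destruct (circle_mean_near_sup (eps / 4)) as [s0 [Hs0 Hsup]]; [lra|].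
  destruct (circle_bounded s0 Hs0) as [B [HB0 HB]].
  (* [arc_integral_le] costs twice the defect eps/4 of the means plus 2 d B <= eps/2; the bound 2 PI
     is its restriction on the length of the arc. *)
  assert (Hd : 0 < Rmin (2 * PI) (eps / (4 * (B + 1)))).
  { apply Rmin_pos; [lra|]. apply Rdiv_lt_0_compat; lra. }
  set (d := Rmin (2 * PI) (eps / (4 * (B + 1)))) in *.
  exists d, s0. split; [exact Hd|]. split; [exact Hs0|].
  intros s th1 th2 Hs Hth.
  assert (Hd1 : d <= 2 * PI) by apply Rmin_l.
  assert (Hd2 : d <= eps / (4 * (B + 1))) by apply Rmin_r.
  assert (HG := holo_scale 1 h s ltac:(lra) Hh).
  assert (Ha : 0 <= s0 / s < 1).
  { split; [apply Rmult_le_pos; [lra|apply Rlt_le, Rinv_0_lt_compat; lra]|].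
    apply Rmult_lt_reg_r with s; [lra|]. unfold Rdiv. rewrite Rmult_assoc, Rinv_l; lra. }
  assert (Ea : forall t, (RtoC s * (RtoC (s0 / s) * expi t))%C = (RtoC s0 * expi t)%C).
  { intros t. rewrite Cmult_assoc, <- RtoC_mult. do 2 f_equal. field; lra. }
  assert (H := arc_integral_le (1 / s) _ (Rinv_gt_1 s ltac:(lra)) HG (s0 / s) Ha B th1 th2).
  cbv beta in H.
  eapply Rle_trans; [apply H|].
  - intros t. rewrite Ea. apply HB.
  - lra.
  - assert (E : RInt (fun t => Cmod (h (RtoC s * (RtoC (s0 / s) * expi t)))) 0 (2 * PI) = circle_mean s0).
    { apply RInt_ext. intros t _. now rewrite Ea. }
    rewrite E. change (RInt (fun t => Cmod (h (RtoC s * expi t))) 0 (2 * PI)) with (circle_mean s).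
    specialize (Hsup s ltac:(lra)).
    assert (Hq : (th2 - th1) * B <= eps / 4).
    { apply Rle_trans with (eps / (4 * (B + 1)) * (B + 1)).
      - apply Rmult_le_compat; lra.
      - apply Req_le. field. lra. }
    lra.
Qed.

Lemma arc_derivative s t : 0 <= s < 1 ->
  is_derive (K := R_AbsRing) (V := C_R_NormedModule) (fun t => F (RtoC s * expi t)%C) t
    (Ci * (RtoC s * expi t) * h (RtoC s * expi t))%C.
Proof.
  intros Hs. apply (Rderive_along F (fun t => (RtoC s * expi t)%C)); [|apply Rderive_circle].
  apply primitive_derive. rewrite Cmod_circle, Rabs_pos_eq; lra.
Qed.

Lemma arc_continuous s a b : 0 <= s < 1 -> cont_on (fun t => (Ci * (RtoC s * expi t) * h (RtoC s * expi t))%C) a b.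
Proof.
  intros Hs t _. apply continuous_Cmult.
  - apply continuous_Cmult; [apply continuous_const|].
    apply continuous_Cmult; [apply continuous_const|apply continuous_expi, continuous_id].
  - apply (continuous_circle 1 h Hh). rewrite Rabs_pos_eq; lra.
Qed.

Lemma arc_integral s th1 th2 : 0 <= s < 1 ->
  CInt (fun t => (Ci * (RtoC s * expi t) * h (RtoC s * expi t))%C) th1 th2 =
  (F (RtoC s * expi th2) - F (RtoC s * expi th1))%C.
Proof.
  intros Hs. apply (CInt_derive (fun t => F (RtoC s * expi t)%C)).
  - intros t _. now apply arc_derivative.
  - now apply arc_continuous.
Qed.

Lemma arc_oscillation_le s th1 th2 : 0 <= s < 1 -> th1 <= th2 ->
  Cmod (F (RtoC s * expi th2) - F (RtoC s * expi th1)) <= RInt (fun t => Cmod (h (RtoC s * expi t))) th1 th2.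
Proof.
  intros Hs Hth. rewrite <- arc_integral by exact Hs.
  eapply Rle_trans; [apply Cmod_CInt_le; [exact Hth|now apply arc_continuous]|].
  apply RInt_le; [exact Hth| | |].
  - apply ex_RInt_cont_R. intros t Ht. now apply continuous_Cmod, (arc_continuous s th1 th2 Hs).
  - apply ex_RInt_cont_R. intros t _. now apply continuous_Cmod_circle.
  - intros t _. rewrite !Cmod_mult, Cmod_Ci, Cmod_expi, Cmod_R, Rabs_pos_eq by lra.
    assert (H := Cmod_ge_0 (h (RtoC s * expi t))). nra.
Qed.

(* Averaging over a short arc turns the oscillation bound on arcs into a radial Lipschitz bound. *)
Lemma radial_le eps d s0 : 0 < d -> 0 <= s0 < 1 ->
  (forall s th1 th2, s0 < s < 1 -> th1 <= th2 <= th1 + d ->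
    Cmod (F (RtoC s * expi th2) - F (RtoC s * expi th1)) <= eps) ->
  forall s s' th, s0 < s -> 1 / 2 < s -> s <= s' < 1 ->
    d * Cmod (F (RtoC s' * expi th) - F (RtoC s * expi th)) <= d * (2 * eps) + (s' - s) * (2 * eps).
Proof.
  intros Hd Hs0 Hosc s s' th Hs Hs12 Hss'.
  assert (Hfe : forall r t, Rabs r < 1 -> cont2 (fun r t => (h (RtoC r * expi t) * expi t)%C) r t).
  { intros r t Hr. apply continuous_Cmult; [now apply (cont2_circle 1 h Hh)|apply continuous_expi, continuous_snd]. }
  assert (HFc : forall r t, 0 <= r < 1 -> continuous (U := C_UniformSpace) (fun t => F (RtoC r * expi t)%C) t).
  { intros r t Hr. apply (continuous_circle 1 F holo_primitive). rewrite Rabs_pos_eq; lra. }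
  (* By Fubini [J] is a radial integral of arc integrals of h(r e^it) e^it. Each of these is an
     increment of [F] along the arc divided by i r, at most 2 eps because r > 1/2. *)
  set (J := CInt (fun t => (F (RtoC s' * expi t) - F (RtoC s * expi t))%C) th (th + d)).
  assert (EJ : J = CInt (fun r => CInt (fun t => (h (RtoC r * expi t) * expi t)%C) th (th + d)) s s').
  { rewrite (CInt_swap (fun r t => (h (RtoC r * expi t) * expi t)%C) (-1) 1 s s' th (th + d)); try lra.
    - unfold J. apply CInt_ext. intros t _. symmetry.
      apply (CInt_derive (fun r => F (RtoC r * expi t)%C)).
      + rewrite Rmin_left, Rmax_right by lra. intros r Hr. rewrite Cmult_comm.
        apply (Rderive_along F (fun r => (RtoC r * expi t)%C)).
        * apply primitive_derive. rewrite Cmod_circle, Rabs_pos_eq; lra.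
        * apply (is_derive_ext (fun r => (RtoC 0 + RtoC r * expi t)%C)); [intros; apply Cplus_0_l|].
          apply Rderive_C_scal.
      + unfold cont_on. rewrite Rmin_left, Rmax_right by lra. intros r Hr.
        apply (cont2_l (fun r t => (h (RtoC r * expi t) * expi t)%C)), Hfe. rewrite Rabs_pos_eq; lra.
    - intros u v Hu. apply Hfe, Rabs_def1; lra. }
  assert (HJ : Cmod J <= (s' - s) * (2 * eps)).
  { rewrite EJ. apply Cmod_CInt_le_const; [lra| |].
    - unfold cont_on. rewrite Rmin_left, Rmax_right by lra. intros r Hr.
      apply (continuous_CInt_param (fun r t => (h (RtoC r * expi t) * expi t)%C)); [lra|].
      apply (locally_between _ (-1) 1); [lra|]. intros y Hy t _. apply Hfe, Rabs_def1; lra.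
    - intros r Hr.
      assert (Hr0 : RtoC r <> RtoC 0) by (intros E; apply RtoC_inj in E; lra).
      assert (Hc : cont_on (fun t => (h (RtoC r * expi t) * expi t)%C) th (th + d)).
      { intros t _. apply (cont2_r (fun r t => (h (RtoC r * expi t) * expi t)%C)), Hfe. rewrite Rabs_pos_eq; lra. }
      assert (E : (Ci * RtoC r * CInt (fun t => (h (RtoC r * expi t) * expi t)%C) th (th + d))%C =
                  (F (RtoC r * expi (th + d)) - F (RtoC r * expi th))%C).
      { rewrite <- arc_integral by lra. rewrite <- CInt_mult_l by exact Hc. apply CInt_ext. intros t _. ring. }
      assert (H := Hosc r th (th + d) ltac:(lra) ltac:(lra)). rewrite <- E in H.
      rewrite !Cmod_mult, Cmod_Ci, Cmod_R, Rabs_pos_eq in H by lra.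
      assert (H0 := Cmod_ge_0 (CInt (fun t => (h (RtoC r * expi t) * expi t)%C) th (th + d))). nra. }
  set (D := (F (RtoC s' * expi th) - F (RtoC s * expi th))%C).
  assert (Hc : cont_on (fun t => (F (RtoC s' * expi t) - F (RtoC s * expi t))%C) th (th + d)).
  { intros t _. apply continuous_Cminus; apply HFc; lra. }
  (* On the arc the radial increment differs from the one at [th] by an oscillation of [F] on each
     of the two circles. *)
  assert (HD : Cmod (RtoC d * D - J) <= d * (2 * eps)).
  { replace (RtoC d * D)%C with (CInt (fun _ => D) th (th + d)).
    2: { rewrite CInt_const. do 2 f_equal. ring. }
    unfold J. rewrite <- CInt_minus; [|apply cont_on_const|exact Hc].
    replace (d * (2 * eps)) with ((th + d - th) * (2 * eps)) by ring.
    apply Cmod_CInt_le_const; [lra| |].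
    - intros t Ht. apply continuous_Cminus; [apply continuous_const|now apply Hc].
    - intros t Ht. unfold D.
      replace (_ - _)%C with (- (F (RtoC s' * expi t) - F (RtoC s' * expi th)) + (F (RtoC s * expi t) - F (RtoC s * expi th)))%C by ring.
      eapply Rle_trans; [apply Cmod_triangle|]. rewrite Cmod_opp.
      assert (H1 := Hosc s' th t ltac:(lra) ltac:(lra)). assert (H2 := Hosc s th t ltac:(lra) ltac:(lra)). lra. }
  assert (Hfin : Cmod (RtoC d * D) <= Cmod (RtoC d * D - J) + Cmod J).
  { replace (RtoC d * D)%C with ((RtoC d * D - J) + J)%C at 1 by ring. apply Cmod_triangle. }
  rewrite Cmod_mult, Cmod_R, Rabs_pos_eq in Hfin by lra. lra.
Qed.

Lemma dilations_uniformly_cauchy eps : 0 < eps -> exists s1, 0 < s1 < 1 /\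
  forall s s' z, s1 < s < 1 -> s1 < s' < 1 -> Cmod z <= 1 ->
    Cmod (F (RtoC s' * z) - F (RtoC s * z)) <= eps.
Proof.
  intros He.
  destruct (uniformly_integrable (eps / 4)) as (d & s0 & Hd & Hs0 & HU); [lra|].
  assert (Hosc : forall s th1 th2, s0 < s < 1 -> th1 <= th2 <= th1 + d ->
    Cmod (F (RtoC s * expi th2) - F (RtoC s * expi th1)) <= eps / 4).
  { intros s th1 th2 Hs Hth. eapply Rle_trans; [apply arc_oscillation_le; lra|]. now apply HU. }
  (* [s0] and 1/2 are the thresholds of [radial_le]; 1 - d forces s' - s < d, so that its bound is
     at most d * (4 * (eps / 4)). *)
  set (s1 := Rmax (Rmax s0 (1 / 2)) (1 - d)).
  assert (H1 : s0 <= s1) by (eapply Rle_trans; [apply Rmax_l|apply Rmax_l]).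
  assert (H2 : 1 / 2 <= s1) by (eapply Rle_trans; [apply Rmax_r|apply Rmax_l]).
  assert (H3 : 1 - d <= s1) by apply Rmax_r.
  assert (H4 : s1 < 1) by (repeat apply Rmax_lub_lt; lra).
  exists s1. split; [lra|].
  assert (Hle : forall s s' th, s1 < s -> s <= s' < 1 -> Cmod (F (RtoC s' * expi th) - F (RtoC s * expi th)) <= eps).
  { intros s s' th Hs Hs'.
    assert (H := radial_le (eps / 4) d s0 Hd Hs0 Hosc s s' th ltac:(lra) ltac:(lra) Hs').
    apply Rmult_le_reg_l with d; [exact Hd|]. nra. }
  assert (Hz : forall s s' z, s1 < s -> s <= s' < 1 -> Cmod z <= 1 -> Cmod (F (RtoC s' * z) - F (RtoC s * z)) <= eps).
  { intros s s' z Hs Hs' Hz.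
    (* The larger radius s' gives the smaller of the two domains, on which both dilates are
       analytic. *)
    apply (maximum_principle (1 / s') (fun z => (F (RtoC s' * z) - F (RtoC s * z))%C)); [apply Rinv_gt_1; lra| | |exact Hz].
    - intros w Hw. apply (ex_Cderive_plus (fun w => F (RtoC s' * w)%C) (fun w => (- F (RtoC s * w))%C)).
      + apply (holo_scale 1 F s' ltac:(lra) holo_primitive w Hw).
      + assert (D : ex_derive (K := C_AbsRing) (V := C_NormedModule) (fun w => (RtoC (-1) * F (RtoC s * w))%C) w).
        { apply (ex_Cderive_mult (fun _ => RtoC (-1)) (fun w => F (RtoC s * w)%C)); [apply ex_Cderive_const|].
          apply (holo_scale 1 F s ltac:(lra) holo_primitive w). eapply Rlt_le_trans; [exact Hw|].
          unfold Rdiv. apply Rmult_le_compat_l; [lra|]. apply Rinv_le_contravar; lra. }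
        revert D. apply ex_derive_ext. intros t.
        match goal with |- ?x = ?y => change (@eq C x y) end. replace (RtoC (-1)) with (- RtoC 1)%C by (symmetry; apply RtoC_opp). ring.
    - intros t. now apply Hle. }
  intros s s' z Hs Hs' Hz1. destruct (Rle_dec s s') as [H|H].
  - apply Hz; lra.
  - replace (_ - _)%C with (- (F (RtoC s * z) - F (RtoC s' * z)))%C by ring. rewrite Cmod_opp. apply Hz; lra.
Qed.

Lemma primitive_disc_algebra : disc_algebra F.
Proof.
  split; [exact holo_primitive|].
  set (sq := fun n : nat => 1 - / (INR n + 2)).
  assert (Hsq : forall n, 0 < sq n < 1).
  { intros n. unfold sq. assert (Hn := pos_INR n).
    assert (0 < / (INR n + 2)) by (apply Rinv_0_lt_compat; lra).
    assert (/ (INR n + 2) <= / 2) by (apply Rinv_le_contravar; lra). lra. }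
  assert (Hsq1 : forall s, s < 1 -> exists N, forall n, (N <= n)%nat -> s < sq n).
  { intros s Hs. destruct (INR_unbounded (/ (1 - s))) as [N HN].
    exists N. intros n Hn. unfold sq. apply le_INR in Hn.
    assert (Hp : 0 < / (1 - s)) by (apply Rinv_0_lt_compat; lra).
    assert (/ (INR n + 2) < / / (1 - s)) by (apply Rinv_lt_contravar; [apply Rmult_lt_0_compat; lra|lra]).
    rewrite Rinv_inv in H. lra. }
  (* The limit is required to inherit every Cauchy bound, so that the function chosen from this
     statement converges at the uniform rate of [dilations_uniformly_cauchy]. Outside the closed
     disc the value is an arbitrary 0. *)
  assert (Hlim : forall z, exists p, Cmod z <= 1 -> forall eps s1, 0 < eps ->
     (forall s s', s1 < s < 1 -> s1 < s' < 1 -> Cmod (F (RtoC s' * z) - F (RtoC s * z)) <= eps) -> s1 < 1 ->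
     forall s, s1 < s < 1 -> Cmod (F (RtoC s * z) - p) <= eps).
  { intros z. destruct (Rle_dec (Cmod z) 1) as [Hz|Hz]; [|exists (RtoC 0); intros; contradiction].
    destruct (C_cauchy_converges (fun n => F (RtoC (sq n) * z)%C)) as [p Hp].
    - intros eps He. destruct (dilations_uniformly_cauchy eps He) as (s1 & Hs1 & H).
      destruct (Hsq1 s1 ltac:(lra)) as [N HN]. exists N. intros n Hn.
      apply H; try exact Hz; split; try apply Hsq; apply HN; lia.
    - exists p. intros _ eps s1 He H Hs1 s Hs. apply Rle_plus_epsilon. intros e' He'.
      destruct (Hp e' He') as [N1 HN1]. destruct (Hsq1 s1 Hs1) as [N2 HN2].
      set (n := (N1 + N2)%nat). specialize (HN1 n ltac:(lia)). specialize (HN2 n ltac:(lia)).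
      replace (F (RtoC s * z) - p)%C with ((F (RtoC s * z) - F (RtoC (sq n) * z)) + (F (RtoC (sq n) * z) - p))%C by ring.
      eapply Rle_trans; [apply Cmod_triangle|]. apply Rplus_le_compat; [|exact HN1].
      apply H; [split; [exact HN2|apply Hsq]|exact Hs]. }
  set (E := fun z => proj1_sig (constructive_indefinite_description _ (Hlim z))).
  assert (HE : forall eps, 0 < eps -> exists s, 0 < s < 1 /\ forall z, Cmod z <= 1 ->
     forall s', s <= s' < 1 -> Cmod (F (RtoC s' * z) - E z) <= eps).
  { intros eps He. destruct (dilations_uniformly_cauchy eps He) as (s1 & Hs1 & H).
    exists ((s1 + 1) / 2). split; [lra|]. intros z Hz s' Hs'.
    apply (proj2_sig (constructive_indefinite_description _ (Hlim z)) Hz eps s1 He); try lra.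
    intros s s'' Hs Hs''. now apply H. }
  exists E. split.
  - apply continuous_on_C_iff. intros z Hz eps He.
    destruct (HE (eps / 4)) as (s & Hs & H); [lra|].
    assert (Hsz : forall w, Cmod w <= 1 -> Cmod (RtoC s * w) < 1).
    { intros w Hw. rewrite Cmod_mult, Cmod_R, Rabs_pos_eq by lra. assert (H0 := Cmod_ge_0 w). nra. }
    assert (He4 : 0 < eps / 4) by lra.
    destruct (proj1 (Ccontinuous_iff _ _) (holo_continuous 1 F _ holo_primitive (Hsz z Hz)) (mkposreal _ He4)) as [d Hd].
    simpl in Hd. exists d. split; [apply cond_pos|]. intros w Hw Hwz.
    assert (Hsw : Cmod (F (RtoC s * w) - F (RtoC s * z)) < eps / 4).
    { apply Hd. replace (RtoC s * w - RtoC s * z)%C with (RtoC s * (w - z))%C by ring.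
      rewrite Cmod_mult, Cmod_R, Rabs_pos_eq by lra. assert (H0 := Cmod_ge_0 (w - z)). nra. }
    assert (H1 := H w Hw s ltac:(lra)). assert (H2 := H z Hz s ltac:(lra)).
    replace (E w - E z)%C with (- (F (RtoC s * w) - E w) + ((F (RtoC s * w) - F (RtoC s * z)) + (F (RtoC s * z) - E z)))%C by ring.
    eapply Rle_lt_trans; [apply Cmod_triangle|]. rewrite Cmod_opp.
    assert (H3 := Cmod_triangle (F (RtoC s * w) - F (RtoC s * z)) (F (RtoC s * z) - E z)). lra.
  - intros z Hz. unfold unit_disc in Hz. symmetry. apply Ceq_minus, Cmod_eq_0. apply Rle_antisym; [|apply Cmod_ge_0].
    apply Rle_plus_epsilon. intros eps He. rewrite Rplus_0_l.
    assert (He2 : 0 < eps / 2) by lra.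
    destruct (HE (eps / 2) He2) as (s & Hs & H).
    destruct (proj1 (Ccontinuous_iff _ _) (holo_continuous 1 F _ holo_primitive Hz) (mkposreal _ He2)) as [d Hd]. simpl in Hd.
    set (s' := Rmax s (1 - d / 2)). assert (Hdp := cond_pos d).
    assert (Hs1 : s <= s') by apply Rmax_l. assert (Hs2 : 1 - d / 2 <= s') by apply Rmax_r.
    assert (Hs3 : s' < 1) by (apply Rmax_lub_lt; lra).
    (* Inside the disc the dilates also converge to [F] by continuity, which identifies the
       extension with [F] there. *)
    assert (Hd' : Cmod (F (RtoC s' * z) - F z) < eps / 2).
    { apply Hd. replace (RtoC s' * z - z)%C with (- (RtoC (1 - s') * z))%C by (rewrite RtoC_minus; ring).
      rewrite Cmod_opp, Cmod_mult, Cmod_R, Rabs_pos_eq by lra. assert (H0 := Cmod_ge_0 z). nra. }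
    specialize (H z ltac:(lra) s' ltac:(lra)).
    replace (F z - E z)%C with (- (F (RtoC s' * z) - F z) + (F (RtoC s' * z) - E z))%C by ring.
    eapply Rle_trans; [apply Cmod_triangle|]. rewrite Cmod_opp. lra.
Qed.
End Boundary.

(** * Difference quotients and growth *)

Lemma Lub_Rbar_bounded (E : R -> Prop) : Rbar_lt (Lub_Rbar E) p_infty <-> exists B, forall x, E x -> x <= B.
Proof.
  destruct (Lub_Rbar_correct E) as [H1 H2]. split.
  - intros H. destruct (Lub_Rbar E) as [B| |]; [|contradiction|].
    + exists B. intros x Hx. exact (H1 x Hx).
    (* The least upper bound is [m_infty] only for an empty set. *)
    + exists 0. intros x Hx. destruct (H1 x Hx).
  - intros [B HB]. apply Rbar_le_lt_trans with (Finite B); [|exact I]. apply H2. intros x Hx. now apply HB.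
Qed.

Lemma Hardy_infty_iff f :
  Hardy_infty f <-> holo 1 f /\ exists B, forall z, Cmod z < 1 -> Cmod (f z) <= B.
Proof.
  unfold Hardy_infty, sup_norm, sup_on_disc. rewrite Lub_Rbar_bounded. split.
  - intros [Hf [B HB]]. split; [exact Hf|]. exists B. intros z Hz. apply HB. now exists z.
  - intros [Hf [B HB]]. split; [exact Hf|]. exists B. intros x (z & Hz & ->). now apply HB.
Qed.

(** * Uniform continuity and boundedness on the closed disc *)

(** The radial retraction of the plane onto the closed disc. Composing with it makes a function on
    the disc continuous everywhere, so that uniform continuity on the square [-1,1]^2 can be
    used. *)
Definition clamp (z : C) : C := (RtoC (/ Rmax 1 (Cmod z)) * z)%C.

Lemma Rmax_1_pos x : 0 < Rmax 1 x.
Proof. apply Rlt_le_trans with 1; [lra|apply Rmax_l]. Qed.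

Lemma clamp_le z : Cmod (clamp z) <= 1.
Proof.
  assert (H := Rmax_1_pos (Cmod z)). assert (H' := Rmax_r 1 (Cmod z)).
  unfold clamp. rewrite Cmod_mult, Cmod_R, Rabs_pos_eq by (apply Rlt_le, Rinv_0_lt_compat, H).
  apply Rmult_le_reg_l with (Rmax 1 (Cmod z)); [exact H|]. rewrite <- Rmult_assoc, Rinv_r; lra.
Qed.

Lemma clamp_id z : Cmod z <= 1 -> clamp z = z.
Proof. intros Hz. unfold clamp. rewrite Rmax_left by exact Hz. rewrite Rinv_1. ring. Qed.

Lemma continuous_Rmax_1 x : continuous (Rmax 1) x.
Proof.
  apply (filterlim_locally (F := locally x)). intros eps. exists eps. intros y Hy.
  change (Rabs (Rmax 1 y - Rmax 1 x) < eps). change (Rabs (y - x) < eps) in Hy.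
  apply Rabs_def2 in Hy. apply Rabs_def1; unfold Rmax; destruct (Rle_dec 1 y), (Rle_dec 1 x);
    assert (H := cond_pos eps); lra.
Qed.

Lemma continuous_clamp z : Ccontinuous clamp z.
Proof.
  apply continuous_Cmult; [|apply continuous_id]. apply continuous_RtoC.
  apply (continuous_comp (fun z : C => Rmax 1 (Cmod z)) Rinv).
  - apply (continuous_comp Cmod (Rmax 1)); [|apply continuous_Rmax_1].
    apply (continuous_Cmod (fun z => z)), continuous_id.
  - apply continuous_Rinv, Rgt_not_eq, Rmax_1_pos.
Qed.

Lemma closed_disc_uniformly_continuous (e : C -> C) :
  continuous_on (T := C_UniformSpace) (U := C_UniformSpace) closed_unit_disc e ->
  forall eps, 0 < eps -> exists d, 0 < d /\ forall z w, Cmod z <= 1 -> Cmod w <= 1 ->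
    Cmod (z - w) < d -> Cmod (e z - e w) < eps.
Proof.
  intros He eps Heps. rewrite continuous_on_C_iff in He.
  assert (Hc : forall z, Ccontinuous (fun z => e (clamp z)) z).
  { intros z. apply Ccontinuous_iff. intros e'.
    destruct (He (clamp z) (clamp_le z) e' (cond_pos e')) as [d1 [Hd1 H1]].
    destruct (proj1 (Ccontinuous_iff _ _) (continuous_clamp z) (mkposreal _ Hd1)) as [d2 H2]. simpl in H2.
    exists d2. intros w Hw. apply H1; [apply clamp_le|now apply H2]. }
  assert (Heps2 : 0 < eps / 2) by lra.
  destruct (uniform_continuity_2d (fun x y => fst (e (clamp (x, y)))) (-1) 1 (-1) 1) with (eps := mkposreal _ Heps2) as [d1 H1].
  { intros x y _ _. apply (continuity_2d_pt_pair (fun p => fst (e (clamp p)))), continuous_C_fst, (Hc (x, y)). }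
  destruct (uniform_continuity_2d (fun x y => snd (e (clamp (x, y)))) (-1) 1 (-1) 1) with (eps := mkposreal _ Heps2) as [d2 H2].
  { intros x y _ _. apply (continuity_2d_pt_pair (fun p => snd (e (clamp p)))), continuous_C_snd, (Hc (x, y)). }
  simpl in H1, H2.
  exists (Rmin d1 d2). split; [apply Rmin_pos; apply cond_pos|].
  assert (Hb : forall z, Cmod z <= 1 -> -1 <= fst z <= 1 /\ -1 <= snd z <= 1).
  { intros z Hz. assert (H := Rmax_Cmod z). assert (Ha := Rmax_l (Rabs (fst z)) (Rabs (snd z))).
    assert (Hb := Rmax_r (Rabs (fst z)) (Rabs (snd z))).
    split; apply Rabs_le_between; lra. }
  intros z w Hz Hw Hzw.
  assert (Hzw1 := Rlt_le_trans _ _ _ Hzw (Rmin_l _ _)). assert (Hzw2 := Rlt_le_trans _ _ _ Hzw (Rmin_r _ _)).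
  assert (H := Rmax_Cmod (z - w)%C). assert (Ha := Rmax_l (Rabs (fst (z - w)%C)) (Rabs (snd (z - w)%C))).
  assert (Hb' := Rmax_r (Rabs (fst (z - w)%C)) (Rabs (snd (z - w)%C))).
  assert (F1 : Rabs (fst z - fst w) <= Cmod (z - w)) by (simpl in *; unfold Rminus; lra).
  assert (F2 : Rabs (snd z - snd w) <= Cmod (z - w)) by (simpl in *; unfold Rminus; lra).
  destruct (Hb z Hz), (Hb w Hw).
  specialize (H1 (fst w) (snd w) (fst z) (snd z)). specialize (H2 (fst w) (snd w) (fst z) (snd z)).
  rewrite <- !surjective_pairing, !clamp_id in H1, H2 by assumption.
  eapply Rle_lt_trans; [apply Cmod_le_Rabs_sum|].
  assert (K1 := H1 ltac:(assumption) ltac:(assumption) ltac:(assumption) ltac:(assumption) ltac:(lra) ltac:(lra)).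
  assert (K2 := H2 ltac:(assumption) ltac:(assumption) ltac:(assumption) ltac:(assumption) ltac:(lra) ltac:(lra)).
  simpl. unfold Rminus in *. lra.
Qed.

(** Walk from 0 to z in N steps shorter than the modulus of continuity for 1; each step changes |e|
    by at most 1. *)
Lemma closed_disc_bounded (e : C -> C) :
  continuous_on (T := C_UniformSpace) (U := C_UniformSpace) closed_unit_disc e ->
  exists B, forall z, Cmod z <= 1 -> Cmod (e z) <= B.
Proof.
  intros He. destruct (closed_disc_uniformly_continuous e He 1 Rlt_0_1) as [d [Hd H]].
  destruct (INR_unbounded (/ d)) as [N HN].
  assert (Hd' : 0 < / d) by now apply Rinv_0_lt_compat.
  assert (HN0 : 0 < INR N) by lra.
  assert (HNd : / INR N < d).
  { rewrite <- (Rinv_inv d). apply Rinv_lt_contravar; [apply Rmult_lt_0_compat; lra|lra]. }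
  exists (Cmod (e (RtoC 0)) + INR N). intros z Hz.
  assert (Hk : forall k, (k <= N)%nat -> Cmod (e (RtoC (INR k / INR N) * z)%C) <= Cmod (e (RtoC 0)) + INR k).
  { assert (Hin : forall k, (k <= N)%nat -> Cmod (RtoC (INR k / INR N) * z) <= 1).
    { intros k Hk. apply le_INR in Hk. assert (H0 := pos_INR k). assert (Hz0 := Cmod_ge_0 z).
      assert (Hq : 0 <= INR k / INR N <= 1).
      { split; [apply Rmult_le_pos; [lra|apply Rlt_le, Rinv_0_lt_compat; lra]|].
        apply Rmult_le_reg_r with (INR N); [lra|]. unfold Rdiv. rewrite Rmult_assoc, Rinv_l; lra. }
      rewrite Cmod_mult, Cmod_R, Rabs_pos_eq by lra. nra. }
    induction k; intros Hk.
    - simpl. replace (0 / INR N) with 0 by (field; lra). rewrite Cmult_0_l. lra.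
    - assert (Hs := H _ _ (Hin (S k) Hk) (Hin k ltac:(lia))).
      rewrite S_INR in *.
      replace (RtoC ((INR k + 1) / INR N) * z - RtoC (INR k / INR N) * z)%C with (RtoC (/ INR N) * z)%C in Hs.
      2: { replace ((INR k + 1) / INR N) with (INR k / INR N + / INR N) by (field; lra). rewrite RtoC_plus. ring. }
      rewrite Cmod_mult, Cmod_R, Rabs_pos_eq in Hs by (apply Rlt_le, Rinv_0_lt_compat; lra).
      assert (Hi : 0 < / INR N) by now apply Rinv_0_lt_compat.
      assert (Hz0 := Cmod_ge_0 z).
      specialize (Hs ltac:(nra)). specialize (IHk ltac:(lia)).
      set (x := e (RtoC ((INR k + 1) / INR N) * z)%C) in *. set (y := e (RtoC (INR k / INR N) * z)%C) in *.
      replace x with ((x - y) + y)%C by ring. eapply Rle_trans; [apply Cmod_triangle|]. lra. }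
  specialize (Hk N (le_n N)). replace (INR N / INR N) with 1 in Hk by (field; lra).
  now rewrite Cmult_1_l in Hk.
Qed.

Lemma disc_algebra_Hardy_infty f : disc_algebra f -> Hardy_infty f.
Proof.
  intros [Hf [e [He Hef]]]. apply Hardy_infty_iff. split; [exact Hf|].
  destruct (closed_disc_bounded e He) as [B HB]. exists B. intros z Hz. rewrite <- Hef by exact Hz. apply HB. lra.
Qed.

(** * Analyticity of the difference quotient *)

Lemma mean_value_circle_le rad (k : C -> C) s L : holo rad k -> 0 < s < rad ->
  (forall t, Cmod (k (RtoC s * expi t)%C) <= L) -> Cmod (k (RtoC 0)) <= L.
Proof.
  intros Hk Hs HL.
  assert (H1 : 1 < rad / s).
  { apply Rmult_lt_reg_r with s; [lra|]. unfold Rdiv. rewrite Rmult_assoc, Rinv_l; lra. }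
  assert (H := mean_value_le (rad / s) _ H1 (holo_scale rad k s ltac:(lra) Hk) L). cbv beta in H.
  rewrite Cmult_0_r in H. apply H. intros t _. apply HL.
Qed.

(* The difference quotient of the primitive of [h] vanishing at [0]; for [h = f g'] it is [T_g f]. *)
Definition quotient (h : C -> C) (z : C) : C :=
  if Ceq_dec z (RtoC 0) then h (RtoC 0) else (/ z * integral_from_0 h z)%C.

Section Quotient.
Context (rad : R) (h : C -> C) (Hrad : 0 < rad) (Hh : holo rad h).

Lemma quotient_0 : quotient h (RtoC 0) = h (RtoC 0).
Proof. unfold quotient. destruct (Ceq_dec 0 0); [reflexivity|contradiction]. Qed.

Lemma quotient_nz z : z <> RtoC 0 -> quotient h z = (/ z * integral_from_0 h z)%C.
Proof. intros Hz. unfold quotient. destruct (Ceq_dec z 0); [contradiction|reflexivity]. Qed.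

Lemma integral_from_0_0 : integral_from_0 h (RtoC 0) = RtoC 0.
Proof.
  rewrite integral_from_0_seg. unfold seg.
  rewrite (CInt_ext _ (fun _ => RtoC 0)); [rewrite CInt_const; ring|]. intros t _. ring.
Qed.

Lemma primitive_eq_quotient z : integral_from_0 h z = (z * quotient h z)%C.
Proof.
  destruct (Ceq_dec z (RtoC 0)) as [->|Hz].
  - rewrite integral_from_0_0. ring.
  - rewrite quotient_nz by exact Hz. now field.
Qed.

Lemma holo_quotient : holo rad (quotient h).
Proof.
  intros z Hz. destruct (Ceq_dec z (RtoC 0)) as [->|Hz0].
  - destruct (Hh (RtoC 0) ltac:(rewrite Cmod_0; exact Hrad)) as [l Hl].
    (* Near 0 the primitive is h(0) w + l w^2 / 2 + o(w^2); dividing by w leaves the slope l/2. *)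
    exists (l / RtoC 2)%C. apply Cderive_iff. intros eps.
    destruct (proj1 (Cderive_iff _ _ _) Hl eps) as [d Hd].
    assert (Hp : 0 < Rmin d rad) by (apply Rmin_pos; [apply cond_pos|exact Hrad]).
    exists (mkposreal _ Hp); simpl; intros w Hw.
    assert (H1 := Rlt_le_trans _ _ _ Hw (Rmin_l _ _)). assert (H2 := Rlt_le_trans _ _ _ Hw (Rmin_r _ _)).
    replace (w - 0)%C with w in * by ring. rewrite quotient_0.
    destruct (Ceq_dec w (RtoC 0)) as [->|Hw0].
    + rewrite quotient_0, Cmod_0. replace (_ - _)%C with (RtoC 0) by field.
      rewrite Cmod_0. lra.
    + rewrite quotient_nz, integral_from_0_seg by exact Hw0.
      assert (S := seg_affine_close rad h Hh (RtoC 0) w (h (RtoC 0)) l (RtoC 0) (eps * Cmod w)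
         ltac:(rewrite Cmod_0; exact Hrad) H2).
      assert (Hwp : 0 < Cmod w) by now apply Cmod_gt_0.
      set (A := (seg h 0 w - _)%C) in S.
      replace (/ w * seg h 0 w - h 0 - w * (l / 2))%C with (/ w * A)%C by (unfold A; field; exact Hw0).
      rewrite Cmod_mult, Cmod_inv by exact Hw0.
      apply Rmult_le_reg_l with (Cmod w); [exact Hwp|]. rewrite <- Rmult_assoc, Rinv_r, Rmult_1_l by lra.
      replace (w - 0)%C with w in S by ring. rewrite (Rmult_comm (Cmod w)). apply S. intros t Ht.
      assert (E : point 0 w t = (RtoC t * w)%C) by (unfold point; ring). rewrite E.
      assert (Htw : Cmod (RtoC t * w) <= Cmod w) by (rewrite Cmod_mult, Cmod_R, Rabs_pos_eq by lra; nra).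
      specialize (Hd (RtoC t * w)%C). replace (RtoC t * w - 0)%C with (RtoC t * w)%C in * by ring.
      replace (h (RtoC t * w)%C - (h 0 + l * (RtoC t * w)))%C with (h (RtoC t * w) - h 0 - RtoC t * w * l)%C by ring.
      eapply Rle_trans; [apply Hd; lra|]. apply Rmult_le_compat_l; [apply Rlt_le, cond_pos|exact Htw].
  - assert (D : ex_derive (K := C_AbsRing) (V := C_NormedModule) (fun w => (/ w * integral_from_0 h w)%C) z).
    { apply (ex_Cderive_mult Cinv (integral_from_0 h)).
      - eexists. now apply Cderive_inv.
      - eexists. now apply (integral_from_0_derive rad). }
    revert D. apply ex_derive_ext_loc.
    assert (Hzp : 0 < Cmod z) by now apply Cmod_gt_0.
    (* The disc of radius |z| about z avoids 0, where the quotient has its separate value. *)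
    exists (mkposreal _ Hzp). intros w Hw. symmetry. apply quotient_nz. intros ->.
    change (Cmod (0 - z) < Cmod z) in Hw. replace (0 - z)%C with (- z)%C in Hw by ring. rewrite Cmod_opp in Hw. lra.
Qed.
End Quotient.

(** * Primitive versus quotient in the two spaces, and growth of the integrand *)

Section Equivalence.
Context (h : C -> C) (Hh : holo 1 h).
Let F := integral_from_0 h.

Lemma primitive_difference z w : Cmod z < 1 -> Cmod (z + w) < 1 ->
  integral_from_0 (fun u => h (z + u)%C) w = (F (z + w) - F z)%C.
Proof.
  intros Hz Hzw. assert (H0 : Cmod 0 < 1) by (rewrite Cmod_0; lra).
  assert (G := goursat 1 h Hh (RtoC 0) z (z + w)%C H0 Hz Hzw). unfold tri in G.
  rewrite (seg_rev 1 h Hh 0 (z + w)) in G by assumption.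
  unfold F. rewrite (integral_from_0_seg h (z + w)%C), (integral_from_0_seg h z).
  replace (integral_from_0 (fun u => h (z + u)%C) w) with (seg h z (z + w)).
  - replace (seg h z (z + w)) with (seg h 0 (z + w) - seg h 0 z + (seg h 0 z + seg h z (z + w) + - seg h 0 (z + w)))%C by ring.
    rewrite G. ring.
  - apply CInt_ext. intros t _. unfold point. replace (z + w - z)%C with w by ring. reflexivity.
Qed.

(** The difference quotient of [F] based at z is analytic with value h(z) at the centre and modulus
    at most L/s on the circle of radius s, so the mean value inequality gives the estimate. *)
Lemma cauchy_estimate z s L : Cmod z < 1 -> 0 < s < 1 - Cmod z ->
  (forall t, Cmod (F (z + RtoC s * expi t) - F z) <= L) -> s * Cmod (h z) <= L.
Proof.
  intros Hz Hs HL.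
  assert (Hk : holo (1 - Cmod z) (fun u => h (z + u)%C)).
  { intros u Hu. apply (ex_Cderive_comp h (fun u => (z + u)%C)).
    - apply Hh. eapply Rle_lt_trans; [apply Cmod_triangle|]. lra.
    - apply (ex_Cderive_plus (fun _ => z) (fun u => u)); [apply ex_Cderive_const|apply ex_Cderive_id]. }
  assert (H := mean_value_circle_le (1 - Cmod z) (quotient (fun u => h (z + u)%C)) s (L / s)
    (holo_quotient (1 - Cmod z) _ ltac:(lra) Hk) Hs).
  rewrite quotient_0, Cplus_0_r in H.
  apply Rmult_le_reg_r with (/ s); [apply Rinv_0_lt_compat; lra|].
  rewrite (Rmult_comm s), Rmult_assoc, Rinv_r, Rmult_1_r by lra. apply H. intros t.
  assert (Hc : Cmod (RtoC s * expi t) = s) by (rewrite Cmod_circle, Rabs_pos_eq; lra).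
  assert (Hnz : (RtoC s * expi t)%C <> RtoC 0) by (apply Cmod_gt_0; lra).
  rewrite quotient_nz, primitive_difference; [|exact Hz| |exact Hnz].
  - rewrite Cmod_mult, Cmod_inv, Hc by exact Hnz. unfold Rdiv. rewrite Rmult_comm.
    apply Rmult_le_compat_r; [apply Rlt_le, Rinv_0_lt_compat; lra|apply HL].
  - eapply Rle_lt_trans; [apply Cmod_triangle|]. lra.
Qed.

(** The radius tends to 1 - |z|. Only points w closer to z than that are compared; this is what lets
    uniform continuity produce the little-o bound. *)
Lemma cauchy_estimate_sup z L : Cmod z < 1 ->
  (forall w, Cmod w < 1 -> Cmod (w - z) < 1 - Cmod z -> Cmod (F w - F z) <= L) -> (1 - Cmod z) * Cmod (h z) <= L.
Proof.
  intros Hz HL. apply Rle_plus_epsilon. intros eps He.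
  assert (H0 := Cmod_ge_0 (h z)).
  set (e := Rmin (1 - Cmod z) (eps / (Cmod (h z) + 1)) / 2).
  assert (Hm : 0 < Rmin (1 - Cmod z) (eps / (Cmod (h z) + 1))) by (apply Rmin_pos; [lra|apply Rdiv_lt_0_compat; lra]).
  assert (He1 : e < 1 - Cmod z) by (unfold e; assert (H := Rmin_l (1 - Cmod z) (eps / (Cmod (h z) + 1))); lra).
  assert (He2 : e <= eps / (Cmod (h z) + 1)) by (unfold e; assert (H := Rmin_r (1 - Cmod z) (eps / (Cmod (h z) + 1))); lra).
  assert (He0 : 0 < e) by (unfold e; lra).
  assert (H := cauchy_estimate z (1 - Cmod z - e) L Hz ltac:(lra)).
  assert (Hs : (1 - Cmod z - e) * Cmod (h z) <= L).
  { apply H. intros t.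
    assert (Hc : Cmod (RtoC (1 - Cmod z - e) * expi t) = 1 - Cmod z - e) by (rewrite Cmod_circle, Rabs_pos_eq; lra).
    apply HL.
    - eapply Rle_lt_trans; [apply Cmod_triangle|]. lra.
    - replace (z + RtoC (1 - Cmod z - e) * expi t - z)%C with (RtoC (1 - Cmod z - e) * expi t)%C by ring. lra. }
  assert (Heh : e * (Cmod (h z) + 1) <= eps).
  { apply (Rmult_le_compat_r (Cmod (h z) + 1)) in He2; [|lra].
    unfold Rdiv in He2. rewrite Rmult_assoc, Rinv_l in He2; lra. }
  nra.
Qed.

(** Where |z| >= 1/2, division by z costs a factor 2; the maximum principle on the disc of radius
    1/2 carries the bound across 0. *)
Lemma Hardy_infty_quotient : Hardy_infty F <-> Hardy_infty (quotient h).
Proof.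
  rewrite !Hardy_infty_iff. split.
  - intros [_ [B HB]]. split; [apply (holo_quotient 1); [lra|exact Hh]|]. exists (2 * B).
    assert (Hfar : forall z, 1 / 2 <= Cmod z -> Cmod z < 1 -> Cmod (quotient h z) <= 2 * B).
    { intros z Hz1 Hz2. assert (Hz : z <> RtoC 0) by (apply Cmod_gt_0; lra).
      assert (H := HB z Hz2). unfold F in H. rewrite primitive_eq_quotient, Cmod_mult in H.
      assert (H0 := Cmod_ge_0 (quotient h z)). nra. }
    intros z Hz. destruct (Rle_dec (1 / 2) (Cmod z)) as [H|H]; [now apply Hfar|].
    assert (Hq : holo (1 / (1 / 2)) (fun w => quotient h (RtoC (1 / 2) * w)%C)).
    { apply holo_scale; [lra|]. apply (holo_quotient 1); [lra|exact Hh]. }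
    assert (M := maximum_principle (1 / (1 / 2)) _ (Rinv_gt_1 (1 / 2) ltac:(lra)) Hq (2 * B)). cbv beta in M.
    specialize (M ltac:(intros t; apply Hfar; rewrite Cmod_circle, Rabs_pos_eq; lra) (RtoC 2 * z)%C).
    rewrite Cmult_assoc, <- RtoC_mult in M. replace (1 / 2 * 2) with 1 in M by field. rewrite Cmult_1_l in M.
    apply M. rewrite Cmod_mult, Cmod_R, Rabs_pos_eq; lra.
  - intros [_ [B HB]]. split; [apply (holo_primitive h Hh)|]. exists B. intros z Hz.
    unfold F. rewrite primitive_eq_quotient, Cmod_mult. assert (H := HB z Hz).
    assert (H0 := Cmod_ge_0 (quotient h z)). assert (H1 := Cmod_ge_0 z). nra.
Qed.

Lemma disc_algebra_quotient : disc_algebra F <-> disc_algebra (quotient h).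
Proof.
  split.
  - intros [_ [e [He Hef]]]. assert (HQ : holo 1 (quotient h)) by (apply holo_quotient; [lra|exact Hh]).
    split; [exact HQ|]. rewrite continuous_on_C_iff in He.
    (* The two branches agree off 0 by [Hval]; the first one is needed only to cross the origin. *)
    exists (fun z => if Rlt_dec (Cmod z) 1 then quotient h z else (/ z * e z)%C).
    assert (Hval : forall z, z <> RtoC 0 -> Cmod z <= 1 ->
      (if Rlt_dec (Cmod z) 1 then quotient h z else (/ z * e z)%C) = (/ z * e z)%C).
    { intros z Hz Hz1. destruct (Rlt_dec (Cmod z) 1) as [H|H]; [|reflexivity].
      rewrite quotient_nz, Hef; [reflexivity|exact H|exact Hz]. }
    split.
    + apply continuous_on_C_iff. intros z Hz eps Heps.
      destruct (Rlt_dec (Cmod z) 1) as [Hz1|Hz1].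
      * destruct (proj1 (Ccontinuous_iff _ _) (holo_continuous 1 _ z HQ Hz1) (mkposreal _ Heps)) as [d Hd]. simpl in Hd.
        exists (Rmin d (1 - Cmod z)). split; [apply Rmin_pos; [apply cond_pos|lra]|].
        intros w Hw Hwz.
        assert (H1 := Rlt_le_trans _ _ _ Hwz (Rmin_l _ _)). assert (H2 := Rlt_le_trans _ _ _ Hwz (Rmin_r _ _)).
        assert (Hw1 : Cmod w < 1).
        { replace w with (z + (w - z))%C by ring. eapply Rle_lt_trans; [apply Cmod_triangle|]. lra. }
        destruct (Rlt_dec (Cmod w) 1); [now apply Hd|contradiction].
      * assert (Hzm : Cmod z = 1) by (unfold closed_unit_disc in Hz; lra).
        assert (Hz0 : z <> RtoC 0) by (apply Cmod_gt_0; lra).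
        assert (Hez := Cmod_ge_0 (e z)).
        destruct (He z Hz (eps / 4)) as [d [Hd0 Hd]]; [lra|].
        (* The two terms contribute eps/4 each, and the factor 1/|w| is at most 2. *)
        set (d2 := eps / (4 * (Cmod (e z) + 1))).
        assert (Hd2 : 0 < d2) by (apply Rdiv_lt_0_compat; lra).
        exists (Rmin (1 / 2) (Rmin d d2)). split; [repeat apply Rmin_pos; lra|].
        intros w Hw Hwz.
        assert (H1 := Rlt_le_trans _ _ _ Hwz (Rmin_l _ _)).
        assert (H23 := Rlt_le_trans _ _ _ Hwz (Rmin_r _ _)).
        assert (H2 := Rlt_le_trans _ _ _ H23 (Rmin_l _ _)). assert (H3 := Rlt_le_trans _ _ _ H23 (Rmin_r _ _)).
        assert (Hwm : 1 / 2 <= Cmod w).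
        { assert (Ht := Cmod_triangle w (- (w - z))). replace (w + - (w - z))%C with z in Ht by ring.
          rewrite Cmod_opp in Ht. lra. }
        assert (Hw0 : w <> RtoC 0) by (apply Cmod_gt_0; lra).
        rewrite (Hval w Hw0 Hw).
        replace (/ w * e w - / z * e z)%C with (/ w * ((e w - e z) + - (/ z * (w - z) * e z)))%C by (field; split; assumption).
        rewrite Cmod_mult, Cmod_inv by exact Hw0.
        apply Rmult_lt_reg_l with (Cmod w); [lra|]. rewrite <- Rmult_assoc, Rinv_r, Rmult_1_l by lra.
        eapply Rle_lt_trans; [apply Cmod_triangle|]. rewrite Cmod_opp, !Cmod_mult, Cmod_inv, Hzm by exact Hz0.
        rewrite Rinv_1, Rmult_1_l. specialize (Hd w Hw H2).
        assert (K : Cmod (w - z) * Cmod (e z) <= eps / 4).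
        { apply Rle_trans with (d2 * (Cmod (e z) + 1)).
          - apply Rmult_le_compat; try apply Cmod_ge_0; lra.
          - apply Req_le. unfold d2. field. lra. }
        nra.
    + intros z Hz. unfold unit_disc in Hz. destruct (Rlt_dec (Cmod z) 1); [reflexivity|contradiction].
  - intros [_ [e [He Hef]]]. split; [apply (holo_primitive h Hh)|].
    rewrite continuous_on_C_iff in He.
    exists (fun z => (z * e z)%C). split.
    + apply continuous_on_C_iff. intros z Hz eps Heps.
      assert (Hez := Cmod_ge_0 (e z)).
      destruct (He z Hz (eps / 2)) as [d [Hd0 Hd]]; [lra|].
      set (d2 := eps / (2 * (Cmod (e z) + 1))).
      assert (Hd2 : 0 < d2) by (apply Rdiv_lt_0_compat; lra).
      exists (Rmin d d2). split; [apply Rmin_pos; lra|]. intros w Hw Hwz.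
      assert (H2 := Rlt_le_trans _ _ _ Hwz (Rmin_l _ _)). assert (H3 := Rlt_le_trans _ _ _ Hwz (Rmin_r _ _)).
      replace (w * e w - z * e z)%C with (w * (e w - e z) + (w - z) * e z)%C by ring.
      eapply Rle_lt_trans; [apply Cmod_triangle|]. rewrite !Cmod_mult. specialize (Hd w Hw H2).
      unfold closed_unit_disc in Hw.
      assert (K : Cmod (w - z) * Cmod (e z) <= eps / 2).
      { apply Rle_trans with (d2 * (Cmod (e z) + 1)).
        - apply Rmult_le_compat; try apply Cmod_ge_0; lra.
        - apply Req_le. unfold d2. field. lra. }
      assert (H0 := Cmod_ge_0 (e w - e z)). assert (Hw0 := Cmod_ge_0 w). nra.
    + intros z Hz. rewrite Hef by exact Hz. symmetry. apply primitive_eq_quotient.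
Qed.

Lemma primitive_growth : Hardy_infty F -> exists B, forall z, Cmod z < 1 -> (1 - Cmod z) * Cmod (h z) <= B.
Proof.
  intros H. destruct (proj1 (Hardy_infty_iff F) H) as [_ [B HB]].
  exists (2 * B). intros z Hz. apply cauchy_estimate_sup; [exact Hz|]. intros w Hw _.
  unfold Cminus. eapply Rle_trans; [apply Cmod_triangle|]. rewrite Cmod_opp.
  assert (H1 := HB z Hz). assert (H2 := HB w Hw). lra.
Qed.

Lemma primitive_little_growth : disc_algebra F ->
  forall eps, 0 < eps -> exists d, 0 < d /\
    forall z, Cmod z < 1 -> 1 - Cmod z < d -> (1 - Cmod z) * Cmod (h z) <= eps.
Proof.
  intros [_ [e [He Hef]]] eps Heps.
  destruct (closed_disc_uniformly_continuous e He eps Heps) as [d [Hd H]].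
  exists d. split; [exact Hd|]. intros z Hz Hzd. apply cauchy_estimate_sup; [exact Hz|]. intros w Hw Hwz.
  rewrite <- (Hef w Hw), <- (Hef z Hz). apply Rlt_le, H; lra.
Qed.
End Equivalence.

(** * The inclusions and equalities of the optimal domains *)

Theorem proposition3p18 :
  forall (g : C -> C)
    (g_analytic : analytic_on_disc g)
    (g'_bounded : Hardy_infty (C_derive g))
    (g'_neq_0 : forall z : C, unit_disc z -> C_derive g z <> RtoC 0)
    (inv_g'_bounded : Hardy_infty (fun z : C => (/ C_derive g z)%C))
    (Vg_continuous : continuous_operator disc_algebra sup_norm (volterra g)),
  ( (forall f : C -> C,
       Hardy_1 f -> opt_domain (volterra g) disc_algebra f) /\
    (forall f : C -> C,
       opt_domain (volterra g) disc_algebra f <->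
       opt_domain (cesaro g) disc_algebra f) /\
    (forall f : C -> C,
       opt_domain (cesaro g) disc_algebra f -> little_growth_space f) )
  /\
  ( (forall f : C -> C,
       Hardy_1 f -> opt_domain (volterra g) Hardy_infty f) /\
    (forall f : C -> C,
       opt_domain (volterra g) Hardy_infty f <->
       opt_domain (cesaro g) Hardy_infty f) /\
    (forall f : C -> C,
       opt_domain (cesaro g) Hardy_infty f -> growth_space f) ).
Proof.
  intros g _ Hg' Hnz Hinv _.
  destruct (proj1 (Hardy_infty_iff _) Hg') as [Hg'' [Bg HBg]].
  destruct (proj1 (Hardy_infty_iff _) Hinv) as [_ [Bi HBi]].
  assert (Hh : forall f, analytic_on_disc f -> holo 1 (fun xi => (f xi * C_derive g xi)%C)).
  { intros f Hf z Hz. apply (ex_Cderive_mult f (C_derive g)); [now apply Hf|now apply Hg'']. }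
  (* Boundedness of 1/g' enters here: growth bounds for f g' become growth bounds for f. *)
  assert (Hfh : forall f z, Cmod z < 1 -> Cmod (f z) <= Bi * Cmod (f z * C_derive g z)).
  { intros f z Hz. assert (H := HBi z Hz). assert (H0 := Hnz z Hz).
    replace (f z) with (/ C_derive g z * (f z * C_derive g z))%C at 1 by now field.
    rewrite Cmod_mult. apply Rmult_le_compat_r; [apply Cmod_ge_0|exact H]. }
  assert (HBi0 : 0 <= Bi).
  { eapply Rle_trans; [apply Cmod_ge_0|]. apply (HBi (RtoC 0)). rewrite Cmod_0; lra. }
  assert (HBg0 : 0 <= Bg).
  { eapply Rle_trans; [apply Cmod_ge_0|]. apply (HBg (RtoC 0)). rewrite Cmod_0; lra. }
  assert (H1 : forall f, Hardy_1 f -> opt_domain (volterra g) disc_algebra f).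
  { intros f [Hf Hn]. split; [exact Hf|].
    apply Lub_Rbar_bounded in Hn. destruct Hn as [B HB].
    (* 2 PI undoes the normalisation of [integral_mean], and [Bg] bounds g'. *)
    apply (primitive_disc_algebra _ (Hh f Hf) (Bg * (2 * PI * B))). intros s Hs.
    assert (HPI := PI_RGT_0).
    assert (HBs := HB _ (ex_intro _ s (conj Hs eq_refl))). unfold integral_mean in HBs.
    apply Rle_trans with (RInt (fun t => Bg * Cmod (f (RtoC s * expi t)%C)) 0 (2 * PI)).
    - apply RInt_le; [lra| | |].
      + apply ex_RInt_all. intros t. exact (continuous_Cmod_circle _ (Hh f Hf) s t Hs).
      + apply ex_RInt_all. intros t. apply continuous_Rmult; [apply continuous_const|].
        exact (continuous_Cmod_circle f Hf s t Hs).
      + intros t _. rewrite Cmod_mult, Rmult_comm. apply Rmult_le_compat_r; [apply Cmod_ge_0|].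
        apply HBg. rewrite Cmod_circle, Rabs_pos_eq; lra.
    - rewrite (RInt_scal (V := R_CompleteNormedModule) (fun t => Cmod (f (RtoC s * expi t)%C))).
      2: { apply ex_RInt_all. intros t. exact (continuous_Cmod_circle f Hf s t Hs). }
      apply Rmult_le_compat_l; [exact HBg0|].
      apply Rmult_le_reg_l with (/ (2 * PI)); [apply Rinv_0_lt_compat; lra|].
      eapply Rle_trans; [exact HBs|]. apply Req_le. field. lra. }
  assert (H2 : forall f, opt_domain (volterra g) disc_algebra f <-> opt_domain (cesaro g) disc_algebra f).
  { intros f. split; intros [Hf HX]; (split; [exact Hf|]).
    (* For h = f g', [volterra g f] and [cesaro g f] unfold to [integral_from_0 h] and
       [quotient h]. *)
    - now apply (disc_algebra_quotient _ (Hh f Hf)).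
    - now apply (disc_algebra_quotient _ (Hh f Hf)). }
  assert (H3 : forall f, opt_domain (volterra g) Hardy_infty f <-> opt_domain (cesaro g) Hardy_infty f).
  { intros f. split; intros [Hf HX]; (split; [exact Hf|]).
    - now apply (Hardy_infty_quotient _ (Hh f Hf)).
    - now apply (Hardy_infty_quotient _ (Hh f Hf)). }
  split; (split; [|split]).
  - exact H1.
  - exact H2.
  - intros f HT. destruct (proj2 (H2 f) HT) as [Hf HX]. split; [exact Hf|].
    intros P [eps HP].
    (* Leaves room for the factor [Bi] of [Hfh]; the summand 1 covers a bound equal to 0. *)
    assert (He : 0 < eps / (2 * (Bi + 1))) by (apply Rdiv_lt_0_compat; [apply cond_pos|lra]).
    destruct (primitive_little_growth _ (Hh f Hf) HX _ He) as [d [Hd Hlg]].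
    exists (mkposreal _ Hd). intros r Hr Hr1 z <-.
    change (Rabs (Cmod z - 1) < d) in Hr. apply Rabs_def2 in Hr.
    apply HP. change (Rabs ((1 - Cmod z) * Cmod (f z) - 0) < eps).
    rewrite Rminus_0_r, Rabs_pos_eq by (apply Rmult_le_pos; [lra|apply Cmod_ge_0]).
    specialize (Hlg z Hr1 ltac:(lra)). assert (K := Hfh f z Hr1).
    apply Rle_lt_trans with (Bi * (eps / (2 * (Bi + 1)))).
    + apply Rle_trans with (Bi * ((1 - Cmod z) * Cmod (f z * C_derive g z))); [|now apply Rmult_le_compat_l].
      replace (Bi * ((1 - Cmod z) * Cmod (f z * C_derive g z))) with ((1 - Cmod z) * (Bi * Cmod (f z * C_derive g z))) by ring.
      apply Rmult_le_compat_l; lra.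
    + assert (Hep := cond_pos eps). apply Rmult_lt_reg_r with (2 * (Bi + 1)); [lra|].
      replace (Bi * (eps / (2 * (Bi + 1))) * (2 * (Bi + 1))) with (Bi * eps) by (field; lra). nra.
  - intros f Hf. destruct (H1 f Hf) as [Hf' HX]. split; [exact Hf'|]. now apply disc_algebra_Hardy_infty.
  - exact H3.
  - intros f HT. destruct (proj2 (H3 f) HT) as [Hf HX]. split; [exact Hf|].
    destruct (primitive_growth _ (Hh f Hf) HX) as [B HB].
    apply Lub_Rbar_bounded. exists (Bi * B). intros x (z & Hz & ->). unfold unit_disc in Hz.
    assert (K := Hfh f z Hz). apply Rle_trans with (Bi * ((1 - Cmod z) * Cmod (f z * C_derive g z))); [|now apply Rmult_le_compat_l, HB].
    replace (Bi * ((1 - Cmod z) * Cmod (f z * C_derive g z))) with ((1 - Cmod z) * (Bi * Cmod (f z * C_derive g z))) by ring.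
    apply Rmult_le_compat_l; lra.
Qed.
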